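(* Let $g:\mathbb{R}_+\to\mathbb{R}_+$ be convex with $g(0)=0$ and let $\chi>0$. Suppose the probability space supports a $d$-dimensional Brownian motion $(B_t)_{t\in[0,T]}$ whose augmented natural filtration $\mathbb{G}=(\mathcal{G}_t)_{t\in[0,T]}$ satisfies that $\mathcal{G}_T$ is independent of $\mathcal{F}_T$, and let $\mathcal{H}_t=\mathcal{F}_t\vee\mathcal{G}_t$, $\mathbb{H}=(\mathcal{H}_t)_{t\in[0,T]}$. Assume that $S=(S_t)_{t\in[0,T]}$ is a c\`adl\`ag $\mathbb{R}^d$-valued $\mathbb{F}$-local martingale under $P$ which is sticky with respect to $\mathbb{F}$. Then there exist $Q\sim P$ with $\|Q-P\|_{tv}<\chi$ and a $d$-dimensional $Q$-martingale $\tilde S$ with respect to $\mathbb{H}$ such that $$E_Q\, g\Big(\sup_{t\in[0,T]}|S_t-\tilde S_t|\Big)<\chi.$$ If $S$ has continuous trajectories then even $\sup_{t\in[0,T]}|S_t-\tilde S_t|<\chi$ holds a.s. Finally, $S$ is also a local martingale with respect to $\mathbb{H}$.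
   Context: $(\Omega,\mathcal{F},P)$ is a probability space with a filtration $\mathbb{F}=(\mathcal{F}_t)_{t\in[0,T]}$ satisfying the usual conditions (right-continuous, $\mathcal{F}_0$ contains all $P$-null sets). $\|\cdot\|_{tv}$ is the total variation norm of finite signed measures on $(\Omega,\mathcal{F})$. $|\cdot|$ is the Euclidean norm. A process $S$ is sticky with respect to $\mathbb{F}$ if for every $\mathbb{F}$-stopping time $\tau$ with values in $[0,T]$ and every strictly positive $\mathcal{F}_\tau$-measurable random variable $\kappa$, $P(\sup_{u\in[\tau,T]}|S_u-S_\tau|<\kappa\mid\mathcal{F}_\tau)>0$ a.s. *)

(* Defs.v *)
From HB Require Import structures.
From mathcomp Require Import all_boot all_order all_algebra.
From mathcomp Require Import all_classical all_reals all_analysis measurable_realfun.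
Set Implicit Arguments. Unset Strict Implicit. Unset Printing Implicit Defensive.
Import Order.TTheory GRing.Theory Num.Theory.
Import numFieldNormedType.Exports.
Local Open Scope classical_set_scope.
Local Open Scope ring_scope.

Section Defs.
Context {R : realType} {d : measure_display} {Omega : measurableType d}.
Implicit Types (mu P Q : probability Omega R) (T : R).

Definition enorm (n : nat) (v : 'rV[R]_n) : R :=
  Num.sqrt (\sum_(i < n) v ord0 i ^+ 2).

Definition sub_sigma (G : set (set Omega)) :=
  sigma_algebra setT G /\ G `<=` measurable.

Definition Pnull mu (A : set Omega) :=
  exists N, [/\ measurable N, mu N = 0%E & A `<=` N].

Definition filtration T (F : R -> set (set Omega)) :=
  (forall t, 0 <= t <= T -> sub_sigma (F t)) /\
  (forall s t, 0 <= s -> s <= t -> t <= T -> F s `<=` F t).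

Definition usual_conditions P T (F : R -> set (set Omega)) :=
  [/\ filtration T F,
      (forall t, 0 <= t < T -> forall A, (forall s, t < s <= T -> F s A) -> F t A)
    & (forall A, Pnull P A -> F 0 A)].

Definition stopping_time T (F : R -> set (set Omega)) (tau : Omega -> R) :=
  (forall w, 0 <= tau w <= T) /\
  (forall t, 0 <= t <= T -> F t [set w | tau w <= t]).

Definition sigma_at T (F : R -> set (set Omega)) (tau : Omega -> R) : set (set Omega) :=
  [set A | measurable A /\
     forall t, 0 <= t <= T -> F t (A `&` [set w | tau w <= t])].

Definition meas_wrt (G : set (set Omega)) (X : Omega -> R) :=
  forall B : set R, measurable B -> G (X @^-1` B).

Definition cond_exp mu (G : set (set Omega)) (X Y : Omega -> R) :=
  [/\ meas_wrt G Y, mu.-integrable setT (EFin \o Y)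
    & forall A, G A -> (\int[mu]_(w in A) (Y w)%:E = \int[mu]_(w in A) (X w)%:E)%E].

Definition martingale mu T (F : R -> set (set Omega)) (n : nat)
    (X : R -> Omega -> 'rV[R]_n) :=
  forall i : 'I_n,
    (forall t, 0 <= t <= T ->
       meas_wrt (F t) (fun w => X t w ord0 i) /\
       mu.-integrable setT (fun w => (X t w ord0 i)%:E)) /\
    (forall s t, 0 <= s -> s <= t -> t <= T ->
       cond_exp mu (F s) (fun w => X t w ord0 i) (fun w => X s w ord0 i)).

Definition stopped (n : nat) (X : R -> Omega -> 'rV[R]_n) (tau : Omega -> R) :=
  fun t w => X (Num.min t (tau w)) w.

Definition local_martingale mu T (F : R -> set (set Omega)) (n : nat)
    (X : R -> Omega -> 'rV[R]_n) :=
  exists tau : nat -> Omega -> R,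
    [/\ forall k, stopping_time T F (tau k),
        forall k w, tau k w <= tau k.+1 w,
        {ae mu, forall w, exists k, tau k w = T}
      & forall k, martingale mu T F (stopped X (tau k))].

Definition cadlag T (n : nat) (X : R -> Omega -> 'rV[R]_n) :=
  forall w (i : 'I_n),
    (forall t, 0 <= t < T -> (fun u => X u w ord0 i) @ t^'+ --> X t w ord0 i) /\
    (forall t, 0 < t <= T -> cvg ((fun u => X u w ord0 i) @ t^'-)).

Definition cont_paths T (n : nat) (X : R -> Omega -> 'rV[R]_n) :=
  forall w (i : 'I_n),
    {within [set t | 0 <= t <= T], continuous (fun u => X u w ord0 i)}.

Definition sticky P T (F : R -> set (set Omega)) (n : nat)
    (S : R -> Omega -> 'rV[R]_n) :=
  forall (tau : Omega -> R) (kappa : Omega -> R),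
    stopping_time T F tau ->
    meas_wrt (sigma_at T F tau) kappa -> (forall w, 0 < kappa w) ->
    exists Y : Omega -> R,
      cond_exp P (sigma_at T F tau)
        (\1_[set w | Order.lt (ereal_sup [set (enorm (S u w - S (tau w) w))%:E
                                   | u in [set u | tau w <= u <= T]]) (kappa w)%:E])
        Y /\
      {ae P, forall w, 0 < Y w}.

(** total variation norm ||Q - P||_tv = |Q - P|(Omega) *)
Definition tv_dist Q P : \bar R :=
  ereal_sup [set x | exists (k : nat) (A : nat -> set Omega),
     [/\ forall i, measurable (A i),
         forall i j, (i < k)%N -> (j < k)%N -> i != j -> A i `&` A j = set0,
         \big[setU/set0]_(i < k) A i = setT
       & x = (\sum_(i < k) `|fine (Q (A i)) - fine (P (A i))|)%:E]].

Definition equiv_meas Q P :=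
  forall A, measurable A -> (Q A = 0%E <-> P A = 0%E).

Definition nat_sigma (n : nat) (B : R -> Omega -> 'rV[R]_n) (t : R) : set (set Omega) :=
  <<s [set A | exists s (i : 'I_n) (C : set R),
          [/\ 0 <= s <= t, measurable C & A = (fun w => B s w ord0 i) @^-1` C]] >>.

Definition brownian P T (n : nat) (B : R -> Omega -> 'rV[R]_n) :=
  [/\ forall t (i : 'I_n), measurable_fun setT (fun w => B t w ord0 i),
      forall w, B 0 w = 0,
      cont_paths T B
    & forall s t, 0 <= s -> s < t -> t <= T ->
        forall A, nat_sigma B s A ->
        forall C : 'I_n -> set R, (forall i, measurable (C i)) ->
          fine (P (A `&` [set w | forall i, C i (B t w ord0 i - B s w ord0 i)])) =
          fine (P A) * \prod_(i < n) fine (normal_prob 0 (Num.sqrt (t - s)) (C i))].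

Definition aug_nat_filtration P (n : nat) (B : R -> Omega -> 'rV[R]_n) (t : R) :=
  <<s nat_sigma B t `|` Pnull P >>.

Definition indep_sigma P (G1 G2 : set (set Omega)) :=
  forall A C, G1 A -> G2 C -> P (A `&` C) = (P A * P C)%E.

Definition join_filtration (F G : R -> set (set Omega)) (t : R) :=
  <<s F t `|` G t >>.

Definition supdist T (n : nat) (X Y : R -> Omega -> 'rV[R]_n) (w : Omega) : \bar R :=
  ereal_sup [set (enorm (X t w - Y t w))%:E | t in [set t | 0 <= t <= T]].

End Defs.

Definition gext {R : realType} (g : R -> R) (x : \bar R) : \bar R :=
  match x with
  | EFin r => (g r)%:E
  | +oo%E => +oo%E
  | -oo%E => 0%E
  end.

(* Main.v *)
(** Let tau be a localizing time with P(tau < T) small. If Q = Z P agrees with P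
    on F_tau, then the stopped process S^tau stays a martingale under Q, and Q
    differs from P only on {tau < T}; so only the behaviour after tau matters.

    For general S we keep S^tau: stickiness lets Z charge mostly the event that S
    stays close to S_tau, and Z is taken of order 1 / (1 + g) elsewhere.

    For continuous S let sigma_0 = tau and let sigma_(j+1) be the time at which S
    leaves the ball of radius kappa around S_(sigma_j). By stickiness the
    conditional probability p_j that S never leaves that ball ("retires") is
    positive; tilting each step by (1 + p_j) / (2 p_j) on retirement and by 1/2
    otherwise makes the number of steps geometric under Q. Choosing the terminal
    value S_(sigma_j) - e_j / (1 + p_j) upon retirement at step j, with e_j the
    conditional mean of the next increment without retirement, centres all the
    increments under Q, and the martingale closed by this terminal value stays
    within 2 kappa of S in each coordinate.

    Since Z is F_T-measurable, G_T and F_T remain independent under Q, so that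
    F-martingales are martingales for the joint filtration. *)
Require Import Defs.
From HB Require Import structures.
From mathcomp Require Import all_boot all_order all_algebra.
From mathcomp Require Import all_classical all_reals all_analysis measurable_realfun.
From mathcomp Require Import ring lra.
Import Order.TTheory GRing.Theory Num.Theory.
Import numFieldNormedType.Exports.
Local Open Scope classical_set_scope.
Local Open Scope ring_scope.

Set Implicit Arguments.
Unset Strict Implicit.
Unset Printing Implicit Defensive.

(** * Sub-sigma-algebras, densities and conditional expectations *)

(** The sticking probabilities p_j are positive but have no lower bound, and this dictates the tilt.
    Under Q the conditional probability of going on is (1 - p_j) / 2, hence at most 1/2 whatever p_j
    is. Since the weight of going on is the constant 1/2, Q equals 2^-k P on the events known after
    k steps that exclude earlier retirement. That makes the total mass telescope and gives the
    integrability of a terminal value that need not be bounded. Centring holds because retiring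
    contributes -e_j / 2 to the conditional Q-mean and going on contributes e_j / 2; dividing by 1 +
    p_j, and not by p_j, keeps the correction no larger than the increments themselves.

    A second obstacle is regularity. The conditional means of the terminal value are chosen for each
    time separately, so closeness to S is at first only almost sure at each fixed time. As null sets
    belong to every F_t, the process may be modified at each time, and a suitable modification makes
    the supremum measurable and bounded at every outcome. *)

Section SubSigma.
Context {d : measure_display} {Omega : measurableType d} {G : set (set Omega)}.
Hypothesis sG : sub_sigma G.

Lemma sub_sigmaW A : G A -> measurable A.
Proof. exact: sG.2. Qed.

Lemma sub_sigma0 : G set0.
Proof. by case: sG => -[]. Qed.

Lemma sub_sigmaC A : G A -> G (~` A).
Proof. by move=> GA; rewrite -setTD; case: sG => -[_ + _] _; exact. Qed.

Lemma sub_sigmaT : G setT.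
Proof. by rewrite -setC0; exact/sub_sigmaC/sub_sigma0. Qed.

Lemma sub_sigma_bigcup (A : nat -> set Omega) :
  (forall i, G (A i)) -> G (\bigcup_i A i).
Proof. by case: sG => -[_ _ +] _; exact. Qed.

Lemma sub_sigma_bigcap (A : nat -> set Omega) :
  (forall i, G (A i)) -> G (\bigcap_i A i).
Proof.
move=> GA; rewrite -[X in G X]setCK setC_bigcap; apply: sub_sigmaC.
by apply: sub_sigma_bigcup => i; exact: sub_sigmaC.
Qed.

Lemma sub_sigmaU A B : G A -> G B -> G (A `|` B).
Proof.
move=> GA GB; rewrite -bigcup2E; apply: sub_sigma_bigcup => -[|[|i]] //=.
exact: sub_sigma0.
Qed.

Lemma sub_sigmaI A B : G A -> G B -> G (A `&` B).
Proof.
move=> GA GB; rewrite -[X in G X]setCK setCI; apply: sub_sigmaC.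
by apply: sub_sigmaU; exact: sub_sigmaC.
Qed.

Lemma sub_sigmaD A B : G A -> G B -> G (A `\` B).
Proof. by move=> GA GB; rewrite setDE; apply: sub_sigmaI => //; exact: sub_sigmaC. Qed.

Lemma gsigma_measurableE : G.-sigma.-measurable = G.
Proof. by apply: measurable_g_measurableTypeE; case: sG. Qed.

End SubSigma.

Section MeasWrt.
Context {R : realType} {d : measure_display} {Omega : measurableType d}.
Context {G : set (set Omega)}.
Hypothesis sG : sub_sigma G.
Implicit Types X Y : Omega -> R.

(** Turns G into the sigma-algebra of a measurable type, which transfers the closure properties of
    measurable functions to [meas_wrt]. *)
Lemma meas_wrtP X :
  meas_wrt G X <-> measurable_fun [set: g_sigma_algebraType G] X.
Proof.
split=> [GX _ B mB|mX B mB].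
  by rewrite setTI (gsigma_measurableE sG); exact: GX.
by have := mX measurableT B mB; rewrite setTI (gsigma_measurableE sG).
Qed.

Lemma meas_wrt_measurable X : meas_wrt G X -> measurable_fun setT X.
Proof. by move=> GX _ B mB; rewrite setTI; exact/(sub_sigmaW sG)/GX. Qed.

Lemma meas_wrt_cst (c : R) : meas_wrt G (fun _ => c).
Proof. exact/meas_wrtP/measurable_cst. Qed.

Lemma meas_wrtD X Y : meas_wrt G X -> meas_wrt G Y ->
  meas_wrt G (fun w => X w + Y w).
Proof. by move=> /meas_wrtP mX /meas_wrtP mY; exact/meas_wrtP/measurable_funD. Qed.

Lemma meas_wrtB X Y : meas_wrt G X -> meas_wrt G Y ->
  meas_wrt G (fun w => X w - Y w).
Proof. by move=> /meas_wrtP mX /meas_wrtP mY; exact/meas_wrtP/measurable_funB. Qed.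

Lemma meas_wrtM X Y : meas_wrt G X -> meas_wrt G Y ->
  meas_wrt G (fun w => X w * Y w).
Proof. by move=> /meas_wrtP mX /meas_wrtP mY; exact/meas_wrtP/measurable_funM. Qed.

Lemma meas_wrt_comp (h : R -> R) X : measurable_fun setT h -> meas_wrt G X ->
  meas_wrt G (fun w => h (X w)).
Proof. by move=> mh /meas_wrtP mX; apply/meas_wrtP; exact: measurableT_comp. Qed.

Lemma meas_wrtV X : (forall w, X w != 0) -> meas_wrt G X ->
  meas_wrt G (fun w => (X w)^-1).
Proof.
move=> X0 /meas_wrtP mX; apply/meas_wrtP.
have o0 : open [set x : R | x != 0] by exact: open_neq.
apply: (@measurable_comp _ _ _ _ _ _ [set x : R | x != 0] _ _ _ _ _ _ mX).
- exact: open_measurable.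
- by move=> _ [w _ <-] /=; exact: X0.
- by apply: open_continuous_measurable_fun => // x /[!inE]; exact: inv_continuous.
Qed.

Lemma meas_wrt_le X Y : meas_wrt G X -> meas_wrt G Y -> G [set w | X w <= Y w].
Proof.
move=> /meas_wrtP mX /meas_wrtP mY; rewrite -(gsigma_measurableE sG).
have mXY := @measurable_fun_ler _ _ _ _ _ _ mX mY.
have := mXY measurableT [set true] I.
rewrite setTI; congr (measurable _); apply/seteqP; split=> w //=.
Qed.

Lemma meas_wrt_lt X Y : meas_wrt G X -> meas_wrt G Y -> G [set w | X w < Y w].
Proof.
move=> mX mY; rewrite (_ : [set w | _] = ~` [set w | Y w <= X w]).
  by apply: (sub_sigmaC sG); exact: meas_wrt_le.
by apply/seteqP; split=> w /=; rewrite ltNge => /negP.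
Qed.

(** The pieces may overlap, since X is prescribed on each of them. This handles variables read at a
    random index. *)
Lemma meas_wrt_glue (E : nat -> set Omega) (Xs : nat -> Omega -> R) X :
  (forall j, G (E j)) -> (forall w, exists j, E j w) ->
  (forall j w, E j w -> X w = Xs j w) -> (forall j, meas_wrt G (Xs j)) ->
  meas_wrt G X.
Proof.
move=> GE covE XE mXs B mB.
rewrite (_ : X @^-1` B = \bigcup_j (E j `&` Xs j @^-1` B)).
  apply: (sub_sigma_bigcup sG) => j; apply: (sub_sigmaI sG) => //.
  exact: mXs.
apply/seteqP; split=> w /=.
  by move=> BX; have [j Ej] := covE w; exists j => //; split => //=; rewrite -XE.
by move=> [j _ [Ej /=]]; rewrite -XE.
Qed.

Lemma meas_wrt_if (A : set Omega) X Y : G A -> meas_wrt G X -> meas_wrt G Y ->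
  meas_wrt G (fun w => if `[< A w >] then X w else Y w).
Proof.
move=> GA mX mY; apply: (@meas_wrt_glue
  (fun j => if j is 0 then A else ~` A) (fun j => if j is 0 then X else Y)).
- by case=> // j; exact: (sub_sigmaC sG).
- by move=> w; have [Aw|nAw] := pselect (A w); [exists 0%N|exists 1%N].
- by move=> [|j] w Aw; case: asboolP.
- by case.
Qed.

Lemma meas_wrt_indic (A : set Omega) : G A -> meas_wrt G (\1_A : Omega -> R).
Proof.
move=> GA; rewrite (_ : \1_A = fun w => if `[< A w >] then 1 else 0 : R).
  by apply: meas_wrt_if => //; exact: meas_wrt_cst.
by apply/funext => w; rewrite indicE -[in LHS](asboolb (w \in A)) in_setE; case: ifP.
Qed.

Lemma meas_wrt_cvg (Xs : nat -> Omega -> R) X : (forall j, meas_wrt G (Xs j)) ->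
  (forall w, Xs ^~ w @ \oo --> X w) -> meas_wrt G X.
Proof.
move=> mXs cX; apply/meas_wrtP; apply: (@measurable_fun_cvg _ (g_sigma_algebraType G) R setT Xs X).
  by move=> j; apply/meas_wrtP.
by move=> w _; exact: cX.
Qed.

End MeasWrt.

Lemma meas_wrtS {R : realType} {d : measure_display} {Omega : measurableType d}
    (G G' : set (set Omega)) (X : Omega -> R) :
  G `<=` G' -> meas_wrt G X -> meas_wrt G' X.
Proof. by move=> GG' mX B mB; exact/GG'/mX. Qed.

Section Density.
Context {R : realType} {d : measure_display} {Omega : measurableType d}.
Variables (P : probability Omega R) (Z : Omega -> R).
Hypotheses (iZ : P.-integrable setT (EFin \o Z)) (Z0 : forall w, 0 <= Z w).
Local Open Scope ereal_scope.

(** The proofs are arguments so that the finite measure structure can be attached to the term. *)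
Definition density of P.-integrable setT (EFin \o Z)
  & (forall w, (0 <= Z w)%R) := fun A => \int[P]_(w in A) (Z w)%:E.

Local Notation nu := (density iZ Z0).

Let mZ : measurable_fun setT (EFin \o Z). Proof. exact: measurable_int iZ. Qed.

Let nu0 : nu set0 = 0. Proof. exact: integral_set0. Qed.

Let nu_ge0 A : 0 <= nu A.
Proof. by apply: integral_ge0 => w _; rewrite lee_fin. Qed.

Let nu_sigma_additive : semi_sigma_additive nu.
Proof.
by apply: semi_sigma_additive_nng_induced => // w; rewrite lee_fin.
Qed.

HB.instance Definition _ := isMeasure.Build _ _ _ nu nu0 nu_ge0 nu_sigma_additive.

Let nu_fin : fin_num_fun nu.
Proof.
by move=> A mA; apply: integrable_fin_num => //=; exact: integrableS iZ.
Qed.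

HB.instance Definition _ := Measure_isFinite.Build _ _ _ nu nu_fin.

Let nu_dom : nu `<< P.
Proof.
apply/null_content_dominatesP => A mA PA; rewrite /density.
by apply: null_set_integral => //; exact: measurable_funTS.
Qed.

(** The Radon-Nikodym derivative of the new measure has the same integrals as Z over all measurable
    sets, so the two agree almost everywhere. *)
Lemma ge0_integral_density (f : Omega -> \bar R) E : measurable E ->
  measurable_fun E f -> (forall w, 0 <= f w) ->
  \int[density iZ Z0]_(w in E) f w = \int[P]_(w in E) (f w * (Z w)%:E).
Proof.
move=> mE mf f0.
have iD := Radon_Nikodym_SigmaFinite.f_integrable nu_dom.
rewrite -(Radon_Nikodym_SigmaFinite.change_of_variables nu_dom)//.
apply: ae_eq_integral => //.
- by apply: emeasurable_funM => //; exact/measurable_funTS/(measurable_int P).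
- by apply: emeasurable_funM => //; exact/measurable_funTS.
apply: ae_eqe_mul2l; apply: integral_ae_eq => //.
- exact: integrableS iD.
- exact/measurable_funTS.
- by move=> A AE mA; rewrite -Radon_Nikodym_SigmaFinite.f_integral.
Qed.

(** As Z is nonnegative, the positive and negative parts of f Z are those of f times Z; both sides
    subtract the same two terms, integrable or not. *)
Lemma integral_density (f : Omega -> \bar R) E : measurable E ->
  measurable_fun E f ->
  \int[density iZ Z0]_(w in E) f w = \int[P]_(w in E) (f w * (Z w)%:E).
Proof.
move=> mE mf; rewrite [LHS]integralE [RHS]integralE.
rewrite !ge0_integral_density//; [|exact: measurable_funeneg|exact: measurable_funepos].
have Ze0 w : 0 <= (Z w)%:E by rewrite lee_fin.
congr (_ - _); apply: eq_integral => w _.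
  by rewrite !funeposE maxe_pMl// mul0e.
by rewrite !funenegE maxe_pMl// mul0e mulNe.
Qed.

Hypothesis Z1 : \int[P]_w (Z w)%:E = 1.

Lemma density_probability : exists Q : probability Omega R,
  forall A, Q A = \int[P]_(w in A) (Z w)%:E.
Proof.
have nuT : nu setT = 1 by [].
pose Qm := Measure_isProbability.Build _ _ _ nu nuT.
by exists (HB.pack_for (probability Omega R) nu Qm).
Qed.

End Density.

Section Restriction.
Context {R : realType} {d : measure_display} {Omega : measurableType d}.
Context {G : set (set Omega)}.
Hypothesis sG : sub_sigma G.
Local Open Scope ereal_scope.
Local Notation T' := (g_sigma_algebraType G).

Let GE (A : set T') : measurable A -> G A.
Proof. by rewrite (gsigma_measurableE sG). Qed.

Section measure.
Variable m : {measure set Omega -> \bar R}.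

Definition restr_sigma of sub_sigma G := fun A : set T' => m A.

Let restr0 : restr_sigma sG set0 = 0. Proof. exact: measure0. Qed.

Let restr_ge0 A : 0 <= restr_sigma sG A. Proof. exact: measure_ge0. Qed.

Let restr_sigma_additive : semi_sigma_additive (restr_sigma sG).
Proof.
move=> /= F mF tF mUF; apply: (@measure_semi_sigma_additive _ _ _ m) => //.
  by move=> i; exact/(sub_sigmaW sG)/GE.
exact/(sub_sigmaW sG)/GE.
Qed.

HB.instance Definition _ := isMeasure.Build _ _ _ (restr_sigma sG)
  restr0 restr_ge0 restr_sigma_additive.

Let mid : measurable_fun setT (idfun : Omega -> T').
Proof. by move=> _ A /GE; rewrite setTI => /(sub_sigmaW sG). Qed.

(** The restriction is the pushforward under the identity from the full sigma-algebra to G. *)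
Lemma ge0_integral_restr_sigma (f : T' -> \bar R) A : measurable_fun setT f ->
  (forall w, 0 <= f w) -> G A ->
  \int[restr_sigma sG]_(w in A) f w = \int[m]_(w in A) f w.
Proof.
move=> /measurable_funTS mf f0 GA.
have mA : measurable (A : set T') by rewrite (gsigma_measurableE sG).
have := @ge0_integral_pushforward _ _ _ _ _ _ mid m A f mA (mf _).
by move=> /(_ (fun y _ => f0 y)) <-; exact: eq_measure_integral.
Qed.

Lemma integral_restr_sigma (f : T' -> \bar R) A : measurable_fun setT f -> G A ->
  \int[restr_sigma sG]_(w in A) f w = \int[m]_(w in A) f w.
Proof.
move=> mf GA; rewrite [LHS]integralE [RHS]integralE.
congr (_ - _); apply: ge0_integral_restr_sigma => //.
  exact: measurable_funepos.
exact: measurable_funeneg.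
Qed.

End measure.

Section cond_exp.
Variables (P : probability Omega R) (X : Omega -> R).
Hypothesis iX : P.-integrable setT (EFin \o X).

Let PT : restr_sigma P sG setT = 1. Proof. exact: probability_setT. Qed.

HB.instance Definition _ :=
  Measure_isProbability.Build _ _ _ (restr_sigma P sG) PT.

Definition restr_charge of sub_sigma G & P.-integrable setT (EFin \o X) :=
  fun A : set T' => \int[P]_(w in A) (X w)%:E.
Local Notation nu := (restr_charge sG iX).

Let nu0 : nu set0 = 0. Proof. exact: integral_set0. Qed.

Let nu_fin A : measurable A -> nu A \is a fin_num.
Proof.
move=> /GE/(sub_sigmaW sG) mA.
by apply: integrable_fin_num => //=; exact: integrableS iX.
Qed.

Let nu_sigma_additive : semi_sigma_additive nu.
Proof.
move=> /= F mF tF mUF.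
apply: (@charge_semi_sigma_additive _ _ _ (induced_charge iX)) => //.
  by move=> i; exact/(sub_sigmaW sG)/GE.
exact/(sub_sigmaW sG)/GE.
Qed.

HB.instance Definition _ := isCharge.Build _ _ _ nu nu0 nu_fin nu_sigma_additive.

(** The Radon-Nikodym derivative is taken between measures on G, which makes it G-measurable. *)
Lemma cond_exp_exists : exists Y, cond_exp P G X Y.
Proof.
have dom : nu `<< restr_sigma P sG.
  apply/null_content_dominatesP => A /GE/(sub_sigmaW sG) mA PA.
  apply: null_set_integral => //; exact/measurable_funTS/(measurable_int P).
pose f := Radon_Nikodym nu (restr_sigma P sG).
have if_ := Radon_Nikodym_integrable dom.
have ff w : f w \is a fin_num by exact: Radon_Nikodym_fin_num.
have mf : measurable_fun setT f by exact: measurable_int if_.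
have fE : EFin \o (fine \o f) = f by apply/funext => w /=; rewrite fineK.
exists (fine \o f); split.
- apply/(meas_wrtP sG); exact: measurableT_comp.
- rewrite fE; apply/integrableP; split.
    move=> _ B mB; rewrite setTI; apply/(sub_sigmaW sG)/GE.
    by have := mf measurableT B mB; rewrite setTI.
  rewrite -ge0_integral_restr_sigma//; last 2 first.
  + exact: measurableT_comp.
  + exact: sub_sigmaT.
  by case/integrableP: if_.
- move=> A GA.
  transitivity (\int[P]_(w in A) f w).
    by apply: eq_integral => w _; rewrite fineK.
  rewrite -integral_restr_sigma//.
  rewrite -Radon_Nikodym_integral//.
  by rewrite (gsigma_measurableE sG).
Qed.

End cond_exp.

Lemma eq_integral_agree (m1 m2 : {measure set Omega -> \bar R}) (f : Omega -> R) A :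
  (forall A, G A -> m1 A = m2 A) -> meas_wrt G f -> G A ->
  \int[m1]_(w in A) (f w)%:E = \int[m2]_(w in A) (f w)%:E.
Proof.
move=> m12 /(meas_wrtP sG) mf GA.
have mf' : measurable_fun [set: T'] (EFin \o f) by exact/measurable_EFinP.
transitivity (\int[restr_sigma m1 sG]_(w in A) (f w)%:E).
  by rewrite integral_restr_sigma.
transitivity (\int[restr_sigma m2 sG]_(w in A) (f w)%:E); last first.
  by rewrite integral_restr_sigma.
by apply: eq_measure_integral => B /GE GB _; exact: m12.
Qed.

(** The measures u P and v Q agree on G, so they integrate f alike. For P = Q this is the rule of
    taking out what is known; allowing two measures also covers the passage from Q to P. *)
Lemma integral_pull_out (P Q : probability Omega R) (u v f : Omega -> R) A :
  P.-integrable setT (EFin \o u) -> Q.-integrable setT (EFin \o v) ->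
  (forall w, (0 <= u w)%R) -> (forall w, (0 <= v w)%R) ->
  (forall A, G A -> \int[P]_(w in A) (u w)%:E = \int[Q]_(w in A) (v w)%:E) ->
  meas_wrt G f -> G A ->
  \int[P]_(w in A) (f w * u w)%:E = \int[Q]_(w in A) (f w * v w)%:E.
Proof.
move=> iu iv u0 v0 uv mf GA.
have mA := sub_sigmaW sG GA.
have mf' : measurable_fun A (EFin \o f).
  exact/measurable_EFinP/measurable_funTS/(meas_wrt_measurable sG).
have h1 := integral_density iu u0 mA mf'.
have h2 := integral_density iv v0 mA mf'.
under eq_integral do rewrite EFinM.
under [RHS]eq_integral do rewrite EFinM.
rewrite -h1 -h2; exact: eq_integral_agree.
Qed.

End Restriction.

Section NullSets.
Context {R : realType} {d : measure_display} {Omega : measurableType d}.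
Implicit Types (P Q : probability Omega R).
Local Open Scope ereal_scope.

Lemma Pnull_sub P (A B : set Omega) : A `<=` B -> Pnull P B -> Pnull P A.
Proof. by move=> AB [N [mN PN BN]]; exists N; split=> //; exact: subset_trans BN. Qed.

Lemma Pnull_measurable P (A : set Omega) : measurable A -> Pnull P A -> P A = 0.
Proof. by move=> mA [N [mN PN AN]]; apply: (subset_measure0 mA mN AN). Qed.

Lemma Pnull_bigcup P (A : nat -> set Omega) :
  (forall k, Pnull P (A k)) -> Pnull P (\bigcup_k A k).
Proof. exact: negligible_bigcup. Qed.

Lemma PnullU P (A B : set Omega) : Pnull P A -> Pnull P B -> Pnull P (A `|` B).
Proof. exact: negligibleU. Qed.

Lemma meas_wrt_Pnull P (G : set (set Omega)) (X Y : Omega -> R) :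
  sub_sigma G -> Pnull P `<=` G -> meas_wrt G X ->
  Pnull P [set w | X w <> Y w] -> meas_wrt G Y.
Proof.
move=> sG GN mX nXY B mB.
rewrite (_ : Y @^-1` B = (X @^-1` B `\` [set w | X w <> Y w]) `|`
    ([set w | X w <> Y w] `&` Y @^-1` B)).
  apply: (sub_sigmaU sG); first by apply: (sub_sigmaD sG); [exact: mX|exact: GN].
  by apply: GN; apply: Pnull_sub nXY; exact: subIsetl.
apply/seteqP; split=> w /=.
  move=> BY; have [XY|XY] := pselect (X w = Y w); last by right.
  by left; split; [rewrite XY|exact].
by move=> [[BX /contrapT <-//]|[]].
Qed.

Lemma integrable_le P (f g : Omega -> R) : measurable_fun setT f ->
  P.-integrable setT (EFin \o g) -> (forall w, (`|f w| <= g w)%R) ->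
  P.-integrable setT (fun w => (f w)%:E).
Proof.
move=> mf ig fg; apply: le_integrable ig => //; first exact/measurable_EFinP.
by move=> w _ /=; rewrite lee_fin (le_trans (fg w))// ler_norm.
Qed.

Lemma integrable_bounded P (f : Omega -> R) (c : R) : measurable_fun setT f ->
  (forall w, (`|f w| <= c)%R) -> P.-integrable setT (fun w => (f w)%:E).
Proof.
move=> mf fc; apply: (@integrable_le _ _ (cst c)) => //.
exact: finite_measure_integrable_cst.
Qed.

Lemma integrable_sub P (f : Omega -> R) A : measurable A ->
  P.-integrable setT (EFin \o f) -> P.-integrable A (fun w => (f w)%:E).
Proof. by move=> mA; exact: integrableS. Qed.

Lemma integral_setI_indicM P (f : Omega -> R) (A C : set Omega) :
  \int[P]_(w in A `&` C) (f w)%:E = \int[P]_(w in A) (f w * \1_C w)%:E.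
Proof.
rewrite integral_mkcondr; apply: eq_integral => w _.
by rewrite epatch_indic /= EFinM.
Qed.

(** On A the difference f - g is nonnegative with integral at most 0. Almost sure comparisons below
    are reduced to this. *)
Lemma Pnull_of_integral_le P (f g : Omega -> R) (A : set Omega) :
  measurable A -> P.-integrable setT (EFin \o f) ->
  P.-integrable setT (EFin \o g) -> (forall w, A w -> (g w <= f w)%R) ->
  \int[P]_(w in A) (f w)%:E <= \int[P]_(w in A) (g w)%:E ->
  Pnull P (A `&` [set w | (g w < f w)%R]).
Proof.
move=> mA /(integrable_sub mA) if_ /(integrable_sub mA) ig gf le_fg.
pose h w := (f w)%:E - (g w)%:E.
have mh : measurable_fun A h.
  by apply: emeasurable_funB; [exact: measurable_int if_|exact: measurable_int ig].
have : \int[P]_(w in A) `|h w| = 0.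
  rewrite (eq_integral h); last first.
    by move=> w /[!inE] Aw; rewrite gee0_abs// /h -EFinB lee_fin subr_ge0 gf.
  apply/eqP; rewrite eq_le; apply/andP; split.
    by rewrite /h integralB_EFin//= leeBlDr ?add0e//; exact: integrable_fin_num.
  by apply: integral_ge0 => w Aw; rewrite /h -EFinB lee_fin subr_ge0 gf.
move=> /(ae_eq_integral_abs P mA mh); apply: Pnull_sub => w /= [Aw gfw] /(_ Aw).
rewrite /h -EFinB => -[] /eqP; rewrite subr_eq0 => /eqP fgw.
by move: gfw; rewrite fgw ltxx.
Qed.

Lemma cond_exp_Pnull P (G : set (set Omega)) (X Y Y' : Omega -> R) :
  sub_sigma G -> Pnull P `<=` G -> cond_exp P G X Y ->
  Pnull P [set w | Y w <> Y' w] -> cond_exp P G X Y'.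
Proof.
move=> sG GN [mY iY YX] nY.
have mY' := meas_wrt_Pnull sG GN mY nY.
have aeY A : ae_eq P A (EFin \o Y) (EFin \o Y').
  apply: Pnull_sub nY => w /= nw YY'; apply: nw => _.
  by rewrite /= YY'.
have mYY A : measurable A -> measurable_fun A (EFin \o Y) /\ measurable_fun A (EFin \o Y').
  by split; apply/measurable_EFinP/measurable_funTS/(meas_wrt_measurable sG).
split=> //.
  have [m1 m2] := mYY _ (@measurableT _ Omega).
  case/integrableP: iY => _ iY; apply/integrableP; split=> //.
  rewrite -(ae_eq_integral _ _ _ _ _ (ae_eq_abse (aeY setT)))//;
    exact: measurableT_comp.
move=> A GA; have mA := sub_sigmaW sG GA; have [m1 m2] := mYY _ mA.
by rewrite -YX//; apply: ae_eq_integral => //; exact/ae_eq_sym/aeY.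
Qed.

Lemma normr_range_le (a b y : R) : (a <= y <= b -> `|y| <= `|a| + `|b|)%R.
Proof.
move=> /andP[ay yb]; rewrite ler_norml.
have := ler_norm b; have := ler_norm (- a); rewrite normrN.
have := normr_ge0 a; have := normr_ge0 b; lra.
Qed.

(** The events where Y leaves the interval lie in G, so Y can be compared there with X through
    integrals. *)
Lemma cond_exp_range_Pnull P (G : set (set Omega)) (X Y : Omega -> R) (a b : R) :
  sub_sigma G -> measurable_fun setT X -> (forall w, (a <= X w <= b)%R) ->
  cond_exp P G X Y -> Pnull P [set w | ~ (a <= Y w <= b)%R].
Proof.
move=> sG mX Xab [mY iY YX].
have icst c : P.-integrable setT (EFin \o cst c : Omega -> \bar R).
  exact: finite_measure_integrable_cst.
have iX : P.-integrable setT (EFin \o X).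
  apply: (@integrable_le _ _ (cst (`|a| + `|b|)%R)) => // w /=.
  exact: normr_range_le.
have Ga : G [set w | (Y w < a)%R].
  by apply: (meas_wrt_lt sG) => //; exact: (meas_wrt_cst sG).
have Gb : G [set w | (b < Y w)%R].
  by apply: (meas_wrt_lt sG) => //; exact: (meas_wrt_cst sG).
apply: (@Pnull_sub _ _ ([set w | (Y w < a)%R] `|` [set w | (b < Y w)%R])).
  by move=> w /= /negP; rewrite negb_and -!ltNge => /orP.
apply: PnullU.
- have mA := sub_sigmaW sG Ga.
  apply: Pnull_sub (Pnull_of_integral_le mA (icst a) iY _ _) => [w //|w /ltW //|].
  rewrite YX//; apply: le_integral => //; [exact: integrable_sub..|].
  by move=> w _; rewrite lee_fin; case/andP: (Xab w).
- have mA := sub_sigmaW sG Gb.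
  apply: Pnull_sub (Pnull_of_integral_le mA iY (icst b) _ _) => [w //|w /ltW //|].
  rewrite YX//; apply: le_integral => //; [exact: integrable_sub..|].
  by move=> w _; rewrite lee_fin; case/andP: (Xab w).
Qed.

(** Resetting the version to a on the exceptional null set keeps it G-measurable because G contains
    the null sets. Bounds valid at every outcome spare almost-everywhere reasoning later. *)
Lemma cond_exp_exists_range P (G : set (set Omega)) (X : Omega -> R) (a b : R) :
  sub_sigma G -> Pnull P `<=` G -> measurable_fun setT X -> (a <= b)%R ->
  (forall w, (a <= X w <= b)%R) ->
  exists2 Y, cond_exp P G X Y & forall w, (a <= Y w <= b)%R.
Proof.
move=> sG GN mX ab Xab.
have iX : P.-integrable setT (EFin \o X).
  apply: (@integrable_bounded _ _ (`|a| + `|b|)%R) => // w.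
  exact: normr_range_le.
have [Y XY] := cond_exp_exists sG iX.
pose Y' w := if (a <= Y w <= b)%R then Y w else a.
exists Y'; last by move=> w; rewrite /Y'; case: ifPn => // _; rewrite lexx.
apply: (cond_exp_Pnull sG GN XY).
apply: Pnull_sub (cond_exp_range_Pnull sG mX Xab XY) => w /= YY' abY.
by apply: YY'; rewrite /Y' abY.
Qed.

End NullSets.

(** * Martingales under enlargement by an independent filtration *)

Section IndependentJoin.
Context {R : realType} {d : measure_display} {Omega : measurableType d}.
Variables (Q : probability Omega R).
Local Open Scope ereal_scope.

(** Independence says that the indicator of C and the constant Q C have the same integrals over
    events of F; then f is pulled out. *)
Lemma integral_indep (F G : set (set Omega)) (f : Omega -> R) A C :
  sub_sigma F -> sub_sigma G -> indep_sigma Q G F -> meas_wrt F f ->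
  Q.-integrable setT (EFin \o f) -> F A -> G C ->
  \int[Q]_(w in A `&` C) (f w)%:E = Q C * \int[Q]_(w in A) (f w)%:E.
Proof.
move=> sF sG ind mf if_ FA GC.
have mC := sub_sigmaW sG GC; have mA := sub_sigmaW sF FA.
have QCfin : Q C \is a fin_num by exact: fin_num_measure.
pose c := fine (Q C).
have c0 : (0 <= c)%R by rewrite fine_ge0.
rewrite integral_setI_indicM.
rewrite (@integral_pull_out _ _ _ _ sF Q Q (\1_C) (fun=> c) f A)//.
- under eq_integral do rewrite mulrC EFinM.
  by rewrite integralZl ?fineK//; exact: integrableS if_.
- by apply: (@integrable_bounded _ _ _ _ _ 1%R) => // w; rewrite indicE; case: (_ \in _); rewrite ?normr1 ?normr0.
- exact: finite_measure_integrable_cst.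
- move=> B FB; have mB := sub_sigmaW sF FB.
  rewrite integral_indic// (@integral_cst _ _ _ Q B mB c%:E) /c fineK//.
  exact: ind.
Qed.

(** The intersections of an event of [F s] with one of [G s] form a pi-system generating the join.
    On them independence factors the probability of the second event out of both sides, and the
    events satisfying the martingale identity form a Dynkin system. *)
Lemma martingale_join (T : R) (F G : R -> set (set Omega)) n
    (X : R -> Omega -> 'rV[R]_n) :
  filtration T F -> filtration T G -> indep_sigma Q (G T) (F T) ->
  martingale Q T F X -> martingale Q T (join_filtration F G) X.
Proof.
move=> [sF FS] [sG GS] ind MX i; have [adX MXi] := MX i.
have F_join t : F t `<=` join_filtration F G t.
  by move=> A FA; apply: sub_sigma_algebra; left.
split.
  move=> t t0T; have [mX iX] := adX _ t0T; split=> //.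
  exact: meas_wrtS mX.
move=> s t s0 st tT; have [mXs iXs XE] := MXi s t s0 st tT.
have t0T : (0 <= t <= T)%R by rewrite (le_trans s0 st).
have s0T : (0 <= s <= T)%R by rewrite s0 (le_trans st tT).
have T0T : (0 <= T <= T)%R by rewrite lexx andbT; case/andP: t0T => + _; move/le_trans; exact.
have [mXt iXt] := adX t t0T.
split=> //; first exact: meas_wrtS mXs.
pose D := [set A | measurable A /\
  \int[Q]_(w in A) (X s w ord0 i)%:E = \int[Q]_(w in A) (X t w ord0 i)%:E].
have dD : dynkin D.
  have DT : D setT by split => //; apply: XE; exact: (sub_sigmaT (sF s s0T)).
  split => //.
    move=> A [mA AE]; split; first exact: measurableC.
    have DE (Y : Omega -> R) : Q.-integrable setT (EFin \o Y) ->
        \int[Q]_(w in ~` A) (Y w)%:E =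
        \int[Q]_w (Y w)%:E - \int[Q]_(w in A) (Y w)%:E.
      move=> iY; have mY := measurable_int _ iY.
      rewrite -(setUv A) integral_setU//; [|exact: measurableC|exact: measurable_funTS|]; last first.
        by apply/disj_setPS; rewrite setICr.
      rewrite addeAC subee ?add0e//; apply: integrable_fin_num => //.
      exact: integrableS iY.
    by rewrite !DE// AE DT.2.
  move=> A tA DA; have mA k : measurable (A k) by case: (DA k).
  split; first exact: bigcup_measurable.
  rewrite !integral_bigcup//.
  - by apply: eq_eseriesr => k _; case: (DA k).
  - apply: (integrableS measurableT _ _ iXt) => //; exact: bigcup_measurable.
  - apply: (integrableS measurableT _ _ iXs) => //; exact: bigcup_measurable.
pose Pi := [set A | exists B C, [/\ F s B, G s C & A = B `&` C]].
have PiI : setI_closed Pi.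
  move=> _ _ [B [C [FB GC ->]]] [B' [C' [FB' GC' ->]]].
  exists (B `&` B'), (C `&` C'); split.
  - exact: (sub_sigmaI (sF s s0T)).
  - exact: (sub_sigmaI (sG s s0T)).
  - by rewrite setIACA.
have PiD : Pi `<=` D.
  move=> _ [B [C [FB GC ->]]].
  have sFT := sF _ T0T; have sGT := sG _ T0T.
  have FTB : F T B by apply: FS FB => //; case/andP: s0T.
  have GTC : G T C by apply: GS GC => //; case/andP: s0T.
  have [t0 _] := andP t0T; have [_ sT] := andP s0T.
  split; first by apply: measurableI; [exact: (sub_sigmaW sFT)|exact: (sub_sigmaW sGT)].
  rewrite !(integral_indep sFT sGT ind)//; first by rewrite XE.
  + by apply: meas_wrtS mXt; exact: FS.
  + by apply: meas_wrtS mXs; exact: FS.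
move=> A HA; suff : D A by case.
have : <<d Pi >> A.
  rewrite setI_closed_g_dynkin_g_sigma_algebra//.
  move: A HA; apply: sub_sigma_algebra2 => A [FA|GA].
    exists A, setT; split=> //; first exact: (sub_sigmaT (sG s s0T)).
    by rewrite setIT.
  exists setT, A; split=> //; first exact: (sub_sigmaT (sF s s0T)).
  by rewrite setTI.
by move: A HA => A _; apply: smallest_sub.
Qed.

End IndependentJoin.

(** * Total variation of measures that agree off an event *)

Section TotalVariation.
Context {R : realType} {d : measure_display} {Omega : measurableType d}.
Variables (P Q : probability Omega R).

(** Off C the differences vanish; on C they are bounded by sums, and Q C = P C because the total
    masses agree. *)
Lemma tv_dist_le (C : set Omega) : measurable C ->
  (forall A, measurable A -> A `<=` ~` C -> Q A = P A) ->
  (tv_dist Q P <= (fine (P C) *+ 2)%:E)%E.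
Proof.
move=> mC QP; apply: ub_ereal_sup => _ [k [A [mA tA UA ->]]].
have finP (mu : probability Omega R) B : measurable B -> mu B \is a fin_num.
  exact: fin_num_measure.
have split_ (mu : probability Omega R) B : measurable B ->
    fine (mu B) = fine (mu (B `&` C)) + fine (mu (B `&` ~` C)).
  move=> mB; have mBC := measurableI _ _ mB mC.
  have mBC' := measurableI _ _ mB (measurableC mC).
  rewrite -fineD ?finP// -measureU//; first by rewrite -setIUr setUv setIT.
  by rewrite setIACA setICr setI0.
have QC : fine (Q C) = fine (P C).
  have := split_ Q _ measurableT; have := split_ P _ measurableT.
  rewrite !setTI !probability_setT (QP (~` C))//; first by move=> -> /addIr.
  exact: measurableC.
have sumC (mu : probability Omega R) : \sum_(i < k) fine (mu (A i `&` C)) = fine (mu C).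
  rewrite sum_fine; last by move=> i _; apply: finP; exact: measurableI.
  rewrite -(measure_bigsetU_ord _ predT)//.
  - by rewrite -big_distrl/= UA setTI.
  - by move=> i; exact: measurableI.
  - apply/trivIsetP => i j _ _ ij; rewrite setIACA setIid tA ?set0I//.
rewrite lee_fin; apply: (@le_trans _ _
    (\sum_(i < k) (fine (Q (A i `&` C)) + fine (P (A i `&` C))))).
  apply: ler_sum => i _; rewrite (split_ Q)// (split_ P)//.
  rewrite (QP (A i `&` ~` C)); last 2 first.
  - by apply: measurableI => //; exact: measurableC.
  - exact: subIsetr.
  rewrite opprD addrACA subrr addr0.
  by apply: (le_trans (ler_normB _ _)); rewrite !ger0_norm ?fine_ge0.
by rewrite big_split/= !sumC QC mulr2n.
Qed.

End TotalVariation.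

(** * Countable essential suprema *)

Section EssentialSupremum.
Context {R : realType} {d : measure_display} {Omega : measurableType d}.
Variables (Q : probability Omega R) (I : set R) (Y : R -> Omega -> R) (c : R).
Hypotheses (mY : forall t, I t -> measurable_fun setT (Y t))
  (Y0c : forall t w, I t -> 0 <= Y t w <= c).
Local Open Scope ereal_scope.

Definition seq_sup (s : nat -> R) (w : Omega) : \bar R :=
  ereal_sup (range (fun k => (Y (s k) w)%:E)).

Lemma seq_sup_ge s k w : (Y (s k) w)%:E <= seq_sup s w.
Proof. by apply: ereal_sup_ubound; exists k. Qed.

Section sequence.
Variable s : nat -> R.
Hypothesis Is : forall k, I (s k).

Lemma seq_sup_ge0 w : 0 <= seq_sup s w.
Proof.
apply: le_trans (seq_sup_ge s 0 w); rewrite lee_fin.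
by case/andP: (Y0c w (Is 0)).
Qed.

Lemma seq_sup_le w : seq_sup s w <= c%:E.
Proof.
apply: ub_ereal_sup => _ [k _ <-]; rewrite lee_fin.
by case/andP: (Y0c w (Is k)).
Qed.

Lemma seq_sup_fin w : seq_sup s w \is a fin_num.
Proof.
by rewrite ge0_fin_numE ?seq_sup_ge0// (le_lt_trans (seq_sup_le w))// ltry.
Qed.

Lemma measurable_seq_sup : measurable_fun setT (seq_sup s).
Proof.
have mYs k : measurable_fun setT (fun w => (Y (s k) w)%:E).
  exact/measurable_EFinP/mY.
have := measurable_fun_esups mYs 0.
congr (measurable_fun _ _); apply/funext => w; rewrite /esups/= /seq_sup.
by congr ereal_sup; apply/seteqP; split=> _ [k _ <-]; exists k.
Qed.

End sequence.

(** Choose s so that the integral of its supremum is the largest possible. If some Y t exceeded that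
    supremum with positive probability, adjoining t would raise the integral further. *)
Lemma countable_ess_sup (t0 : R) : I t0 -> exists s : nat -> R,
  (forall k, I (s k)) /\
  forall t, I t -> Pnull Q [set w | seq_sup s w < (Y t w)%:E].
Proof.
move=> It0.
pose J := [set s : nat -> R | forall k, I (s k)].
pose al := ereal_sup [set \int[Q]_w seq_sup s w | s in J].
have int_le_al s : J s -> \int[Q]_w seq_sup s w <= al.
  by move=> Js; apply: ereal_sup_ubound; exists s.
have al0 : 0 <= al.
  have Jt0 : J (fun=> t0) by [].
  apply: le_trans (int_le_al _ Jt0).
  by apply: integral_ge0 => w _; exact: seq_sup_ge0.
have alc : al <= c%:E.
  apply: ub_ereal_sup => _ [s Js <-].
  apply: (@le_trans _ _ (\int[Q]_w (cst c%:E) w)).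
    apply: ge0_le_integral => //=.
    - by move=> w _; exact: seq_sup_ge0.
    - exact: measurable_seq_sup.
    - by move=> w _; exact: seq_sup_le.
  by rewrite integral_cst// [X in _ * X](probability_setT Q) mule1.
have alfin : al \is a fin_num by rewrite ge0_fin_numE// (le_lt_trans alc)// ltry.
have /choice[ss ssP] : forall m : nat, exists s, J s /\
    al - (m.+1%:R^-1)%:E < \int[Q]_w seq_sup s w.
  move=> m; have m0 : (0 < m.+1%:R^-1 :> R)%R by rewrite invr_gt0.
  by have [_ [s Js <-] ?] := ub_ereal_sup_adherent m0 alfin; exists s.
(* Interleaves all the nearly maximizing sequences, so its supremum dominates each of theirs. *)
pose st (k : nat) := if unpickle k is Some (m, l) then ss m l else t0.
have Jst : J st.
  by move=> k; rewrite /st; case: unpickle => [[m l]|//]; case: (ssP m) => + _; exact.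
have ss_st m w : seq_sup (ss m) w <= seq_sup st w.
  apply: ub_ereal_sup => _ [l _ <-]; apply: ereal_sup_ubound.
  by exists (pickle (m, l)) => //; rewrite /st pickleK.
have al_st : al <= \int[Q]_w seq_sup st w.
  apply/lee_addgt0Pr => e e0; rewrite -leeBlDr//.
  have [m me] : exists m : nat, (m.+1%:R^-1 < e)%R.
    have [m _ /(_ m (leqnn m)) me] := near_infty_natSinv_lt (PosNum e0).
    by exists m.
  apply: (@le_trans _ _ (al - (m.+1%:R^-1)%:E)).
    by rewrite leeB// lee_fin ltW.
  apply: (le_trans (ltW (ssP m).2)); apply: ge0_le_integral => //.
  - by move=> w _; apply: seq_sup_ge0; exact: (ssP m).1.
  - by apply: measurable_seq_sup; exact: (ssP m).1.
  - exact: measurable_seq_sup.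
exists st; split=> // t It.
(* Adjoins t to the maximizing sequence. *)
pose s' (k : nat) := if k is k'.+1 then st k' else t.
have Js' : J s' by case.
have st_s' w : seq_sup st w <= seq_sup s' w.
  by apply: ub_ereal_sup => _ [l _ <-]; exact: (seq_sup_ge s' l.+1).
have fineE s w : J s -> (fine (seq_sup s w))%:E = seq_sup s w.
  by move=> Js; rewrite fineK// seq_sup_fin.
have isup s : J s -> Q.-integrable setT (EFin \o (fine \o seq_sup s)).
  move=> Js; apply: (@integrable_bounded _ _ _ _ _ c).
    by apply: measurableT_comp => //; exact: measurable_seq_sup.
  move=> w /=; rewrite -lee_fin ger0_norm ?fineE ?seq_sup_le//.
  by rewrite fine_ge0// seq_sup_ge0.
have := @Pnull_of_integral_le _ _ _ Q _ _ setT measurableT (isup _ Js') (isup _ Jst).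
move=> /= H; apply: Pnull_sub (H _ _) => [w /= ltw|w _|].
- split=> //; rewrite -lte_fin !fineE//; apply: (lt_le_trans ltw).
  exact: (seq_sup_ge s' 0).
- by rewrite -lee_fin !fineE.
- under eq_integral do rewrite fineE//.
  under [leRHS]eq_integral do rewrite fineE//.
  exact: le_trans (int_le_al _ Js') al_st.
Qed.

End EssentialSupremum.

(** * Retirement at a sequence of random times *)

Section Retirement.
Context {R : realType} {d : measure_display} {Omega : measurableType d}.
Variables (P : probability Omega R) (G : nat -> set (set Omega)).
Variables (GT : set (set Omega)) (E : nat -> set Omega) (p : nat -> Omega -> R).
Hypotheses (sG : forall j, sub_sigma (G j)) (sGT : sub_sigma GT).
Hypotheses (GS : forall j, G j `<=` G j.+1) (GGT : forall j, G j `<=` GT).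
Hypotheses (E0 : E 0 = set0) (ES : forall j, E j `<=` E j.+1).
Hypotheses (GE : forall j, G j (E j)) (covE : forall w, exists j, E j w).
Hypotheses (mp : forall j, meas_wrt (G j) (p j)).
Hypotheses (p01 : forall j w, 0 < p j w <= 1).
Hypothesis pE : forall j A, G j A ->
  (\int[P]_(w in A) (p j w)%:E = P (A `&` E j.+1))%E.

Let mG j A : G j A -> measurable A. Proof. exact: (sub_sigmaW (sG j)). Qed.
Let mE j : measurable (E j). Proof. exact: mG (GE j). Qed.

Lemma retire_homoG j k : (j <= k)%N -> G j `<=` G k.
Proof.
move=> /subnK <-; elim: (k - j)%N => [//|m IH]; rewrite addSn.
exact: subset_trans IH (@GS _).
Qed.

Lemma retire_homoE j k : (j <= k)%N -> E j `<=` E k.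
Proof.
move=> /subnK <-; elim: (k - j)%N => [//|m IH]; rewrite addSn.
exact: subset_trans IH (@ES _).
Qed.

Let exE w : exists j, `[< E j.+1 w >].
Proof.
have [[|j] Ew] := covE w; last by exists j; apply/asboolP.
by move: Ew; rewrite E0.
Qed.

(** [E j] is to be read as retirement before step j, so the step of retirement is the j with
    [E j.+1] but not [E j]. *)
Definition retire_idx w := ex_minn (exE w).

Lemma retire_idxP w : E (retire_idx w).+1 w /\ ~ E (retire_idx w) w.
Proof.
rewrite /retire_idx; case: ex_minnP => j /asboolP Ej minj; split=> //.
case: j Ej minj => [|j] Ej minj; first by rewrite E0.
by move=> Ejw; have /minj : `[< E j.+1 w >]; [exact/asboolP|rewrite ltnn].
Qed.

Lemma retire_idxE j w : E j.+1 w -> ~ E j w -> retire_idx w = j.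
Proof.
have [E1 E2] := retire_idxP w => Ej nEj.
case: (ltngtP (retire_idx w) j) => // lt_j; exfalso.
  exact/nEj/(retire_homoE lt_j).
exact/E2/(retire_homoE lt_j).
Qed.

Let hp k : R := 2^-1 ^+ k.
Let hp0 k : 0 < hp k. Proof. by rewrite exprn_gt0// invr_gt0. Qed.
Let hpS k : hp k.+1 = 2^-1 * hp k. Proof. by rewrite /hp exprS. Qed.

(** The j steps survived give 2^-j, and retirement at step j gives (1 + p) / (2 p). *)
Definition retire_factor j w : R := hp j.+1 * (1 + p j w) / p j w.

Definition retire_density w := retire_factor (retire_idx w) w.
Local Notation Z := retire_density.

Lemma retire_density_gt0 w : 0 < Z w.
Proof.
rewrite /Z /retire_factor; have /andP[p0 _] := p01 (retire_idx w) w.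
by rewrite divr_gt0// mulr_gt0// addr_gt0.
Qed.

Let mz j : meas_wrt (G j) (retire_factor j).
Proof.
apply: (meas_wrtM (sG j)).
  apply: (meas_wrtM (sG j)); first exact: (meas_wrt_cst (sG j)).
  by apply: (meas_wrtD (sG j)) => //; exact: (meas_wrt_cst (sG j)).
apply: (meas_wrtV (sG j)) => // w.
by rewrite gt_eqF//; case/andP: (p01 j w).
Qed.

Lemma meas_wrt_retire_glue (X : Omega -> R) (Xs : nat -> Omega -> R) :
  (forall j, meas_wrt GT (Xs j)) -> (forall w, X w = Xs (retire_idx w) w) ->
  meas_wrt GT X.
Proof.
move=> mXs XE; apply: (meas_wrt_glue sGT (E := fun j => E j.+1 `\` E j) (Xs := Xs)) => //.
- by move=> j; apply: (sub_sigmaD sGT); exact: GGT (GE _).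
- by move=> w; exists (retire_idx w); exact: retire_idxP.
- by move=> j w [Ej nEj]; rewrite XE (retire_idxE Ej nEj).
Qed.

Lemma meas_wrt_retire_density : meas_wrt GT Z.
Proof. by apply: meas_wrt_retire_glue => // j; exact: meas_wrtS (mz j). Qed.

Let mZ A : measurable_fun A (EFin \o Z).
Proof.
exact/measurable_EFinP/measurable_funTS/(meas_wrt_measurable sGT)/meas_wrt_retire_density.
Qed.

Let Z0 w : (0 <= (Z w)%:E)%E. Proof. by rewrite lee_fin ltW// retire_density_gt0. Qed.

Let ip j : P.-integrable setT (EFin \o p j).
Proof.
apply: (@integrable_bounded _ _ _ _ _ 1); first exact: (meas_wrt_measurable (sG j)).
by move=> w; have /andP[p0 p1] := p01 j w; rewrite ger0_norm// ltW.
Qed.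

Lemma integrable_indic1 (mu : probability Omega R) A : measurable A ->
  mu.-integrable setT (EFin \o (\1_A : Omega -> R)).
Proof.
move=> mA; apply: (@integrable_bounded _ _ _ _ _ 1) => // w.
by rewrite indicE; case: (_ \in _); rewrite ?normr1 ?normr0.
Qed.

Let finP (mu : probability Omega R) A : measurable A -> mu A \is a fin_num.
Proof. exact: fin_num_measure. Qed.

(** The factor is known at step j, so the indicator of [E j.+1] may be replaced by its conditional
    mean [p j], which cancels the denominator. *)
Let retire_step j A : G j A ->
  (\int[P]_(w in A `&` (E j.+1 `\` E j)) (Z w)%:E =
   \int[P]_(w in A `\` E j) (hp j.+1 * (1 + p j w))%:E)%E.
Proof.
move=> GA; have GAE : G j (A `\` E j) by exact: (sub_sigmaD (sG j)).
have -> : A `&` (E j.+1 `\` E j) = (A `\` E j) `&` E j.+1.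
  by rewrite !setDE [E j.+1 `&` _]setIC setIA.
rewrite (eq_integral (fun w => (retire_factor j w)%:E)); last first.
  by move=> w /[!inE] -[[_ nE] Ew]; rewrite /Z (retire_idxE Ew nE).
rewrite integral_setI_indicM (@integral_pull_out _ _ _ _ (sG j) P P _ (p j))//.
- apply: eq_integral => w _; rewrite /retire_factor divfK//.
  by rewrite gt_eqF//; case/andP: (p01 j w).
- exact/integrable_indic1/mE.
- by move=> w; case/andP: (p01 j w) => /ltW.
- move=> B GB; rewrite pE// integral_indic//; first by rewrite setIC.
  exact: mG GB.
Qed.

(** The numerator 1 + p turns the mass of step j into a difference of consecutive terms, ready for
    telescoping. *)
Let retire_stepE j A : G j A ->
  (\int[P]_(w in A `&` (E j.+1 `\` E j)) (Z w)%:E =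
   (hp j * fine (P (A `\` E j)) - hp j.+1 * fine (P (A `\` E j.+1)))%:E)%E.
Proof.
move=> GA; rewrite retire_step//.
have GAE : G j (A `\` E j) by exact: (sub_sigmaD (sG j)).
have mAE := mG GAE; have mA := mG GA.
under eq_integral do rewrite EFinM.
rewrite integralZl//; last first.
  apply: integrable_sub => //; apply: (@integrable_bounded _ _ _ _ _ 2).
    exact/(meas_wrt_measurable (sG j))/(meas_wrtD (sG j))/mp/(meas_wrt_cst (sG j)).
  move=> w; have /andP[p0 p1] := p01 j w.
  by rewrite ler_norml; lra.
under eq_integral do rewrite EFinD.
rewrite integralD_EFin//; last 2 first.
  exact: finite_measure_integrable_cst.
  exact: integrable_sub.
rewrite pE// (integral_cst P mAE 1%:E) mul1e.
have mB : measurable ((A `\` E j) `&` E j.+1) by exact: measurableI.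
have mC : measurable (A `\` E j.+1) by exact: measurableD.
have AE : P (A `\` E j) = (P ((A `\` E j) `&` E j.+1) + P (A `\` E j.+1))%E.
  rewrite -measureU//; last first.
    by apply/seteqP; split=> w //= -[[_ Ew] [_ /(_ Ew)]].
  congr (P _); apply/seteqP; split=> w /=.
    move=> [Aw nEj]; have [Ew|Ew] := pselect (E j.+1 w); first by left.
    by right.
  by move=> [[[]]//|[Aw nE]]; split=> // /ES.
transitivity ((hp j.+1)%:E * ((fine (P (A `\` E j)))%:E +
    (fine (P ((A `\` E j) `&` E j.+1)))%:E))%E; first by rewrite !fineK ?finP.
by rewrite -EFinD -EFinM; congr EFin; rewrite AE fineD ?finP// hpS; field.
Qed.

(** The steps from k on telescope; the remainder carries the factor 2^-(k + m) and vanishes, and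
    monotone convergence identifies the limit since every outcome retires. *)
Lemma integral_retire_density k A : G k A -> A `&` E k = set0 ->
  (\int[P]_(w in A) (Z w)%:E = (hp k * fine (P A))%:E)%E.
Proof.
move=> GA AE; have mA := mG GA.
have partial m : (\int[P]_(w in A `&` E (k + m)%N) (Z w)%:E =
    (hp k * fine (P A) - hp (k + m)%N * fine (P (A `\` E (k + m)%N)))%:E)%E.
  elim: m => [|m IH].
    rewrite addn0 AE integral_set0 (_ : A `\` E k = A) ?subrr//.
    apply/seteqP; split=> w /=; first by case.
    by move=> Aw; split=> // Ew; have : (A `&` E k) w by []; rewrite AE.
  rewrite addnS (_ : A `&` E (k + m).+1 =
      (A `&` E (k + m)%N) `|` (A `&` (E (k + m).+1 `\` E (k + m)%N))); last first.
    rewrite -setIUr; congr (_ `&` _); apply/seteqP; split=> w /=.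
      by move=> Ew; have [?|?] := pselect (E (k + m)%N w); [left|right].
    by move=> [/ES//|[]].
  have GAk : G (k + m)%N A by apply: retire_homoG GA; rewrite leq_addr.
  have mD : measurable (A `&` (E (k + m).+1 `\` E (k + m)%N)).
    by apply: measurableI => //; exact: measurableD.
  rewrite integral_setU//; [|exact: measurableI|]; last first.
    by apply/disj_setPS => w [[_ Ew] [_ []]].
  by rewrite IH retire_stepE// -EFinD addrA subrK.
have UA : \bigcup_m (A `&` E (k + m)%N) = A.
  rewrite -setI_bigcupr; apply/seteqP; split=> w /=; first by case.
  move=> Aw; split=> //; have [j Ej] := covE w; exists j => //.
  by apply: retire_homoE Ej; rewrite leq_addl.
rewrite -[in LHS]UA.
have h1 : (fun m => \int[P]_(w in A `&` E (k + m)%N) (Z w)%:E)%E @ \oo -->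
    (\int[P]_(w in \bigcup_m (A `&` E (k + m)%N)) (Z w)%:E)%E.
  apply: ge0_nondecreasing_set_cvg_integral => //.
  - move=> m1 m2 m12; apply/subsetPset => w [Aw Ew]; split=> //.
    by apply: retire_homoE Ew; rewrite leq_add2l.
  - by move=> m; exact: measurableI.
apply: (cvg_unique _ h1) => //.
rewrite [X in X @ _](_ : _ = fun m => (hp k * fine (P A) -
    hp (k + m)%N * fine (P (A `\` E (k + m)%N)))%:E); last first.
  by apply/funext => m; exact: partial.
apply: cvg_EFin; first by near=> m.
rewrite -[X in _ --> X]subr0.
apply: cvgB; first exact: cvg_cst.
apply: (@squeeze_cvgr _ _ _ _ (cst 0) (fun m => hp m)).
- near=> m => /=; have mAE : measurable (A `\` E (k + m)%N) by exact: measurableD.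
  apply/andP; split; first by rewrite mulr_ge0 ?fine_ge0// ltW.
  rewrite -[leRHS]mulr1 ler_pM ?fine_ge0//; first exact: ltW.
    rewrite /hp exprD ler_piMl ?exprn_ge0 ?invr_ge0//.
    by rewrite exprn_ile1 ?invr_ge0// invf_le1// ler1n.
  by rewrite -lee_fin fineK ?finP//; exact: probability_le1.
- exact: cvg_cst.
- by apply: cvg_expr; rewrite ger0_norm ?invr_ge0// invf_lt1// ltr1n.
Unshelve. all: by end_near.
Qed.

Lemma retire_probability : exists2 Q : probability Omega R,
  (forall A, (Q A = \int[P]_(w in A) (Z w)%:E)%E) & forall A, G 0 A -> Q A = P A.
Proof.
have ZP A : G 0 A -> (\int[P]_(w in A) (Z w)%:E = P A)%E.
  move=> GA; rewrite (@integral_retire_density 0)//; last by rewrite E0 setI0.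
  by rewrite /hp expr0 mul1r fineK// finP//; exact: mG GA.
have Z1 : (\int[P]_w (Z w)%:E = 1)%E.
  by rewrite ZP ?probability_setT//; exact: (sub_sigmaT (sG 0)).
have iZ : P.-integrable setT (EFin \o Z).
  apply/integrableP; split => //.
  rewrite (eq_integral (EFin \o Z)); first by rewrite Z1 ltry.
  by move=> w _; rewrite gee0_abs//; exact: Z0.
have [Q QE] := density_probability iZ (fun w => ltW (retire_density_gt0 w)) Z1.
by exists Q => // A GA; rewrite QE ZP.
Qed.

Section retirement_martingale.
Variables (Q : probability Omega R) (x : nat -> Omega -> R) (K : R).
Hypothesis QE : forall A, (Q A = \int[P]_(w in A) (Z w)%:E)%E.
Hypotheses (GN : forall j, Pnull P `<=` G j).
Hypotheses (mx : forall j, meas_wrt (G j.+1) (x j)).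
Hypotheses (xK : forall j w, `|x j w| <= K).

Let K0 : 0 <= K. Proof. exact: le_trans (xK 0 point). Qed.

Let retire_out j A : G j A -> (Q (A `\` E j) = (hp j)%:E * P (A `\` E j))%E.
Proof.
move=> GA; have GAE : G j (A `\` E j) by exact: (sub_sigmaD (sG j)).
rewrite QE (@integral_retire_density j)//; last by rewrite setDE -setIA setICl setI0.
by rewrite EFinM fineK// finP//; exact: mG GAE.
Qed.

Let y j w : R := x j w * \1_(~` E j.+1) w.

Let my j : measurable_fun setT (y j).
Proof.
apply: measurable_funM; first exact: (meas_wrt_measurable (sG j.+1)).
by apply: measurable_indic; exact: measurableC.
Qed.

Let yK j w : - K <= y j w <= K.
Proof.
rewrite -ler_norml /y indicE normrM; case: (_ \in _) => /=.
  by rewrite normr1 mulr1.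
by rewrite normr0 mulr0.
Qed.

(* The value - e / (1 + p) taken on retirement is the one that makes the
   increment centred under Q. *)
Let increments : exists dd : nat -> Omega -> R, forall j,
  [/\ meas_wrt (G j.+1) (dd j),
      forall w, `|dd j w| <= K * \1_(~` E j) w,
      forall w, ~ E j.+1 w -> dd j w = x j w
    & forall A, G j A -> (\int[Q]_(w in A) (dd j w)%:E = 0)%E].
Proof.
suff /choice[dd ddP] : forall j, exists d : Omega -> R,
    [/\ meas_wrt (G j.+1) d, forall w, `|d w| <= K * \1_(~` E j) w,
      forall w, ~ E j.+1 w -> d w = x j w
    & forall A, G j A -> (\int[Q]_(w in A) (d w)%:E = 0)%E] by exists dd.
move=> j.
have NKK : - K <= K by rewrite ge0_cp.
have [e [me ie eE] eK] := cond_exp_exists_range (sG j) (@GN j) (my j) NKK (@yK j).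
pose c w := e w / (1 + p j w).
have p1_gt0 w : 0 < 1 + p j w.
  by have /andP[p0 _] := p01 j w; rewrite addr_gt0.
have p1_neq0 w : 1 + p j w != 0 by rewrite gt_eqF.
have mc : meas_wrt (G j) c.
  apply: (meas_wrtM (sG j)) => //; apply: (meas_wrtV (sG j)) => //.
  by apply: (meas_wrtD (sG j)) => //; exact: (meas_wrt_cst (sG j)).
have cK w : `|c w| <= K.
  rewrite /c normrM normfV (gtr0_norm (p1_gt0 w)) ler_pdivrMr//.
  have := eK w; rewrite -ler_norml => /le_trans; apply.
  by rewrite ler_peMr// lerDl; case/andP: (p01 j w) => /ltW.
pose u1 : Omega -> R := \1_(E j.+1 `\` E j).
pose u2 : Omega -> R := \1_(~` E j.+1).
have GE1 : G j.+1 (E j) by apply: GS; exact: GE.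
have mu1 : meas_wrt (G j.+1) u1.
  by apply: (meas_wrt_indic (sG _)); exact: (sub_sigmaD (sG _)).
have mu2 : meas_wrt (G j.+1) u2.
  by apply: (meas_wrt_indic (sG _)); exact: (sub_sigmaC (sG _)).
have mc1 : meas_wrt (G j.+1) c by exact: meas_wrtS mc.
have m1 : meas_wrt (G j.+1) (fun w => c w * u1 w) by exact: (meas_wrtM (sG _)).
have m2 : meas_wrt (G j.+1) (fun w => x j w * u2 w) by exact: (meas_wrtM (sG _)).
have boundM (a : Omega -> R) A w : (forall w, `|a w| <= K) -> `|a w * \1_A w| <= K.
  move=> aK; rewrite normrM indicE; case: (_ \in _) => /=.
    by rewrite normr1 mulr1.
  by rewrite normr0 mulr0.
exists (fun w => x j w * u2 w - c w * u1 w); split.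
- exact: (meas_wrtB (sG _)).
- move=> w; rewrite /u1 /u2 !indicE !in_setC in_setD.
  have [Ej|nEj] := boolP (w \in E j).
    have -> : w \in E j.+1 by move: Ej; rewrite !inE; exact: ES.
    by rewrite /= !mulr0 subrr normr0.
  by case: (w \in E j.+1) => /=; rewrite !mulr0 !mulr1 ?sub0r ?subr0 ?normrN.
- move=> w nE; rewrite /u1 /u2 !indicE !in_setC in_setD.
  by rewrite (_ : w \in E j.+1 = false)/= ?mulr0 ?mulr1 ?subr0//; apply/negP; rewrite inE.
- move=> A GA; have mA := mG GA.
  have i1 : Q.-integrable A (EFin \o (fun w => c w * u1 w)).
    apply: integrable_sub => //; apply: (@integrable_bounded _ _ _ _ _ K).
      exact: (meas_wrt_measurable (sG _)) m1.
    by move=> w; exact: boundM.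
  have i2 : Q.-integrable A (EFin \o (fun w => x j w * u2 w)).
    apply: integrable_sub => //; apply: (@integrable_bounded _ _ _ _ _ K).
      exact: (meas_wrt_measurable (sG _)) m2.
    by move=> w; exact: boundM.
  under eq_integral do rewrite EFinB.
  rewrite integralB_EFin//.
  (* Back from Q to P: [v1] represents the Q-weight of [u1] on events of [G j], and [v2] that of
     [u2] on events of [G j.+1], where survival costs 2^-(j + 1). After this both integrals become
     that of e over the part of A outside [E j], up to the same constant. *)
  pose v1 w : R := hp j.+1 * (1 + p j w) * \1_(~` E j) w.
  pose v2 w : R := hp j.+1 * \1_(~` E j.+1) w.
  have mpj : measurable_fun setT (p j) by exact: (meas_wrt_measurable (sG j)).
  have v1_ge0 w : 0 <= v1 w by rewrite /v1 mulr_ge0 ?indicE// mulr_ge0// ltW.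
  have v2_ge0 w : 0 <= v2 w by rewrite /v2 mulr_ge0 ?indicE// ltW.
  have iv1 : P.-integrable setT (EFin \o v1).
    apply: (@integrable_bounded _ _ _ _ _ (hp j.+1 * 2)).
      apply: measurable_funM; last by apply: measurable_indic; exact: measurableC.
      by apply: measurable_funM => //; exact: measurable_funD.
    move=> w; rewrite ger0_norm// /v1 -mulrA ler_wpM2l ?(ltW (hp0 _))//.
    have /andP[p0 p1] := p01 j w.
    rewrite indicE; case: (_ \in _); rewrite /= ?mulr1 ?mulr0//.
    by rewrite -[leRHS]/(1 + 1) lerD2l.
  have iv2 : P.-integrable setT (EFin \o v2).
    apply: (@integrable_bounded _ _ _ _ _ (hp j.+1)).
      by apply: measurable_funM => //; apply: measurable_indic; exact: measurableC.
    move=> w; rewrite ger0_norm// /v2.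
    by rewrite indicE; case: (_ \in _); rewrite /= ?mulr1 ?mulr0// ltW.
  have -> : (\int[Q]_(w in A) (c w * u1 w)%:E = \int[P]_(w in A) (c w * v1 w)%:E)%E.
    apply: (integral_pull_out (sG j)) => //.
    - by apply: integrable_indic1; exact: measurableD.
    - move=> B GB; have mB := mG GB.
      rewrite integral_indic//; last exact: measurableD.
      transitivity (Q (B `&` (E j.+1 `\` E j))); first by rewrite setIC.
      by rewrite QE retire_step// setDE integral_setI_indicM.
  have -> : (\int[Q]_(w in A) (x j w * u2 w)%:E = \int[P]_(w in A) (x j w * v2 w)%:E)%E.
    apply: (integral_pull_out (sG j.+1)) => //; last exact: GS.
    - by apply: integrable_indic1; exact: measurableC.
    - move=> B GB; have mB := mG GB.
      rewrite integral_indic//; last exact: measurableC.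
      transitivity (Q (B `\` E j.+1)); first by rewrite setIC -setDE.
      rewrite retire_out//.
      under eq_integral do rewrite /v2 EFinM.
      rewrite integralZl//; last first.
        by apply: integrable_sub => //; apply: integrable_indic1; exact: measurableC.
      by rewrite integral_indic 1?setIC//; exact: measurableC.
  have GAE : G j (A `\` E j) by exact: (sub_sigmaD (sG j)).
  have iy : P.-integrable setT (EFin \o y j).
    by apply: (@integrable_bounded _ _ _ _ _ K) => // w; rewrite ler_norml.
  have -> : (\int[P]_(w in A) (x j w * v2 w)%:E =
      (hp j.+1)%:E * \int[P]_(w in A `\` E j) (y j w)%:E)%E.
    rewrite -integralZl//; [|exact: mG GAE|by apply: integrable_sub => //; exact: mG GAE].
    under [RHS]eq_integral do rewrite -EFinM.
    rewrite setDE integral_setI_indicM; apply: eq_integral => w _; congr EFin.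
    rewrite /v2 /y !indicE !in_setC.
    have [Ej|nEj] := boolP (w \in E j).
      have -> : w \in E j.+1 by move: Ej; rewrite !inE; exact: ES.
      by rewrite /= !mulr0.
    by rewrite /= mulr1; ring.
  have -> : (\int[P]_(w in A) (c w * v1 w)%:E =
      (hp j.+1)%:E * \int[P]_(w in A `\` E j) (e w)%:E)%E.
    rewrite -integralZl//; [|exact: mG GAE|by apply: integrable_sub => //; exact: mG GAE].
    under [RHS]eq_integral do rewrite -EFinM.
    rewrite setDE integral_setI_indicM; apply: eq_integral => w _; congr EFin.
    by rewrite /v1 /c mulrA [_ * (1 + _)]mulrC mulrA divfK ?[e w * _]mulrC// -mulrA.
  rewrite eE// subee// fin_numM//; apply: integrable_fin_num; first exact: mG GAE.
  by apply: integrable_sub => //; exact: mG GAE.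
Qed.

(** The corrected increments are centred and vanish after retirement. Their partial sums s are
    eventually constant, and their limit zeta closes the discrete martingale by dominated
    convergence. *)
Lemma retire_martingale : exists (zeta : Omega -> R) (s : nat -> Omega -> R),
  [/\ meas_wrt GT zeta, Q.-integrable setT (EFin \o zeta),
      forall k, Q.-integrable setT (EFin \o s k),
      forall k A, G k A ->
        (\int[Q]_(w in A) (zeta w)%:E = \int[Q]_(w in A) (s k w)%:E)%E
    & [/\ forall k w, ~ E k w -> s k w = \sum_(j < k) x j w,
          forall k w, `|s k.+1 w - s k w| <= K
        & forall k w, E k.+1 w -> ~ E k w -> zeta w = s k.+1 w]].
Proof.
have [dd ddP] := increments.
pose s k w := \sum_(j < k) dd j w.
have dd0 j w : E j w -> dd j w = 0.
  move=> Ew; have [_ /(_ w) + _ _] := ddP j.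
  by rewrite indicE in_setC mem_set//= mulr0 normr_le0 => /eqP.
have mdd j : measurable_fun setT (dd j).
  by have [m _ _ _] := ddP j; exact: (meas_wrt_measurable (sG j.+1)).
have ddK j w : `|dd j w| <= K.
  have [_ /(_ w) /le_trans + _ _] := ddP j; apply.
  by rewrite indicE; case: (_ \in _); rewrite /= ?mulr1 ?mulr0.
have idd j : Q.-integrable setT (EFin \o dd j) by exact: integrable_bounded.
have sE k w : (s k w)%:E = (\sum_(j < k) (dd j w)%:E)%E by rewrite sumEFin.
have is_ k : Q.-integrable setT (EFin \o s k).
  rewrite (_ : EFin \o s k = fun w => \sum_(j < k) (dd j w)%:E)%E; last first.
    by apply/funext => w; exact: sE.
  by apply: integrable_sum => // j _; exact: idd.
pose zeta w := s (retire_idx w).+1 w.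
have s_stable w m : (retire_idx w < m)%N -> s m w = zeta w.
  move=> /subnK <-; elim: (m - _)%N => [//|k IH].
  rewrite addSn /s big_ord_recr/= -/(s _ w) IH dd0 ?addr0//.
  have [Ew _] := retire_idxP w; apply: retire_homoE Ew.
  by rewrite leq_addl.
have mzeta : meas_wrt GT zeta.
  apply: (meas_wrt_retire_glue (Xs := fun j w => s j.+1 w)) => // j.
  rewrite /s; elim: j.+1 => [|k IH].
    under [X in meas_wrt _ X]eq_fun do rewrite big_ord0.
    exact: (meas_wrt_cst sGT).
  under [X in meas_wrt _ X]eq_fun do rewrite big_ord_recr/=.
  by apply: (meas_wrtD sGT) => //; have [m _ _ _] := ddP k; exact: meas_wrtS m.
(* Each step taken costs at most K, so g dominates all the partial sums; it is integrable because
   step j is reached with Q-probability at most 2^-j. *)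
pose g w : \bar R := (\sum_(0 <= j <oo) (K * \1_(~` E j) w)%:E)%E.
have gj0 j w : (0 <= (K * \1_(~` E j) w)%:E)%E by rewrite lee_fin mulr_ge0// indicE.
have mgj j A : measurable_fun A (fun w => (K * \1_(~` E j) w)%:E).
  apply/measurable_EFinP/measurable_funM => //; apply: measurable_indic.
  exact: measurableC.
have mg : measurable_fun setT g.
  by apply: ge0_emeasurable_sum => // j w _ _; exact: gj0.
have ig : Q.-integrable setT g.
  apply/integrableP; split=> //.
  under eq_integral do rewrite gee0_abs ?nneseries_ge0//.
  rewrite /g integral_nneseries//.
  (* The terms are K / 2^j, written in the form of a geometric series of ratio 1/2. *)
  apply: (@le_lt_trans _ _ (\sum_(0 <= j <oo) ((K * 2) / (2 ^ (j + 1))%:R)%:E)%E).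
    apply: lee_nneseries => [j _ _|j _]; first by apply: integral_ge0.
    under eq_integral do rewrite EFinM.
    rewrite integralZl//; last by apply: integrable_indic1; exact: measurableC.
    rewrite integral_indic//; last exact: measurableC.
    rewrite setIT -setTD.
    rewrite [X in (_ * X)%E](retire_out (sub_sigmaT (sG j))).
    rewrite -[P _]fineK; last by apply: finP; exact: measurableD.
    rewrite -!EFinM lee_fin -mulrA ler_wpM2l// natrX addn1 exprS invfM mulrA divff// mul1r.
    rewrite -[leRHS]mulr1 -exprVn ler_wpM2l ?(ltW (hp0 _))//.
    rewrite -lee_fin fineK ?finP//; last exact: measurableD.
    by apply: probability_le1; exact: measurableD.
  have := @cvg_geometric_eseries_half R (K * 2) 0.
  by move/cvg_lim => ->//; rewrite ltry.
have sg m w : (`|(s m w)%:E| <= g w)%E.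
  apply: (@le_trans _ _ (\sum_(0 <= j < m) (K * \1_(~` E j) w)%:E)%E); last first.
    exact: nneseries_lim_ge.
  rewrite big_mkord /= sumEFin lee_fin; apply: (le_trans (ler_norm_sum _ _ _)).
  by apply: ler_sum => j _; have [_ + _ _] := ddP j; exact.
have cvs w : (fun m => (s m w)%:E) @ \oo --> (zeta w)%:E.
  by apply: cvg_near_cst; exists (retire_idx w).+1 => // m /= le_m; rewrite s_stable.
have msA m A : measurable_fun A (fun w => (s m w)%:E).
  by apply: measurable_funTS; exact: measurable_int (is_ m).
have mzA A : measurable_fun A (EFin \o zeta).
  exact/measurable_EFinP/measurable_funTS/(meas_wrt_measurable sGT).
have dom A : measurable A -> Q.-integrable A (EFin \o zeta) /\
    (fun m => \int[Q]_(w in A) (s m w)%:E)%E @ \oo --> (\int[Q]_(w in A) (zeta w)%:E)%E.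
  move=> mA.
  have [|||? _ ?//] := @dominated_convergence _ _ _ Q A mA (fun m w => (s m w)%:E)
    (EFin \o zeta) g (fun m => msA m A) (mzA A).
  - by apply: aeW => w _; exact: cvs.
  - exact: integrableS ig.
  - by apply: aeW => w m _; exact: sg.
exists zeta, s; split=> //; [by case: (dom _ measurableT)| |split].
- move=> k A GA; have mA := mG GA.
  have [_ cvA] := dom _ mA; apply: (cvg_unique _ cvA) => //.
  apply: cvg_near_cst; exists k => // m /= km.
  rewrite -(subnK km); elim: (m - k)%N => [//|l IH].
  rewrite addSn; under eq_integral do rewrite /s big_ord_recr/= EFinD.
  rewrite integralD_EFin//; [|exact: integrable_sub (is_ _)|exact: integrable_sub].
  rewrite IH; have [_ _ _ ->] := ddP (l + k)%N; first by rewrite adde0.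
  by apply: retire_homoG GA; rewrite leq_addl.
- move=> k w nE; apply: eq_bigr => j _; have [_ _ + _] := ddP j; apply.
  by apply: contra_not nE; exact: retire_homoE.
- by move=> k w; rewrite /s big_ord_recr/= addrAC subrr add0r.
- by move=> k w Ek nEk; rewrite /zeta (retire_idxE Ek nEk).
Qed.

End retirement_martingale.

End Retirement.

(** * Right-continuous paths and stopping times *)

Section RightLimits.
Context {R : realType}.
Implicit Types (f : R -> R) (s t T : R).

Lemma right_cvg_ex f t l e : f @ t^'+ --> l -> 0 < e ->
  exists2 del, 0 < del & forall u, t < u < t + del -> `|f u - l| < e.
Proof.
move=> /cvgrPdist_lt /(_ e) H e0; have [del /= del0 Hdel] := H e0.
exists del => // u /andP[tu ut]; rewrite distrC; apply: Hdel => //=.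
by rewrite ltr_distlC; apply/andP; split=> //; lra.
Qed.

Lemma left_cvg_ex f t l e : f @ t^'- --> l -> 0 < e ->
  exists2 del, 0 < del & forall u, t - del < u < t -> `|f u - l| < e.
Proof.
move=> /cvgrPdist_lt /(_ e) H e0; have [del /= del0 Hdel] := H e0.
exists del => // u /andP[tu ut]; rewrite distrC; apply: Hdel => //=.
by rewrite ltr_distlC; apply/andP; split=> //; lra.
Qed.

Lemma cvg_right_seq f t (u : nat -> R) : f @ t^'+ --> f t ->
  (forall m, t <= u m) -> u @ \oo --> t -> (f \o u) @ \oo --> f t.
Proof.
move=> ft tu ut; apply/cvgrPdist_lt => e e0.
have [del del0 Hdel] := right_cvg_ex ft e0.
move/cvgrPdist_lt : ut => /(_ _ del0); apply: filterS => m.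
rewrite distrC ltr_distl => /andP[_ um]; rewrite distrC /=.
have := tu m; rewrite le_eqVlt => /predU1P[<-|tum]; first by rewrite subrr normr0.
by apply: Hdel; rewrite tum.
Qed.

Lemma cvg_left_seq f t (u : nat -> R) : f @ t^'- --> f t ->
  (forall m, u m <= t) -> u @ \oo --> t -> (f \o u) @ \oo --> f t.
Proof.
move=> ft tu ut; apply/cvgrPdist_lt => e e0.
have [del del0 Hdel] := left_cvg_ex ft e0.
move/cvgrPdist_lt : ut => /(_ _ del0); apply: filterS => m.
rewrite distrC ltr_distl => /andP[um _]; rewrite distrC /=.
have := tu m; rewrite le_eqVlt => /predU1P[->|tum]; first by rewrite subrr normr0.
by apply: Hdel; rewrite tum um.
Qed.

Lemma cvg_right_min f s t : f @ t^'+ --> f t ->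
  (fun u => f (Num.min u s)) @ t^'+ --> f (Num.min t s).
Proof.
move=> ft; have [ts|st] := ltP t s.
  apply: cvg_trans ft; apply: near_eq_cvg; near=> u.
  by rewrite min_l// ltW//; near: u; exact: nbhs_right_lt.
by apply: cvg_near_cst; near=> u; rewrite min_r// (le_trans st).
Unshelve. all: by end_near.
Qed.

(** Consider the times up to which f is bounded: the left limit puts their supremum among them, and
    right-continuity lets it be passed unless it is T. *)
Lemma cadlag_fun_bounded f T : 0 <= T ->
  (forall t, 0 <= t < T -> f @ t^'+ --> f t) ->
  (forall t, 0 < t <= T -> cvg (f @ t^'-)) ->
  exists M, forall t, 0 <= t <= T -> `|f t| <= M.
Proof.
move=> T0 fr fl.
pose A := [set t | 0 <= t <= T /\ exists M, forall u, 0 <= u <= t -> `|f u| <= M].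
have A0 : A 0.
  split; first by rewrite lexx.
  by exists `|f 0| => u; rewrite -eq_le => /eqP <-.
have supA : has_sup A by split; [exists 0|exists T => t [/andP[]]].
set s := sup A.
have s0T : 0 <= s <= T.
  by rewrite ub_le_sup//=; [apply: ge_sup; [exists 0|move=> t [/andP[]]]|exists T => t [/andP[]]].
have /andP[s0 sT] := s0T.
have As : A s.
  split=> //; move: s0; rewrite le_eqVlt => /predU1P[<-|s_gt0]; first by case: A0.
  have /fl/left_cvg_ex : 0 < s <= T by rewrite s_gt0.
  move=> /(_ _ ltr01)[del del0 Hdel].
  have [a [/andP[a0 aT] [M HM]] sa] := sup_adherent del0 supA.
  exists (Num.max (Num.max M `|f s|) (`|lim (f @ s^'-)| + 1)) => u /andP[u0 us].
  have [ua|au] := leP u a; first by rewrite !le_max HM ?u0.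
  move: us; rewrite le_eqVlt => /predU1P[->|us]; first by rewrite !le_max lexx orbT.
  rewrite le_max; apply/orP; right.
  have := Hdel u; rewrite us (lt_trans sa)// => /(_ isT)/ltW fu.
  by rewrite -[f u](subrK (lim (f @ s^'-))) addrC (le_trans (ler_normD _ _))// lerD2l.
move: sT; rewrite le_eqVlt => /predU1P[<-|sT]; first by case: As.
have /fr/right_cvg_ex : 0 <= s < T by rewrite s0.
move=> /(_ _ ltr01)[del del0 Hdel]; exfalso.
pose r := Num.min T (s + del / 2).
have sr : s < r by rewrite /r lt_min sT ltrDl divr_gt0.
have : A r.
  split; first by rewrite (le_trans s0 (ltW sr)) ge_min lexx.
  have [_ [M HM]] := As; exists (Num.max M (`|f s| + 1)) => u /andP[u0 ur].
  have [us|su] := leP u s; first by rewrite le_max HM ?u0.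
  rewrite le_max; apply/orP; right.
  have /ltW fu : `|f u - f s| < 1.
    apply: Hdel; rewrite su (le_lt_trans ur)// /r gt_min; apply/orP; right.
    by rewrite ltrD2l ltr_pdivrMr// ltr_pMr// ltr1n.
  by rewrite -[f u](subrK (f s)) addrC (le_trans (ler_normD _ _))// lerD2l.
move=> Ar; have : r <= s by apply: sup_upper_bound.
by rewrite leNgt sr.
Qed.

Let ex_grid_idx m s : exists k : nat, s * m.+1%:R <= k%:R.
Proof.
exists (Num.bound `|s * m.+1%:R|); rewrite (le_trans (ler_norm _))// ltW//.
exact: archi_boundP.
Qed.

(* The least k with s <= k / (m + 1): rounding up keeps [grid_idx m tau <= k]
   an event known at time k / (m + 1) when tau is a stopping time. *)
Definition grid_idx m s := ex_minn (ex_grid_idx m s).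

Lemma grid_idx_le m s k : (grid_idx m s <= k)%N = (s <= k%:R / m.+1%:R).
Proof.
rewrite ler_pdivlMr// /grid_idx; case: ex_minnP => j Pj minj.
apply/idP/idP => [jk|/minj//]; apply: (le_trans Pj); by rewrite ler_nat.
Qed.

Definition grid_up m s : R := (grid_idx m s)%:R / m.+1%:R.

Lemma grid_up_ge m s : s <= grid_up m s.
Proof. by rewrite /grid_up -grid_idx_le. Qed.

Lemma grid_up_le m s : 0 <= s -> grid_up m s <= s + m.+1%:R^-1.
Proof.
move=> s0; rewrite /grid_up; have [->|k0] := eqVneq (grid_idx m s) 0%N.
  by rewrite mul0r addr_ge0.
have : ~~ (grid_idx m s <= (grid_idx m s).-1)%N by rewrite -ltnNge ltn_predL lt0n.
rewrite grid_idx_le -ltNge => /ltW; case: (grid_idx m s) k0 => // k _ /=.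
by rewrite -[k.+1%:R]natr1 mulrDl div1r lerD2r.
Qed.

Lemma cvg_grid_up s T : 0 <= s <= T ->
  (fun m => Num.min T (grid_up m s)) @ \oo --> s.
Proof.
move=> /andP[s0 sT].
apply: (@squeeze_cvgr _ _ _ _ (cst s) (fun m => s + m.+1%:R^-1)).
- near=> m; rewrite le_min sT grid_up_ge/= ge_min grid_up_le// orbT//.
- exact: cvg_cst.
- rewrite -[X in _ --> X]addr0; apply: cvgD; first exact: cvg_cst.
  exact: cvg_harmonic.
Unshelve. all: by end_near.
Qed.

(** Right limits recover the values at times before T from the grid; capping at T makes T itself a
    grid point. *)
Definition grid_time T i : R :=
  if unpickle i is Some (m, k) then Num.min T (k%:R / m.+1%:R) else 0.

Lemma grid_time_itv T i : 0 <= T -> 0 <= grid_time T i <= T.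
Proof.
move=> T0; rewrite /grid_time; case: unpickle => [[m k]|]; last by rewrite lexx.
by rewrite le_min T0 divr_ge0//= ge_min lexx.
Qed.

Lemma grid_time_up T m s : exists i, grid_time T i = Num.min T (grid_up m s).
Proof. by exists (pickle (m, grid_idx m s)); rewrite /grid_time pickleK. Qed.

Lemma grid_timeT T : exists i, grid_time T i = T.
Proof.
have [i iE] := grid_time_up T 0 T; exists i.
by rewrite iE min_l// grid_up_ge.
Qed.

Lemma ereal_sup_grid f T : 0 <= T -> (forall t, 0 <= t < T -> f @ t^'+ --> f t) ->
  ereal_sup [set (f t)%:E | t in [set t | 0 <= t <= T]] =
  ereal_sup (range (fun i => (f (grid_time T i))%:E)).
Proof.
move=> T0 fr; apply/eqP; rewrite eq_le; apply/andP; split; last first.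
  apply: le_ereal_sup => _ [i _ <-]; exists (grid_time T i) => //=.
  exact: grid_time_itv.
apply: ub_ereal_sup => _ [t /= /andP[t0 tT] <-].
have [->|tneT] := eqVneq t T.
  have [i iE] := grid_timeT T; apply: ereal_sup_ubound.
  by exists i => //; rewrite iE.
have /fr ft : 0 <= t < T by rewrite t0 lt_neqAle tneT.
have : (fun m => (f (Num.min T (grid_up m t)))%:E) @ \oo --> (f t)%:E.
  apply: cvg_EFin; first by near=> m.
  apply: (@cvg_right_seq f t (fun m => Num.min T (grid_up m t))) => //.
    by move=> m; rewrite le_min tT grid_up_ge.
  by apply: cvg_grid_up; rewrite t0.
move=> cf; rewrite -(cvg_lim _ cf)//; apply: lime_le.
  by apply/cvg_ex; exists (f t)%:E.
near=> m; apply: ereal_sup_ubound; have [i <-] := grid_time_up T m t.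
by exists i.
Unshelve. all: by end_near.
Qed.

End RightLimits.

Section EuclideanNorm.
Context {R : realType} {n : nat}.
Implicit Types v : 'rV[R]_n.

Lemma enorm_ge0 v : 0 <= enorm v.
Proof. exact: sqrtr_ge0. Qed.

Lemma enorm0 : enorm (0 : 'rV[R]_n) = 0.
Proof.
by rewrite /enorm big1 ?sqrtr0// => i _; rewrite mxE expr0n.
Qed.

Lemma coord_le_enorm v i : `|v ord0 i| <= enorm v.
Proof.
rewrite -sqrtr_sqr ler_wsqrtr// (bigD1 i)//= lerDl sumr_ge0// => j _.
exact: sqr_ge0.
Qed.

Lemma enorm_le_sum v : enorm v <= \sum_(i < n) `|v ord0 i|.
Proof.
have s0 : 0 <= \sum_(i < n) `|v ord0 i| by apply: sumr_ge0.
rewrite -[leRHS](ger0_norm s0) -sqrtr_sqr ler_wsqrtr//.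
rewrite [leRHS]expr2 mulr_suml; apply: ler_sum => i _.
rewrite -real_normK ?num_real// expr2 ler_wpM2l//.
by rewrite (bigD1 i)//= lerDl sumr_ge0.
Qed.

Lemma cvg_enorm {U : Type} {D : set_system U} {FD : Filter D} (V : U -> 'rV[R]_n) v :
  (forall i, (fun u => V u ord0 i) @ D --> v ord0 i) ->
  (fun u => enorm (V u)) @ D --> enorm v.
Proof.
move=> cV; rewrite /enorm.
apply: (@continuous_cvg _ _ _ _ _ _ (@Num.sqrt R)); first exact: sqrt_continuous.
apply: cvg_big => [|i _]; first exact: add_continuous.
by rewrite expr2; under eq_fun do rewrite expr2; exact: cvgM.
Qed.

Lemma meas_wrt_enorm {d : measure_display} {Omega : measurableType d}
    (G : set (set Omega)) (V : Omega -> 'rV[R]_n) : sub_sigma G ->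
  (forall i, meas_wrt G (fun w => V w ord0 i)) -> meas_wrt G (fun w => enorm (V w)).
Proof.
move=> sG mV; rewrite /enorm; apply: (@meas_wrt_comp _ _ _ _ sG Num.sqrt).
  by apply: nondecreasing_measurable => // x y xy; exact: ler_wsqrtr.
apply/(meas_wrtP sG); apply: measurable_sum => i.
by apply: measurable_funX; exact/(meas_wrtP sG).
Qed.

End EuclideanNorm.

Section StoppingTimes.
Context {R : realType} {d : measure_display} {Omega : measurableType d}.
Variables (P : probability Omega R) (T : R) (F : R -> set (set Omega)).
Hypotheses (T0 : 0 < T) (ucF : usual_conditions P T F).

Let sF t : 0 <= t <= T -> sub_sigma (F t).
Proof. by case: ucF => -[+ _] _ _; exact. Qed.

Let FS s t : 0 <= s -> s <= t -> t <= T -> F s `<=` F t.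
Proof. by case: ucF => -[_ +] _ _; exact. Qed.

Let T0T : 0 <= T <= T. Proof. by rewrite lexx ltW. Qed.

Lemma usual_sub_sigmaT : sub_sigma (F T). Proof. exact: sF. Qed.

Lemma usual_Pnull t : 0 <= t <= T -> Pnull P `<=` F t.
Proof.
by move=> /andP[t0 tT] A nA; apply: (@FS 0 t) => //; case: ucF => _ _; exact.
Qed.

Section stopping.
Variable tau : Omega -> R.
Hypothesis stau : stopping_time T F tau.
Local Notation Ftau := (sigma_at T F tau).

Let Ftle t : 0 <= t <= T -> F t [set w | tau w <= t].
Proof. by case: stau => _; exact. Qed.

Lemma sigma_at_sub_sigma : sub_sigma Ftau.
Proof.
split; last by move=> A [].
split.
- split=> // t t0T; rewrite set0I; exact: (sub_sigma0 (sF t0T)).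
- move=> A [mA FA]; rewrite setTD; split; first exact: measurableC.
  move=> t t0T; rewrite (_ : _ `&` _ = [set w | tau w <= t] `\` (A `&` [set w | tau w <= t])).
    by apply: (sub_sigmaD (sF t0T)); [exact: Ftle|exact: FA].
  apply/seteqP; split=> w /=; first by move=> [nA tw]; split=> // -[].
  by move=> [tw nA]; split=> // Aw; exact: nA.
- move=> A FA; split; first by apply: bigcup_measurable => k _; case: (FA k).
  move=> t t0T; rewrite setI_bigcupl; apply: (sub_sigma_bigcup (sF t0T)) => k.
  by case: (FA k) => _; exact.
Qed.

Lemma sigma_at_subT : Ftau `<=` F T.
Proof.
move=> A [_ /(_ T T0T)]; rewrite (_ : _ `&` _ = A)//.
apply/seteqP; split=> w /=; first by case.
by move=> Aw; split=> //; case: stau => /(_ w)/andP[].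
Qed.

Lemma sigma_at_Pnull : Pnull P `<=` Ftau.
Proof.
move=> A nA; split.
  by apply: (sub_sigmaW (sF T0T)); exact: usual_Pnull.
by move=> t t0T; apply: usual_Pnull => //; apply: Pnull_sub nA; exact: subIsetl.
Qed.

(** Carries events of a fixed time over to a random time, where Q and P agree or where the terminal
    value may be replaced by a partial sum. *)
Lemma sigma_at_before t A : 0 <= t <= T -> F t A ->
  A `<=` [set w | t < tau w] -> Ftau A.
Proof.
move=> t0T FA At; have /andP[t0 tT] := t0T.
split; first exact: (sub_sigmaW (sF t0T)).
move=> u u0T; have /andP[u0 uT] := u0T; have [tu|ut] := leP t u.
  by apply: (sub_sigmaI (sF u0T)); [exact: FS FA|exact: Ftle].
rewrite (_ : _ `&` _ = set0); first exact: (sub_sigma0 (sF u0T)).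
apply/seteqP; split=> w //= -[/At /= tw wu].
by move: (lt_le_trans tw wu); rewrite ltNge ltW.
Qed.

Lemma sigma_at_last A : F T A -> A `<=` [set w | tau w = T] -> Ftau A.
Proof.
move=> FA At; split; first exact: (sub_sigmaW (sF T0T)).
move=> t t0T; have /andP[t0 tT] := t0T; have [Tt|tT'] := leP T t.
  have -> : t = T by apply/eqP; rewrite eq_le tT.
  by apply: (sub_sigmaI (sF T0T)) => //; exact: Ftle.
rewrite (_ : _ `&` _ = set0); first exact: (sub_sigma0 (sF t0T)).
by apply/seteqP; split=> w //= -[/At /= ->]; rewrite leNgt tT'.
Qed.

Lemma stopping_time_gt t : 0 <= t <= T -> F t [set w | t < tau w].
Proof.
move=> t0T; rewrite (_ : [set w | _] = ~` [set w | tau w <= t]).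
  by apply: (sub_sigmaC (sF t0T)); exact: Ftle.
by apply/seteqP; split=> w /=; rewrite ltNge => /negP.
Qed.

(** Rounding the capped stopping time up to a grid leaves countably many cases, each with a
    deterministic time at most t; right-continuity lets the mesh tend to 0. *)
Lemma meas_wrt_stopped (Y : R -> Omega -> R) t :
  (forall t, 0 <= t <= T -> meas_wrt (F t) (Y t)) ->
  (forall w t, 0 <= t < T -> (Y ^~ w) @ t^'+ --> Y t w) ->
  0 <= t <= T -> meas_wrt (F t) (fun w => Y (Num.min t (tau w)) w).
Proof.
move=> mY rY t0T; have /andP[t0 tT] := t0T; have sFt := sF t0T.
have tau0T w : 0 <= tau w <= T by case: stau.
pose sg w := Num.min t (tau w).
have sg0t w : 0 <= sg w <= t.
  by rewrite /sg le_min t0 ge_min lexx andbT; case/andP: (tau0T w).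
have Fsg a : F t [set w | sg w <= a].
  have [ta|at_] := leP t a.
    rewrite (_ : [set w | _] = setT); first exact: (sub_sigmaT sFt).
    by apply/seteqP; split=> w //= _; rewrite /sg ge_min ta.
  have [a0|a0] := leP 0 a; last first.
    rewrite (_ : [set w | _] = set0); first exact: (sub_sigma0 sFt).
    apply/seteqP; split=> w //= /le_lt_trans/(_ a0).
    by case/andP: (sg0t w) => s0 _; rewrite ltNge s0.
  rewrite (_ : [set w | _] = [set w | tau w <= a]).
    apply: (@FS a t) => //; first exact: ltW.
    by apply: Ftle; rewrite a0 (le_trans (ltW at_)).
  by apply/seteqP; split=> w /=; rewrite /sg ge_min leNgt at_.
apply: (@meas_wrt_cvg _ _ _ _ sFt (fun m w => Y (Num.min t (grid_up m (sg w))) w)).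
  move=> m; apply: (meas_wrt_glue sFt (E := fun k => [set w | grid_idx m (sg w) = k])
    (Xs := fun k w => Y (Num.min t (k%:R / m.+1%:R)) w)).
  - case=> [|k].
      rewrite (_ : [set w | _] = [set w | sg w <= 0%:R / m.+1%:R])//.
      apply/seteqP; split=> w /=; rewrite -grid_idx_le leqn0; first by move=> ->.
      by move=> /eqP.
    rewrite (_ : [set w | _] = [set w | sg w <= k.+1%:R / m.+1%:R] `\`
        [set w | sg w <= k%:R / m.+1%:R]); first exact: (sub_sigmaD sFt).
    apply/seteqP; split=> w /=; rewrite -!grid_idx_le.
      by move=> ->; split=> //; apply/negP; rewrite -ltnNge.
    by move=> [kw /negP]; rewrite -ltnNge => kw'; apply/eqP; rewrite eqn_leq kw.
  - by move=> w; exists (grid_idx m (sg w)).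
  - by move=> k w /= <-.
  - move=> k; have u0t : 0 <= Num.min t (k%:R / m.+1%:R) <= t.
      by rewrite le_min t0 divr_ge0//= ge_min lexx.
    have /andP[u0 ut] := u0t.
    by apply: meas_wrtS (mY _ _); [exact: FS|rewrite u0 (le_trans ut)].
move=> w; have /andP[s0 st] := sg0t w.
have cs := @cvg_grid_up _ (sg w) t (sg0t w).
have ge_s m : sg w <= Num.min t (grid_up m (sg w)) by rewrite le_min st grid_up_ge.
(* At T there is no right limit to use, but there the cap at t makes the sequence constant. *)
have [sT|Ts] := ltP (sg w) T.
  by apply: (cvg_right_seq (f := Y ^~ w)) cs => //; apply: rY; rewrite s0.
have sT : sg w = t by apply/eqP; rewrite eq_le st (le_trans tT).
apply: cvg_near_cst; near=> m; congr Y.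
by apply/eqP; rewrite eq_le ge_s [X in _ <= X]sT ge_min lexx.
Unshelve. all: by end_near.
Qed.

(** On the event that tau is at most u, capping additionally at u changes nothing and makes the
    variable known at time u. *)
Lemma meas_wrt_stopped_at (Y : R -> Omega -> R) t :
  (forall t, 0 <= t <= T -> meas_wrt (F t) (Y t)) ->
  (forall w t, 0 <= t < T -> (Y ^~ w) @ t^'+ --> Y t w) ->
  0 <= t <= T -> meas_wrt Ftau (fun w => Y (Num.min t (tau w)) w).
Proof.
move=> mY rY t0T B mB; split.
  apply: (sub_sigmaW (sF t0T)); exact: meas_wrt_stopped.
move=> u u0T; have /andP[u0 uT] := u0T; have /andP[t0 tT] := t0T.
rewrite (_ : _ `&` _ = (fun w => Y (Num.min (Num.min t u) (tau w)) w) @^-1` B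
    `&` [set w | tau w <= u]).
  apply: (sub_sigmaI (sF u0T)); last exact: Ftle.
  have v0T : 0 <= Num.min t u <= T by rewrite le_min t0 u0 ge_min tT.
  apply: (@FS (Num.min t u) u) => //; first by case/andP: v0T.
    by rewrite ge_min lexx orbT.
  exact: meas_wrt_stopped.
by apply/seteqP; split=> w /= [+ wu]; rewrite -minA [Num.min u _]min_r.
Qed.

End stopping.

Lemma sigma_at_le (tau tau' : Omega -> R) : stopping_time T F tau' ->
  (forall w, tau w <= tau' w) -> sigma_at T F tau `<=` sigma_at T F tau'.
Proof.
move=> [_ st'] le_tau A [mA FA]; split=> // t t0T.
rewrite (_ : _ `&` _ = (A `&` [set w | tau w <= t]) `&` [set w | tau' w <= t]).
  by apply: (sub_sigmaI (sF t0T)); [exact: FA|exact: st'].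
apply/seteqP; split=> w /=; last by case=> -[].
by move=> [Aw tw]; split=> //; split=> //; exact: le_trans (le_tau w) tw.
Qed.

(** Right-continuity of the filtration enters here, through strict inequalities at times decreasing
    to t. *)
Lemma stopping_time_of_lt (tau : Omega -> R) : (forall w, 0 <= tau w <= T) ->
  (forall t, 0 < t <= T -> F t [set w | tau w < t]) -> stopping_time T F tau.
Proof.
move=> tau0T Flt; split=> // t /andP[t0 tT].
have [->|tneT] := eqVneq t T.
  rewrite (_ : [set w | _] = setT); first exact: (sub_sigmaT (sF T0T)).
  by apply/seteqP; split=> w //= _; case/andP: (tau0T w).
have tT' : t < T by rewrite lt_neqAle tneT.
case: ucF => _ Frc _; apply: Frc => [|s /andP[ts sT]]; first by rewrite t0.
have s0T : 0 <= s <= T by rewrite (le_trans t0 (ltW ts)).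
rewrite (_ : [set w | _] = \bigcap_m [set w | tau w < t + (s - t) / m.+1%:R]).
  apply: (sub_sigma_bigcap (sF s0T)) => m.
  have q0 : 0 < (s - t) / m.+1%:R by rewrite divr_gt0// subr_gt0.
  have qs : t + (s - t) / m.+1%:R <= s.
    rewrite -lerBrDl ler_pdivrMr// ler_peMr ?ler1n// subr_ge0.
    exact: ltW.
  apply: (@FS (t + (s - t) / m.+1%:R)) => //; first by rewrite addr_ge0// ltW.
  by apply: Flt; rewrite (le_trans qs sT) ltr_wpDl.
apply/seteqP; split=> w /=.
  by move=> wt m _ /=; rewrite (le_lt_trans wt)// ltrDl divr_gt0// subr_gt0.
move=> wt; apply/ler_addgt0Pr => e e0.
have st0 : 0 < s - t by rewrite subr_gt0.
have [m _ /(_ m (leqnn m)) /= me] := near_infty_natSinv_lt (PosNum (divr_gt0 e0 st0)).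
apply: (le_trans (ltW (wt m I))); rewrite lerD2l mulrC -ler_pdivlMr//.
exact: ltW.
Qed.

End StoppingTimes.

(** * Stickiness and exit times along the paths *)

Section Paths.
Context {R : realType} {d : measure_display} {Omega : measurableType d}.
Variables (P : probability Omega R) (T : R) (F : R -> set (set Omega)).
Variables (n : nat) (S : R -> Omega -> 'rV[R]_n).
Hypotheses (T0 : 0 < T) (ucF : usual_conditions P T F).
Hypothesis rcS : forall w i t, 0 <= t < T ->
  (fun u => S u w ord0 i) @ t^'+ --> S t w ord0 i.
Hypothesis adS : forall t i, 0 <= t <= T -> meas_wrt (F t) (fun w => S t w ord0 i).

Let sF t : 0 <= t <= T -> sub_sigma (F t).
Proof. by case: ucF => -[+ _] _ _; exact. Qed.

Let FS s t : 0 <= s -> s <= t -> t <= T -> F s `<=` F t.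
Proof. by case: ucF => -[_ +] _ _; exact. Qed.

Let T0T : 0 <= T <= T. Proof. by rewrite lexx ltW. Qed.
Let sFT : sub_sigma (F T). Proof. exact: sF. Qed.

Lemma meas_wrt_stoppedS tau t i : stopping_time T F tau -> 0 <= t <= T ->
  meas_wrt (F t) (fun w => stopped S tau t w ord0 i).
Proof.
move=> st t0T.
exact: (@meas_wrt_stopped _ _ _ P _ _ ucF _ st (fun t w => S t w ord0 i) t
  (fun t => @adS t i) (fun w t => @rcS w i t)).
Qed.

Lemma meas_wrt_stoppedS_at tau t i : stopping_time T F tau -> 0 <= t <= T ->
  meas_wrt (sigma_at T F tau) (fun w => stopped S tau t w ord0 i).
Proof.
move=> st t0T.
exact: (@meas_wrt_stopped_at _ _ _ P _ _ ucF _ st (fun t w => S t w ord0 i) t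
  (fun t => @adS t i) (fun w t => @rcS w i t)).
Qed.

Lemma stopped_endE tau w : stopping_time T F tau -> stopped S tau T w = S (tau w) w.
Proof. by move=> [/(_ w)/andP[_ tT] _]; rewrite /stopped min_r. Qed.

Lemma meas_wrt_atS tau i : stopping_time T F tau ->
  meas_wrt (sigma_at T F tau) (fun w => S (tau w) w ord0 i).
Proof.
move=> st; have := meas_wrt_stoppedS_at i st T0T.
by under eq_fun do rewrite stopped_endE//.
Qed.

Lemma cvg_dist_stopped tau w t : 0 <= t < T ->
  (fun u => enorm (S u w - stopped S tau u w)) @ t^'+ -->
  enorm (S t w - stopped S tau t w).
Proof.
move=> t0T; apply: cvg_enorm => i; rewrite !mxE.
under eq_fun do rewrite !mxE.
apply: cvgB; first exact: rcS.
exact: (@cvg_right_min _ (fun u => S u w ord0 i) (tau w) t (@rcS w i t t0T)).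
Qed.

Lemma supdist_gridE tau w : supdist T S (stopped S tau) w =
  seq_sup (fun t w => enorm (S t w - stopped S tau t w)) (grid_time T) w.
Proof.
apply: (ereal_sup_grid (f := fun t => enorm (S t w - stopped S tau t w))).
  exact: ltW.
by move=> t t0T; exact: cvg_dist_stopped.
Qed.

Lemma meas_wrt_dist_stopped tau t : stopping_time T F tau -> 0 <= t <= T ->
  meas_wrt (F t) (fun w => enorm (S t w - stopped S tau t w)).
Proof.
move=> st t0T; apply: (meas_wrt_enorm (sF t0T)) => i.
under [X in meas_wrt _ X]eq_fun do rewrite !mxE.
by apply: (meas_wrtB (sF t0T)); [exact: adS|exact: meas_wrt_stoppedS].
Qed.

Lemma measurable_supdist_stopped tau : stopping_time T F tau ->
  measurable_fun [set: g_sigma_algebraType (F T)] (supdist T S (stopped S tau)).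
Proof.
move=> st; rewrite (_ : supdist _ _ _ =
  seq_sup (fun t w => enorm (S t w - stopped S tau t w)) (grid_time T)).
  apply: (@measurable_seq_sup _ _ (g_sigma_algebraType (F T))
    [set t | 0 <= t <= T]).
    move=> t /= t0T; apply/(meas_wrtP sFT).
    apply: (@meas_wrtS _ _ _ (F t)); last exact: meas_wrt_dist_stopped.
    by have /andP[? ?] := t0T; exact: FS.
  by move=> k /=; apply: grid_time_itv; exact: ltW.
by apply/funext => w; exact: supdist_gridE.
Qed.

Lemma supdist_stopped_lt tau (c : R) : stopping_time T F tau ->
  F T [set w | (supdist T S (stopped S tau) w < c%:E)%E].
Proof.
move=> st; rewrite -(gsigma_measurableE sFT).
have := measurable_supdist_stopped st measurableT (emeasurable_itv `]-oo, c%:E[).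
by rewrite setTI.
Qed.

Lemma supdist_after tau w : 0 <= tau w <= T ->
  ereal_sup [set (enorm (S u w - S (tau w) w))%:E | u in [set u | tau w <= u <= T]] =
  supdist T S (stopped S tau) w.
Proof.
move=> /andP[t0 tT]; congr ereal_sup; apply/seteqP; split=> _ [u /= /andP[u0 uT] <-].
  exists u; first by rewrite /= uT (le_trans t0).
  by rewrite /stopped min_r.
have [ut|tu] := leP u (tau w).
  exists (tau w); first by rewrite /= lexx.
  by rewrite /stopped min_l// !subrr.
by exists u => /=; [rewrite uT ltW|rewrite /stopped min_r// ltW].
Qed.

(** Provides a version of the sticking probability that is positive at every outcome, so that the
    densities may divide by it. *)
Lemma sticky_prob tau (kappa : R) : sticky P T F S -> stopping_time T F tau ->
  0 < kappa -> exists p : Omega -> R,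
  [/\ meas_wrt (sigma_at T F tau) p, forall w, 0 < p w <= 1
    & forall A, sigma_at T F tau A -> (\int[P]_(w in A) (p w)%:E =
        P (A `&` [set w | supdist T S (stopped S tau) w < kappa%:E]))%E].
Proof.
move=> stS st k0; have sG := sigma_at_sub_sigma ucF st.
have [Y [cY Y0]] := stS tau (fun=> kappa) st (meas_wrt_cst sG kappa) (fun=> k0).
set Rt := [set w | (supdist T S (stopped S tau) w < kappa%:E)%E].
have RtE : [set w | Order.lt (ereal_sup [set (enorm (S u w - S (tau w) w))%:E
    | u in [set u | tau w <= u <= T]]) kappa%:E] = Rt.
  by apply/seteqP; split=> w /=; rewrite supdist_after//; case: st.
rewrite RtE in cY.
have mRt : measurable Rt by apply: (sub_sigmaW sFT); exact: supdist_stopped_lt.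
have nY : Pnull P [set w | ~ (0 <= Y w <= 1)].
  apply: (cond_exp_range_Pnull sG _ _ cY) => [|w]; first exact: measurable_indic.
  by rewrite indicE; case: (_ \in _) => /=; rewrite lexx ler01.
(* On the exceptional null set any value in the half-open unit interval would do. *)
pose p w := if 0 < Y w <= 1 then Y w else 1.
have [mp _ pE] : cond_exp P (sigma_at T F tau) (\1_Rt) p.
  apply: (cond_exp_Pnull sG (@sigma_at_Pnull _ _ _ P _ _ T0 ucF tau) cY).
  apply: Pnull_sub (PnullU nY Y0) => w /= Yp.
  have [Yw|/negP nYw] := boolP (0 < Y w <= 1); first by exfalso; apply: Yp; rewrite /p Yw.
  have [Y0w|nY0w] := boolP (0 < Y w); last by right; exact/negP.
  by left => /andP[_ Y1]; apply: nYw; rewrite Y0w.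
exists p; split=> //.
  by move=> w; rewrite /p; case: ifPn => // _; rewrite ltr01 lexx.
move=> A GA; rewrite pE// integral_indic//; first by rewrite setIC.
exact: (sub_sigmaW sG).
Qed.

Lemma supdist_stopped_fin tau w : cadlag T S -> 0 <= tau w <= T ->
  supdist T S (stopped S tau) w \is a fin_num.
Proof.
move=> cS /andP[t0 tT].
have /choice[M MP] : forall i : 'I_n, exists M, forall t, 0 <= t <= T -> `|S t w ord0 i| <= M.
  move=> i; have [c1 c2] := cS w i.
  exact: (cadlag_fun_bounded (f := fun t => S t w ord0 i) (ltW T0)).
have bnd t : 0 <= t <= T -> enorm (S t w - stopped S tau t w) <= \sum_(i < n) (M i + M i).
  move=> t0T; apply: (le_trans (enorm_le_sum _)); apply: ler_sum => i _.
  rewrite !mxE (le_trans (ler_normB _ _))// lerD ?MP//.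
  have /andP[? ?] := t0T; by rewrite le_min t0 ge_min andbC; apply/and3P; split=> //; apply/orP; left.
rewrite fin_real//; apply/andP; split.
  apply: (@lt_le_trans _ _ (enorm (S T w - stopped S tau T w))%:E); first exact: ltNyr.
  by apply: ereal_sup_ubound; exists T => //=; rewrite lexx ltW.
apply: (@le_lt_trans _ _ (\sum_(i < n) (M i + M i))%:E); last exact: ltry.
by apply: ub_ereal_sup => _ [t /= t0T <-]; rewrite lee_fin bnd.
Qed.

Section hitting.
Variable kappa : R.
Hypothesis k0 : 0 < kappa.

(** T is adjoined so that the infimum exists and equals T if the ball is never left. The strict
    inequality describes an exceedance that persists to the right. *)
Definition exit_set (tau : Omega -> R) w :=
  [set t | tau w <= t <= T /\ kappa < enorm (S t w - S (tau w) w)] `|` [set T].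

Definition exit_time tau w := inf (exit_set tau w).

Variable tau : Omega -> R.
Hypothesis st : stopping_time T F tau.
Let tau0T w : 0 <= tau w <= T. Proof. by case: st. Qed.

Let exit_lb w : lbound (exit_set tau w) (tau w).
Proof. by move=> t [[/andP[]]//|/= ->]; case/andP: (tau0T w). Qed.

Let exit_has w : has_inf (exit_set tau w).
Proof. by split; [exists T; right|exists (tau w)]. Qed.

Lemma exit_time_ge w : tau w <= exit_time tau w.
Proof. by apply: lb_le_inf => //; exists T; right. Qed.

Lemma exit_time_leT w : exit_time tau w <= T.
Proof. by apply: inf_lbound; [case: (exit_has w)|right]. Qed.

Let exit0T w : 0 <= exit_time tau w <= T.
Proof.
rewrite exit_time_leT andbT (le_trans _ (exit_time_ge w))//.
by case/andP: (tau0T w).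
Qed.

Lemma dist_before_exit w t : tau w <= t < exit_time tau w ->
  enorm (S t w - S (tau w) w) <= kappa.
Proof.
move=> /andP[wt te]; rewrite leNgt; apply/negP => kt.
have : exit_time tau w <= t.
  apply: inf_lbound; first by case: (exit_has w).
  by left; split=> //; rewrite wt (le_trans (ltW te))// exit_time_leT.
by rewrite leNgt te.
Qed.

Let exit_lt w t : exit_time tau w < t -> t <= T ->
  exists2 u, tau w <= u < t & kappa < enorm (S u w - S (tau w) w).
Proof.
move=> et tT; have e0 : 0 < t - exit_time tau w by rewrite subr_gt0.
have [u] := inf_adherent e0 (exit_has w); rewrite -/(exit_time tau w) subrKC.
move=> [[/andP[wu uT] ku] ut|/= -> Tt]; first by exists u; rewrite ?wu.
by move: (lt_le_trans Tt tT); rewrite ltxx.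
Qed.

(** A distance below kappa at the exit time would remain so on an interval to the right, and the
    infimum would be larger. *)
Lemma dist_at_exit w : exit_time tau w < T ->
  kappa <= enorm (S (exit_time tau w) w - S (tau w) w).
Proof.
move=> eT; rewrite leNgt; apply/negP => ek.
have /andP[e0 _] := exit0T w.
have c : (fun u => enorm (S u w - S (tau w) w)) @ (exit_time tau w)^'+ -->
    enorm (S (exit_time tau w) w - S (tau w) w).
  apply: cvg_enorm => i; rewrite !mxE; under eq_fun do rewrite !mxE.
  by apply: cvgB; [apply: rcS; rewrite e0|exact: cvg_cst].
have ek0 : 0 < kappa - enorm (S (exit_time tau w) w - S (tau w) w) by rewrite subr_gt0.
have [del del0 Hdel] := right_cvg_ex c ek0.
have er : exit_time tau w < Num.min T (exit_time tau w + del).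
  by rewrite lt_min eT ltrDl.
have [|u /andP[wu] ur ku] := exit_lt er; first by rewrite ge_min lexx.
have eu : exit_time tau w <= u.
  apply: inf_lbound; first by case: (exit_has w).
  left; split=> //; rewrite wu ltW// (lt_le_trans ur)// ge_min lexx//.
move: eu; rewrite le_eqVlt => /predU1P[eu|eu].
  by move: ku; rewrite -eu ltNge ltW.
have := Hdel u; rewrite eu (lt_le_trans ur) ?ge_min ?lexx ?orbT// => /(_ isT).
by move=> /(le_lt_trans (ler_norm _)); rewrite ltrD2r ltNge ltW.
Qed.

(** By right-continuity an exceedance before t is also seen at a grid time before t, so countably
    many events suffice. *)
Lemma exit_time_stopping : stopping_time T F (exit_time tau).
Proof.
apply: (stopping_time_of_lt T0 ucF) => // t /andP[t0 tT].
have t0T : 0 <= t <= T by rewrite ltW.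
rewrite (_ : [set w | _] = \bigcup_i (if grid_time T i < t then
   [set w | kappa < enorm (S (grid_time T i) w - stopped S tau (grid_time T i) w)]
   else set0)).
  apply: (sub_sigma_bigcup (sF t0T)) => i; case: ifPn => [qt|_]; last exact: (sub_sigma0 (sF t0T)).
  have q0T := grid_time_itv i (ltW T0); have /andP[q0 qT] := q0T.
  apply: (FS q0 (ltW qt) tT).
  apply: (meas_wrt_lt (sF q0T)); first exact: (meas_wrt_cst (sF q0T)).
  exact: meas_wrt_dist_stopped.
apply/seteqP; split=> w /=.
  move=> /exit_lt/(_ tT)[u /andP[wu ut] ku].
  have u0T : 0 <= u < T.
    by rewrite (lt_le_trans ut tT) (le_trans _ wu)//; case/andP: (tau0T w).
  have /andP[u0 uT] := u0T.
  have ku' : 0 < enorm (S u w - stopped S tau u w) - kappa.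
    by rewrite /stopped min_r// subr_gt0.
  have [del del0 Hdel] := right_cvg_ex (@cvg_dist_stopped tau w u u0T) ku'.
  have ut0 : 0 < Num.min del (t - u) by rewrite lt_min del0 subr_gt0.
  have /cvgrPdist_lt/(_ _ ut0)[m _ /(_ m (leqnn m)) /=] :=
    @cvg_grid_up _ u T (introT andP (conj u0 (ltW uT))).
  have [i iE] := grid_time_up T m u; rewrite -iE => um.
  have uq : u <= grid_time T i by rewrite iE le_min (ltW uT) grid_up_ge.
  have {um} : grid_time T i - u < Num.min del (t - u).
    by move: um; rewrite distrC ger0_norm// subr_ge0.
  rewrite lt_min => /andP[q1 q2].
  exists i => //; rewrite ifT; last by rewrite -(ltrD2r (- u)).
  rewrite /=; move: uq; rewrite le_eqVlt => /predU1P[<-|uq].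
    by rewrite -subr_gt0.
  have := Hdel (grid_time T i); rewrite uq -ltrBlDl q1 => /(_ isT).
  by rewrite distrC => /(le_lt_trans (ler_norm _)); lra.
move=> [i _]; case: ifPn => // qt /= ku.
have /andP[q0 qT] := grid_time_itv i (ltW T0).
have wq : tau w <= grid_time T i.
  rewrite leNgt; apply/negP => qw; move: ku.
  by rewrite /stopped min_l ?ltW// subrr enorm0 ltNge ltW.
apply: le_lt_trans qt; apply: inf_lbound; first by case: (exit_has w).
left; split; first by rewrite wq.
by move: ku; rewrite /stopped min_r.
Qed.

End hitting.

Section continuous.
Hypothesis ctS : cont_paths T S.

Lemma cont_paths_left w i t : 0 < t <= T ->
  (fun u => S u w ord0 i) @ t^'- --> S t w ord0 i.
Proof.
move=> /andP[t0 tT]; have := @ctS w i.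
rewrite (_ : [set t | 0 <= t <= T] = [set` `[0, T]]); last first.
  by apply/seteqP; split=> u /=; rewrite in_itv.
move=> /(continuous_within_itvP _ T0)[cin _ cT].
have [->//|tneT] := eqVneq t T.
apply: cvg_at_left_filter; apply: cin.
by rewrite in_itv /= t0 lt_neqAle tneT.
Qed.

Variables (kappa : R) (tau : Omega -> R).
Hypotheses (k0 : 0 < kappa) (st : stopping_time T F tau).

Definition exit_seq j := iter j (exit_time kappa) tau.
Local Notation sg := exit_seq.

Lemma exit_seq_stopping j : stopping_time T F (sg j).
Proof. by elim: j => [//|j IH]; rewrite /sg iterS; exact: exit_time_stopping. Qed.

Let sg0T j w : 0 <= sg j w <= T.
Proof. by case: (exit_seq_stopping j). Qed.

Lemma exit_seq_le j w : sg j w <= sg j.+1 w.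
Proof. by rewrite /sg iterS; apply: exit_time_ge; exact: exit_seq_stopping. Qed.

Lemma exit_seq_before j w t : sg j w <= t < sg j.+1 w ->
  enorm (S t w - S (sg j w) w) <= kappa.
Proof.
by rewrite {2}/sg iterS; apply: dist_before_exit => //; exact: exit_seq_stopping.
Qed.

(** Left-continuity excludes an overshoot at the exit time; this bounds the increments of the
    discrete process. *)
Lemma exit_seq_dist j w : enorm (S (sg j.+1 w) w - S (sg j w) w) <= kappa.
Proof.
have := exit_seq_le j w; rewrite le_eqVlt => /predU1P[->|lt_sg].
  by rewrite subrr enorm0 ltW.
have /andP[s0 sT] := sg0T j.+1 w; have /andP[s0' sT'] := sg0T j w.
have c : (fun u => enorm (S u w - S (sg j w) w)) @ (sg j.+1 w)^'- -->
    enorm (S (sg j.+1 w) w - S (sg j w) w).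
  apply: cvg_enorm => i; rewrite !mxE; under eq_fun do rewrite !mxE.
  apply: cvgB; [apply: cont_paths_left|exact: cvg_cst].
  by rewrite sT (le_lt_trans s0' lt_sg).
rewrite leNgt; apply/negP => ks.
have ks0 : 0 < enorm (S (sg j.+1 w) w - S (sg j w) w) - kappa by rewrite subr_gt0.
have [del del0 Hdel] := left_cvg_ex c ks0.
pose u := Num.max (sg j w) (sg j.+1 w - del / 2).
have us : u < sg j.+1 w by rewrite /u gt_max lt_sg /= gtrBl divr_gt0.
have := Hdel u; rewrite us andbT lt_max orbC ltrD2l ltrN2 ltr_pdivrMr// ltr_pMr// ltr1n.
move=> /(_ isT); rewrite distrC => /(le_lt_trans (ler_norm _)).
rewrite ltrD2l ltrN2 => ku.
have : enorm (S u w - S (sg j w) w) <= kappa.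
  by apply: exit_seq_before; rewrite us le_max lexx.
by rewrite leNgt ku.
Qed.

Lemma exit_seq_at j w : sg j.+1 w < T ->
  kappa <= enorm (S (sg j.+1 w) w - S (sg j w) w).
Proof. by move=> lt_T; apply: dist_at_exit => //; exact: exit_seq_stopping. Qed.

(** Otherwise the exit times increase to a limit at which the path has a left limit, while
    consecutive positions stay at distance at least kappa. *)
Lemma exit_seq_end w : exists j, sg j w = T.
Proof.
apply: contrapT => nT.
have ltT j : sg j w < T.
  have /andP[_ sT] := sg0T j w; rewrite lt_neqAle sT andbT.
  by apply/eqP => sT'; apply: nT; exists j.
have nd : nondecreasing_seq (fun j => sg j w).
  by apply/nondecreasing_seqP => j; exact: exit_seq_le.
have ub : has_ubound (range (fun j => sg j w)).
  by exists T => _ [j _ <-]; exact: ltW.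
have cv := nondecreasing_cvgn nd ub; set L := sup _ in cv.
have sL j : sg j w <= L by apply: ub_le_sup => //; exists j.
have LT : L <= T by apply: ge_sup; [exists (sg 0 w); exists 0%N|move=> _ [j _ <-]; exact: ltW].
have cvS i : (fun j => S (sg j w) w ord0 i) @ \oo --> S L w ord0 i.
  have [L0|L0] := ltP 0 L.
    apply: (cvg_left_seq (f := fun u => S u w ord0 i)) cv => //.
    by apply: cont_paths_left; rewrite L0.
  (* If the limit is 0, all exit times are 0 and left-continuity is not called for. *)
  apply: cvg_near_cst; near=> j; congr (S _ w ord0 i).
  apply/eqP; rewrite eq_le sL (le_trans L0)//.
  by case/andP: (sg0T j w).
have : (fun j => enorm (S (sg j.+1 w) w - S (sg j w) w)) @ \oo --> (0 : R).
  rewrite -[X in _ --> X](@enorm0 R n); apply: cvg_enorm => i.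
  have -> : (0 : 'rV[R]_n) ord0 i = S L w ord0 i - S L w ord0 i by rewrite mxE subrr.
  under eq_fun do rewrite !mxE.
  apply: cvgB; last exact: cvS.
  by have := cvS i; rewrite -cvg_shiftS.
move=> /cvgrPdist_lt/(_ _ k0)[m _ /(_ m (leqnn m)) /=].
rewrite sub0r normrN ger0_norm ?enorm_ge0// ltNge => /negP; apply.
exact: exit_seq_at.
Unshelve. all: by end_near.
Qed.

Lemma exit_seq_retired j w : (supdist T S (stopped S (sg j)) w < kappa%:E)%E ->
  sg j.+1 w = T /\ enorm (S T w - S (sg j w) w) <= kappa.
Proof.
rewrite -supdist_after// => ltk.
have distk u : sg j w <= u <= T -> enorm (S u w - S (sg j w) w) < kappa.
  move=> u0T; rewrite -lte_fin; apply: le_lt_trans ltk.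
  by apply: ereal_sup_ubound; exists u.
have /andP[_ sT] := sg0T j w; have /andP[_ sT1] := sg0T j.+1 w.
split; last by apply/ltW/distk; rewrite sT lexx.
apply/eqP; rewrite eq_le sT1 leNgt; apply/negP => s1T.
have := distk (sg j.+1 w); rewrite exit_seq_le sT1 => /(_ isT).
by rewrite ltNge exit_seq_at.
Qed.

(** Once T is reached nothing is left to happen; as T is reached after finitely many exits, every
    path retires. *)
Lemma exit_seq_retired_end j w : sg j w = T ->
  (supdist T S (stopped S (sg j)) w < kappa%:E)%E.
Proof.
move=> sT; apply: (@le_lt_trans _ _ 0%:E); last by rewrite lte_fin.
apply: ub_ereal_sup => _ [t /= /andP[t0 tT] <-].
by rewrite /stopped sT min_l// subrr enorm0.
Qed.

End continuous.

End Paths.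

(** * Martingales and change of measure *)

Section Martingales.
Context {R : realType} {d : measure_display} {Omega : measurableType d}.
Variables (T : R) (F : R -> set (set Omega)) (n : nat).
Hypothesis filF : filtration T F.
Implicit Types (Q : probability Omega R) (X Y V : R -> Omega -> 'rV[R]_n).

Let sF t : 0 <= t <= T -> sub_sigma (F t). Proof. by case: filF => + _; exact. Qed.

Lemma martingaleP Q V :
  (forall t i, 0 <= t <= T -> meas_wrt (F t) (fun w => V t w ord0 i)) ->
  (forall t i, 0 <= t <= T -> Q.-integrable setT (fun w => (V t w ord0 i)%:E)) ->
  (forall s t i A, 0 <= s -> s <= t -> t <= T -> F s A ->
    (\int[Q]_(w in A) (V s w ord0 i)%:E = \int[Q]_(w in A) (V t w ord0 i)%:E)%E) ->
  martingale Q T F V.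
Proof.
move=> mV iV VE i; split; first by move=> t t0T; split; [exact: mV|exact: iV].
move=> s t s0 st tT; have s0T : 0 <= s <= T by rewrite s0 (le_trans st).
by split; [exact: mV|exact: iV|move=> A FA; exact: VE].
Qed.

Lemma martingaleD Q X Y : martingale Q T F X -> martingale Q T F Y ->
  martingale Q T F (fun t w => X t w + Y t w).
Proof.
move=> MX MY; apply: martingaleP => [t i t0T|t i t0T|s t i A s0 st tT FA].
- under [X in meas_wrt _ X]eq_fun do rewrite mxE.
  apply: (meas_wrtD (sF t0T)); first by case: (MX i) => + _ => /(_ t t0T)[].
  by case: (MY i) => + _ => /(_ t t0T)[].
- under [X in integrable _ _ X]eq_fun do rewrite mxE EFinD.
  apply: integrableD => //; first by case: (MX i) => + _ => /(_ t t0T)[].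
  by case: (MY i) => + _ => /(_ t t0T)[].
- have s0T : 0 <= s <= T by rewrite s0 (le_trans st).
  have t0T : 0 <= t <= T by rewrite tT (le_trans s0).
  have mA := sub_sigmaW (sF s0T) FA.
  have [iX XE] := MX i; have [iY YE] := MY i.
  have [_ _ XE'] := XE s t s0 st tT; have [_ _ YE'] := YE s t s0 st tT.
  have E u : 0 <= u <= T -> (\int[Q]_(w in A) ((X u w + Y u w) ord0 i)%:E =
     \int[Q]_(w in A) (X u w ord0 i)%:E + \int[Q]_(w in A) (Y u w ord0 i)%:E)%E.
    move=> u0T; under eq_integral do rewrite mxE EFinD.
    by rewrite integralD_EFin//; apply: integrable_sub => //; [case: (iX u u0T)|case: (iY u u0T)].
  by rewrite !E// XE'// YE'.
Qed.

Lemma martingale_modification Q V X :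
  (forall t, 0 <= t <= T -> Pnull Q `<=` F t) ->
  (forall t, 0 <= t <= T -> Pnull Q [set w | V t w <> X t w]) ->
  martingale Q T F V -> martingale Q T F X.
Proof.
move=> FN nVX MV.
have nVXi t i : 0 <= t <= T -> Pnull Q [set w | V t w ord0 i <> X t w ord0 i].
  by move=> t0T; apply: Pnull_sub (nVX t t0T) => w /= + e; rewrite e.
have cV t i : 0 <= t <= T -> cond_exp Q (F t) (fun w => V t w ord0 i) (fun w => X t w ord0 i).
  move=> t0T; have /andP[t0 tT] := t0T.
  apply: (cond_exp_Pnull (sF t0T) (FN t t0T) _ (nVXi t i t0T)).
  by case: (MV i) => _ /(_ t t t0 (lexx t) tT).
apply: martingaleP => [t i t0T|t i t0T|s t i A s0 st tT FA].
- by case: (cV t i t0T).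
- by case: (cV t i t0T).
- have s0T : 0 <= s <= T by rewrite s0 (le_trans st).
  have t0T : 0 <= t <= T by rewrite tT (le_trans s0).
  have FtA : F t A by case: filF => _ FS; exact: (FS s t).
  have [_ _ ->//] := cV s i s0T; have [_ _ ->//] := cV t i t0T.
  by case: (MV i) => _ /(_ s t s0 st tT)[_ _ ->].
Qed.

(* An uncountable supremum of a.s. bounds need not be measurable. The essential
   supremum is reached along countably many times, and moving V onto S on the
   null set where a given time exceeds it makes the supremum equal to it. *)
Lemma martingale_regularize Q (S : R -> Omega -> 'rV[R]_n) V (c : R) : 0 < T -> 0 <= c ->
  (forall t, 0 <= t <= T -> Pnull Q `<=` F t) ->
  (forall t i, 0 <= t <= T -> meas_wrt (F t) (fun w => S t w ord0 i)) ->
  martingale Q T F V ->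
  (forall t, 0 <= t <= T -> Pnull Q [set w | ~ (enorm (S t w - V t w) <= c)]) ->
  exists St : R -> Omega -> 'rV[R]_n,
  [/\ martingale Q T F St, measurable_fun setT (supdist T S St)
    & forall w, (0 <= supdist T S St w <= c%:E)%E].
Proof.
move=> T0 c0 FN adS MV nV.
pose I := [set t | 0 <= t <= T].
(* Enforces the bound at every outcome, as the essential supremum requires, while altering V on a
   null set for each t. *)
pose V1 t w := if enorm (S t w - V t w) <= c then V t w else S t w.
pose Y t w := enorm (S t w - V1 t w).
have Y0c t w : I t -> 0 <= Y t w <= c.
  move=> _; rewrite /Y /V1; case: ifPn => [->|_]; first by rewrite enorm_ge0.
  by rewrite subrr enorm0 lexx.
have mV t i : I t -> meas_wrt (F t) (fun w => V t w ord0 i).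
  by move=> t0T; case: (MV i) => + _ => /(_ t t0T)[].
have mSV (W : Omega -> 'rV[R]_n) t : I t -> (forall i, meas_wrt (F t) (fun w => W w ord0 i)) ->
    meas_wrt (F t) (fun w => enorm (S t w - W w)).
  move=> It mW; apply: (meas_wrt_enorm (sF It)) => i.
  under [X in meas_wrt _ X]eq_fun do rewrite !mxE.
  by apply: (meas_wrtB (sF It)) => //; exact: adS.
have mY t : I t -> measurable_fun setT (Y t).
  move=> It; apply: (meas_wrt_measurable (sF It)); apply: (mSV (V1 t)) => // i.
  rewrite (_ : (fun w => _) = fun w => if `[< enorm (S t w - V t w) <= c >]
    then V t w ord0 i else S t w ord0 i); last first.
    by apply/funext => w; rewrite /V1 asboolb; case: ifP.
  apply: (meas_wrt_if (sF It) (A := [set w | enorm (S t w - V t w) <= c])).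
  - apply: (meas_wrt_le (sF It)); last exact: (meas_wrt_cst (sF It)).
    by apply: mSV => // j; exact: mV.
  - exact: mV.
  - exact: adS.
have I0 : I 0 by rewrite /I /= lexx ltW.
have [s [Is sP]] := @countable_ess_sup _ _ _ Q I Y c mY Y0c 0 I0.
(* At the times [s k] the test always succeeds, so the supremum is still reached there; a larger
   value elsewhere is replaced by distance 0. *)
pose St t w := if ((Y t w)%:E <= seq_sup Y s w)%E then V1 t w else S t w.
have supE w : supdist T S St w = seq_sup Y s w.
  apply/eqP; rewrite eq_le; apply/andP; split.
    apply: ub_ereal_sup => _ [t It <-]; rewrite /St; case: ifPn => [//|_].
    by rewrite subrr enorm0 (seq_sup_ge0 (I := I) Y0c).
  apply: ub_ereal_sup => _ [k _ <-]; apply: ereal_sup_ubound; exists (s k).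
    exact: Is.
  by rewrite /St seq_sup_ge.
exists St; split.
- apply: (martingale_modification FN _ MV) => t t0T.
  apply: Pnull_sub (PnullU (nV t t0T) (sP t t0T)) => w /= VSt.
  have [Vc|Vc] := boolP (enorm (S t w - V t w) <= c); last by left; exact/negP.
  right; rewrite ltNge; apply/negP => Yle; apply: VSt.
  by rewrite /St Yle /V1 Vc.
- rewrite (_ : supdist T S St = seq_sup Y s); last by apply/funext => w; exact: supE.
  exact: (measurable_seq_sup mY).
- by move=> w; rewrite supE (seq_sup_ge0 Y0c)//= (seq_sup_le Y0c).
Qed.

End Martingales.

Section LocalMartingale.
Context {R : realType} {d : measure_display} {Omega : measurableType d}.
Variables (P : probability Omega R) (T : R) (F : R -> set (set Omega)) (n : nat).
Variable (S : R -> Omega -> 'rV[R]_n).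
Hypotheses (T0 : 0 < T) (ucF : usual_conditions P T F).
Hypothesis lmS : local_martingale P T F S.

Let sF t : 0 <= t <= T -> sub_sigma (F t).
Proof. by case: ucF => -[+ _] _ _; exact. Qed.

(** Off the null set where the localizing times never reach T, the value at t is the limit of
    stopped values, eventually constant; the null set belongs to [F t]. *)
Lemma local_martingale_adapted t i : 0 <= t <= T ->
  meas_wrt (F t) (fun w => S t w ord0 i).
Proof.
move=> t0T; have [tau [stau ndtau aeT Mtau]] := lmS.
have sFt := sF t0T; have FN := usual_Pnull ucF t0T.
pose N := ~` [set w | exists k, tau k w = T].
have nN : Pnull P N := aeT.
pose Y w := if `[< N w >] then 0 else S t w ord0 i.
suff mY : meas_wrt (F t) Y.
  apply: (meas_wrt_Pnull sFt FN mY); apply: Pnull_sub nN => w /=.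
  by rewrite /Y; case: asboolP.
apply: (@meas_wrt_cvg _ _ _ _ sFt (fun k w => if `[< N w >] then 0
    else stopped S (tau k) t w ord0 i)).
  move=> k; apply: (meas_wrt_if sFt); [exact: FN|exact: (meas_wrt_cst sFt)|].
  by case: (Mtau k i) => + _ => /(_ t t0T)[].
move=> w; rewrite /Y; case: asboolP => [_|/contrapT[k kT]]; first exact: cvg_cst.
apply: cvg_near_cst; exists k => // l /= kl; rewrite /stopped.
have -> : tau l w = T.
  apply/eqP; rewrite eq_le; case: (stau l) => /(_ w)/andP[_ ->] _ /=.
  have nd : nondecreasing_seq (tau ^~ w) by apply/nondecreasing_seqP => m; exact: ndtau.
  by rewrite -kT; exact: nd.
by rewrite min_l//; case/andP: t0T.
Qed.

Lemma stopping_time_ltT tau : stopping_time T F tau -> F T [set w | tau w < T].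
Proof.
move=> st; have T0T : 0 <= T <= T by rewrite lexx ltW.
rewrite (_ : [set w | _] = \bigcup_m [set w | tau w <= T - T / m.+1%:R]).
  apply: (sub_sigma_bigcup (sF T0T)) => m.
  have mT : T / m.+1%:R <= T.
    by rewrite ler_pdivrMr// ler_peMr ?ler1n// ltW.
  have m0 : 0 <= T / m.+1%:R by rewrite divr_ge0// ltW.
  move: (T / m.+1%:R) mT m0 => q qT q0.
  have q0T : 0 <= T - q <= T by lra.
  have /andP[Tq0 TqT] := q0T.
  case: ucF => -[_ FS] _ _; apply: (FS (T - q) T) => //.
  by case: st => _; exact.
apply/seteqP; split=> w /=; last first.
  by move=> [m _ /= wm]; rewrite (le_lt_trans wm)// ltrBlDr ltrDl divr_gt0.
move=> wT; have e0 : 0 < (T - tau w) / T by rewrite divr_gt0// subr_gt0.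
have [m _ /(_ m (leqnn m)) /= me] := near_infty_natSinv_lt (PosNum e0).
exists m => //=; rewrite lerBrDr -lerBrDl mulrC -ler_pdivlMr//; exact: ltW.
Qed.

Lemma local_martingale_large_time e : 0 < e -> exists tau,
  [/\ stopping_time T F tau, martingale P T F (stopped S tau)
    & (P [set w | (tau w < T)%R] < e%:E)%E].
Proof.
move=> e0; have [tau [stau ndtau aeT Mtau]] := lmS.
have T0T : 0 <= T <= T by rewrite lexx ltW.
pose C k := [set w | tau k w < T].
have mC k : measurable (C k) by apply: (sub_sigmaW (sF T0T)); exact: stopping_time_ltT.
have C0 : P (\bigcap_k C k) = 0%E.
  apply: Pnull_measurable; first exact: bigcap_measurable.
  by apply: Pnull_sub aeT => w Cw /= [k kT]; have := Cw k I; rewrite /C /= kT ltxx.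
have : (P \o C) @ \oo --> P (\bigcap_k C k).
  apply: nonincreasing_cvg_mu => //.
  - by rewrite -ge0_fin_numE// fin_num_measure.
  - exact: bigcap_measurable.
  - move=> k l kl; apply/subsetPset => w; rewrite /C /=.
    have nd : nondecreasing_seq (tau ^~ w) by apply/nondecreasing_seqP => m; exact: ndtau.
    exact: le_lt_trans (nd _ _ kl).
rewrite C0.
move=> /fine_cvgP[_] /cvgrPdist_lt/(_ _ e0)[k _ /(_ k (leqnn k)) /=].
rewrite sub0r normrN ger0_norm ?fine_ge0// => ke.
exists (tau k); split=> //.
have fk : P (C k) \is a fin_num by exact: fin_num_measure.
by rewrite -[X in (X < _)%E](fineK fk) lte_fin.
Qed.

End LocalMartingale.

(** * Passing to an equivalent measure that agrees up to a stopping time *)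

Section ChangeOfMeasure.
Context {R : realType} {d : measure_display} {Omega : measurableType d}.
Variables (P Q : probability Omega R) (T : R) (F : R -> set (set Omega)) (n : nat).
Variables (S : R -> Omega -> 'rV[R]_n) (tau : Omega -> R) (Z : Omega -> R).
Hypotheses (T0 : 0 < T) (ucF : usual_conditions P T F).
Hypotheses (st : stopping_time T F tau) (mZ : meas_wrt (F T) Z).
Hypotheses (Z_gt0 : forall w, 0 < Z w).
Hypothesis QE : forall A, (Q A = \int[P]_(w in A) (Z w)%:E)%E.
Hypothesis QP : forall A, sigma_at T F tau A -> Q A = P A.

Let sF t : 0 <= t <= T -> sub_sigma (F t).
Proof. by case: ucF => -[+ _] _ _; exact. Qed.
Let T0T : 0 <= T <= T. Proof. by rewrite lexx ltW. Qed.
Let sFT : sub_sigma (F T). Proof. exact: sF. Qed.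

Let iZ : P.-integrable setT (EFin \o Z).
Proof.
have mZ' : measurable_fun setT (EFin \o Z).
  exact/measurable_EFinP/(meas_wrt_measurable sFT).
apply/integrableP; split=> //.
rewrite (eq_integral (EFin \o Z)) /=; last first.
  by move=> w _; rewrite ger0_norm// ltW.
by rewrite -QE probability_setT ltry.
Qed.

Let i1 : P.-integrable setT (EFin \o cst 1 : Omega -> \bar R).
Proof. exact: finite_measure_integrable_cst. Qed.

Lemma ge0_integral_change (f : Omega -> \bar R) : measurable_fun setT f ->
  (forall w, (0 <= f w)%E) -> (\int[Q]_w f w = \int[P]_w (f w * (Z w)%:E))%E.
Proof.
move=> mf f0; rewrite -(ge0_integral_density iZ (fun w => ltW (Z_gt0 w)))//.
by apply: eq_measure_integral => A mA _; exact: QE.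
Qed.

Lemma change_equiv : equiv_meas Q P.
Proof.
move=> A mA; split=> [QA|PA].
  have : Pnull P (A `&` [set w | cst 0 w < Z w]).
    apply: (Pnull_of_integral_le mA iZ).
    - exact: finite_measure_integrable_cst.
    - by move=> w _; exact: ltW.
    - by rewrite -QE QA integral0.
  move=> nA; apply: Pnull_measurable => //; apply: Pnull_sub nA => w Aw.
  by split=> //=.
rewrite QE; apply: null_set_integral => //.
exact/measurable_EFinP/measurable_funTS/(meas_wrt_measurable sFT).
Qed.

Lemma change_Pnull : Pnull Q = Pnull P.
Proof.
by apply/seteqP; split=> A [N [mN N0 AN]]; exists N; split=> //; apply/(change_equiv mN).
Qed.

(** Every event of [F T] inside the event that tau equals T is known at tau, where Q and P agree;
    apply this to the parts with Z above and below 1. *)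
Let Z_eq1 : Pnull P [set w | tau w = T /\ Z w <> 1].
Proof.
have FT_eq : F T [set w | tau w = T].
  rewrite (_ : [set w | _] = ~` [set w | tau w < T]).
    by apply: (sub_sigmaC sFT); exact: (stopping_time_ltT T0 ucF).
  apply/seteqP; split=> w /=; first by move=> ->; rewrite ltxx.
  by move=> /negP; rewrite -leNgt => Tw; apply/eqP; rewrite eq_le Tw andbT; case: st => /(_ w)/andP[].
have int_eq A : F T A -> A `<=` [set w | tau w = T] ->
    (\int[P]_(w in A) (Z w)%:E = \int[P]_(w in A) (cst 1 w)%:E)%E.
  move=> FA AT; have mA := sub_sigmaW sFT FA.
  rewrite -QE QP; last exact: (sigma_at_last T0 ucF st).
  by rewrite (integral_cst P mA 1%:E) mul1e.
pose A1 := [set w | tau w = T] `&` [set w | 1 < Z w].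
pose A2 := [set w | tau w = T] `&` [set w | Z w < 1].
have F1 : F T A1.
  apply: (sub_sigmaI sFT) => //; apply: (meas_wrt_lt sFT) => //.
  exact: (meas_wrt_cst sFT).
have F2 : F T A2.
  apply: (sub_sigmaI sFT) => //; apply: (meas_wrt_lt sFT) => //.
  exact: (meas_wrt_cst sFT).
apply: (@Pnull_sub _ _ _ _ _ (A1 `|` A2)).
  move=> w [/= wT /eqP]; rewrite neq_lt => /orP[lt1|gt1]; first by right.
  by left.
apply: PnullU.
- apply: Pnull_sub (Pnull_of_integral_le (sub_sigmaW sFT F1) iZ i1 _ _) => [w []//|w [_ /ltW]//|].
  by rewrite int_eq//; exact: subIsetl.
- apply: Pnull_sub (Pnull_of_integral_le (sub_sigmaW sFT F2) i1 iZ _ _) => [w []//|w [_ /ltW]//|].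
  by rewrite int_eq//; exact: subIsetl.
Qed.

Lemma change_tv_dist :
  (tv_dist Q P <= (fine (P [set w | (tau w < T)%R]) *+ 2)%:E)%E.
Proof.
apply: tv_dist_le.
  by apply: (sub_sigmaW sFT); exact: (stopping_time_ltT T0 ucF).
move=> A mA AC; rewrite QE -[RHS]mul1e -(integral_cst P mA 1%:E).
apply: ae_eq_integral => //.
- exact/measurable_EFinP/measurable_funTS/(meas_wrt_measurable sFT).
- apply: Pnull_sub Z_eq1 => w /= Zw; split; last by move=> Z1; apply: Zw => _; rewrite Z1.
  have Aw : A w by apply: contrapT => nA; apply: Zw => /nA.
  have := AC w Aw => /= /negP; rewrite -leNgt => Tw.
  by apply/eqP; rewrite eq_le Tw andbT; case: st => /(_ w)/andP[].
Qed.

(** Independence under P makes Q of the intersection equal to P A times Q C; taking C to be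
    everything shows that Q and P coincide on G. *)
Lemma change_indep (G : set (set Omega)) : sub_sigma G ->
  indep_sigma P G (F T) -> indep_sigma Q G (F T).
Proof.
move=> sG ind A C GA FC.
have QAC B : F T B -> (Q (A `&` B) = P A * Q B)%E.
  by move=> FB; rewrite !QE setIC (integral_indep sFT sG ind).
rewrite QAC//; congr (_ * _)%E.
by rewrite -[in RHS](setIT A) QAC ?probability_setT ?mule1//; exact: (sub_sigmaT sFT).
Qed.

Hypothesis rcS : forall w i t, 0 <= t < T ->
  (fun u => S u w ord0 i) @ t^'+ --> S t w ord0 i.
Hypothesis adS : forall t i, 0 <= t <= T -> meas_wrt (F t) (fun w => S t w ord0 i).

(** Split at time s: the part of A before tau is known at tau, where Q and P agree, and on the rest
    the stopped process no longer moves. *)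
Lemma change_martingale : martingale P T F (stopped S tau) ->
  martingale Q T F (stopped S tau).
Proof.
move=> MS; have sG := sigma_at_sub_sigma ucF st.
have mG t i : 0 <= t <= T -> meas_wrt (sigma_at T F tau) (fun w => stopped S tau t w ord0 i).
  by move=> t0T; exact: (meas_wrt_stoppedS_at ucF rcS adS).
have agree (f : Omega -> R) A : meas_wrt (sigma_at T F tau) f -> sigma_at T F tau A ->
    (\int[Q]_(w in A) (f w)%:E = \int[P]_(w in A) (f w)%:E)%E.
  exact: (eq_integral_agree sG).
apply: martingaleP => [t i t0T|t i t0T|s t i A s0 st' tT FA].
- by case: (MS i) => + _ => /(_ t t0T)[].
- case: (MS i) => + _ => /(_ t t0T)[mS /integrableP[_ iS]].
  apply/integrableP; split.
    exact/measurable_EFinP/(meas_wrt_measurable (sF t0T)).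
  move: iS; rewrite (_ : (\int[P]_x _ = \int[Q]_w (`|stopped S tau t w ord0 i|)%:E)%E)//.
  apply/esym; apply: agree; last exact: (sub_sigmaT sG).
  by apply: (meas_wrt_comp sG (h := fun x => `|x|)) => //; exact: mG.
- have s0T : 0 <= s <= T by rewrite s0 (le_trans st').
  have t0T : 0 <= t <= T by rewrite tT (le_trans s0).
  pose A1 := A `&` [set w | s < tau w]; pose A2 := A `&` [set w | tau w <= s].
  have F1 : F s A1 by apply: (sub_sigmaI (sF s0T)) => //; exact: (stopping_time_gt ucF st).
  have F2 : F s A2 by apply: (sub_sigmaI (sF s0T)) => //; case: st => _; exact.
  have GA1 : sigma_at T F tau A1 by apply: (sigma_at_before ucF st s0T F1); exact: subIsetr.
  have mA1 := sub_sigmaW (sF s0T) F1; have mA2 := sub_sigmaW (sF s0T) F2.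
  have AE : A = A1 `|` A2.
    rewrite /A1 /A2 -setIUr (_ : _ `|` _ = setT) ?setIT//.
    by apply/seteqP; split=> w //= _; apply/orP; rewrite ltNge orNb.
  have spl u : 0 <= u <= T -> (\int[Q]_(w in A) (stopped S tau u w ord0 i)%:E =
      \int[Q]_(w in A1) (stopped S tau u w ord0 i)%:E +
      \int[Q]_(w in A2) (stopped S tau u w ord0 i)%:E)%E.
    move=> u0T; rewrite [in LHS]AE integral_setU//.
      exact/measurable_EFinP/measurable_funTS/(meas_wrt_measurable sG)/mG.
    by apply/disj_setPS => w [[_ /= sw] [_ /= ws]]; move: (lt_le_trans sw ws); rewrite ltxx.
  rewrite !spl//; congr (_ + _)%E.
    have [_ _ E] := (MS i).2 s t s0 st' tT.
    by rewrite (agree _ _ (mG s i s0T) GA1) (agree _ _ (mG t i t0T) GA1) E.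
  apply: eq_integral => w /[!inE] -[_ /= ws].
  by rewrite /stopped !min_r// (le_trans ws).
Qed.

End ChangeOfMeasure.

Section BrownianFiltration.
Context {R : realType} {d : measure_display} {Omega : measurableType d}.
Variables (P : probability Omega R) (T : R) (F : R -> set (set Omega)) (n : nat).
Variable B : R -> Omega -> 'rV[R]_n.
Hypotheses (T0 : 0 < T) (ucF : usual_conditions P T F) (bB : brownian P T B).

(** The adjoined null sets are measurable because the usual conditions place them in F. *)
Lemma aug_nat_filtration_filtration : filtration T (aug_nat_filtration P B).
Proof.
have nat_meas t : nat_sigma B t `<=` measurable.
  apply: smallest_sub; first exact: sigma_algebra_measurable.
  move=> _ [s [i [C [_ mC ->]]]]; case: bB => /(_ s i) mB _ _ _.
  by rewrite -[X in measurable X]setTI; exact: mB.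
have natS s t : s <= t -> nat_sigma B s `<=` nat_sigma B t.
  move=> st; apply: sub_sigma_algebra2 => _ [u [i [C [/andP[u0 us] mC ->]]]].
  by exists u, i, C; split=> //; rewrite u0 (le_trans us).
split.
  move=> t t0T; split; first exact: smallest_sigma_algebra.
  apply: smallest_sub; first exact: sigma_algebra_measurable.
  move=> A [/nat_meas//|nA].
  have T0T : 0 <= T <= T by rewrite lexx ltW.
  apply: (sub_sigmaW (usual_sub_sigmaT T0 ucF)); exact: (usual_Pnull ucF T0T).
move=> s t s0 st tT; apply: sub_sigma_algebra2 => A [nA|nA]; last by right.
by left; exact: natS nA.
Qed.

End BrownianFiltration.

(** * The two constructions *)

Section ConvexLoss.
Context {R : realType}.
Variable g : R -> R.
Hypotheses (g_ge0 : forall x, 0 <= x -> 0 <= g x).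
Hypothesis g_convex : forall x y l, 0 <= x -> 0 <= y -> 0 <= l <= 1 ->
  g (l * x + (1 - l) * y) <= l * g x + (1 - l) * g y.
Hypothesis g0 : g 0 = 0.

Let g_scale x l : 0 <= x -> 0 <= l <= 1 -> g (l * x) <= l * g x.
Proof.
by move=> x0 l01; have := g_convex x0 (lexx 0) l01; rewrite g0 !mulr0 !addr0.
Qed.

(** Convexity between 0 and y gives g x at most (x / y) g y, which is at most g y. *)
Lemma convex_loss_nd x y : 0 <= x -> x <= y -> g x <= g y.
Proof.
move=> x0 xy; have [y0|y0] := leP y 0.
  by have -> : x = y by lra.
have l01 : 0 <= x / y <= 1.
  by apply/andP; split; [rewrite divr_ge0// ltW|rewrite ler_pdivrMr// mul1r].
have := g_scale (ltW y0) l01; rewrite divfK ?gt_eqF// => /le_trans; apply.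
by rewrite ler_piMl ?g_ge0 ?(ltW y0)//; case/andP: l01.
Qed.

Lemma convex_loss_small c e : 0 < c -> 0 < e -> exists2 x, 0 < x < c & g x < e.
Proof.
move=> c0 e0; have g1 : 0 <= g 1 by exact: g_ge0.
have g1' : 0 < g 1 + 1 by lra.
(* Uses g x at most x g 1 for x at most 1; the summand 1 in the denominator covers g 1 = 0. *)
pose x := Num.min (Num.min 1 (c / 2)) (e / 2 / (g 1 + 1)).
have x0 : 0 < x by rewrite /x !lt_min ltr01 !divr_gt0.
have x1 : x <= 1 by rewrite /x !ge_min lexx.
have xc : x <= c / 2 by rewrite /x !ge_min lexx orbT.
have xe : x <= e / 2 / (g 1 + 1) by rewrite /x ge_min lexx orbT.
have xc' : x < c by apply: le_lt_trans xc _; lra.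
exists x; first by rewrite x0.
have x01 : 0 <= x <= 1 by rewrite ltW.
have := g_scale ler01 x01; rewrite mulr1 => /le_lt_trans; apply.
move: xe; rewrite ler_pdivlMr// => xe.
apply: (@le_lt_trans _ _ (x * (g 1 + 1))); last by lra.
by rewrite ler_wpM2l ?(ltW x0)//; lra.
Qed.

(** Nothing is known of g at negative arguments, hence the truncation at 0. *)
Lemma measurable_convex_loss : measurable_fun setT (fun x : R => g (Num.max x 0)).
Proof.
apply: nondecreasing_measurable => // x y xy; apply: convex_loss_nd.
  by rewrite le_max lexx orbT.
by rewrite ge_max !le_max xy lexx !orbT.
Qed.

Lemma gext_fin (D : \bar R) : D \is a fin_num -> (0 <= D)%E ->
  gext g D = (g (Num.max (fine D) 0))%:E.
Proof. by case: D => // r _ /=; rewrite lee_fin => r0; rewrite max_l. Qed.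

Lemma measurable_gext {d : measure_display} {Omega : measurableType d}
    (D : Omega -> \bar R) : measurable_fun setT D ->
  (forall w, D w \is a fin_num) -> (forall w, (0 <= D w)%E) ->
  measurable_fun setT (fun w => gext g (D w)).
Proof.
move=> mD Df D0; under eq_fun do rewrite gext_fin//.
apply/measurable_EFinP; apply: (measurableT_comp measurable_convex_loss).
exact: measurableT_comp.
Qed.

End ConvexLoss.

Section JumpCase.
Context {R : realType} {d : measure_display} {Omega : measurableType d}.
Variables (P : probability Omega R) (T : R) (F : R -> set (set Omega)) (n : nat).
Variables (S : R -> Omega -> 'rV[R]_n) (g : R -> R) (chi : R) (tau : Omega -> R).
Hypotheses (T0 : 0 < T) (ucF : usual_conditions P T F).
Hypotheses (g_ge0 : forall x, 0 <= x -> 0 <= g x).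
Hypothesis g_convex : forall x y l, 0 <= x -> 0 <= y -> 0 <= l <= 1 ->
  g (l * x + (1 - l) * y) <= l * g x + (1 - l) * g y.
Hypotheses (g0 : g 0 = 0) (chi0 : 0 < chi).
Hypothesis cS : cadlag T S.
Hypothesis adS : forall t i, 0 <= t <= T -> meas_wrt (F t) (fun w => S t w ord0 i).
Hypotheses (stS : sticky P T F S) (st : stopping_time T F tau).

Let sFT : sub_sigma (F T). Proof. exact: (usual_sub_sigmaT T0 ucF). Qed.

Let rcS w i t : 0 <= t < T -> (fun u => S u w ord0 i) @ t^'+ --> S t w ord0 i.
Proof. by case: (cS w i) => + _; exact. Qed.

Local Notation D := (supdist T S (stopped S tau)).

Let Dfin w : D w \is a fin_num.
Proof. by apply: supdist_stopped_fin => //; case: st. Qed.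

Let D0 w : (0 <= D w)%E.
Proof.
apply: (@le_trans _ _ (enorm (S 0 w - stopped S tau 0 w))%:E).
  by rewrite lee_fin enorm_ge0.
by apply: ereal_sup_ubound; exists 0 => //=; rewrite lexx ltW.
Qed.

Let mDF : measurable_fun [set: g_sigma_algebraType (F T)] D.
Proof. exact: (measurable_supdist_stopped T0 ucF rcS adS). Qed.

Lemma measurable_supdist_stoppedT : measurable_fun setT D.
Proof.
move=> _ B mB; rewrite setTI; apply: (sub_sigmaW sFT).
by have := mDF measurableT mB; rewrite setTI (gsigma_measurableE sFT).
Qed.

Lemma measurable_gext_supdist_stopped : measurable_fun setT (fun w => gext g (D w)).
Proof. exact: (measurable_gext g_ge0 g_convex g0 measurable_supdist_stoppedT). Qed.

(* With v the conditional mean of h off the sticky event, the density is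
   (1 - v) / p on that event and h off it; h compensates the growth of g. *)
Lemma jump_case : exists (Q : probability Omega R) (Z : Omega -> R),
  [/\ meas_wrt (F T) Z, forall w, 0 < Z w,
      forall A, (Q A = \int[P]_(w in A) (Z w)%:E)%E,
      forall A, sigma_at T F tau A -> Q A = P A
    & (\int[Q]_w gext g (D w) < chi%:E)%E].
Proof.
have sG := sigma_at_sub_sigma ucF st.
have chi4 : 0 < chi / 4 by rewrite divr_gt0.
have [kappa /andP[k0 _] gk] := convex_loss_small g_ge0 g_convex g0 ltr01 chi4.
have [p [mp p01 pE]] := sticky_prob T0 ucF rcS adS stS st k0.
set Rt := [set w | (D w < kappa%:E)%E] in pE.
have FRt : F T Rt by exact: (supdist_stopped_lt T0 ucF rcS adS).
have mRt := sub_sigmaW sFT FRt.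
(* The bound 1/2 keeps 1 - v positive; chi / 4 is the share of the loss allowed off the sticky
   event. *)
pose e := Num.min 2^-1 (chi / 4).
have e0 : 0 < e by rewrite /e lt_min invr_gt0 ltr0n divr_gt0.
have e2 : e <= 2^-1 by rewrite /e ge_min lexx.
have ec : e <= chi / 4 by rewrite /e ge_min lexx orbT.
pose gU w := g (Num.max (fine (D w)) 0).
have gU0 w : 0 <= gU w by apply: g_ge0; rewrite le_max lexx orbT.
have mgU : meas_wrt (F T) gU.
  apply/(meas_wrtP sFT); apply: (measurableT_comp (measurable_convex_loss g_ge0 g_convex g0)).
  exact: measurableT_comp.
pose h w := e / (1 + gU w).
have gU1 w : 0 < 1 + gU w by rewrite ltr_pwDl.
have h0 w : 0 < h w by rewrite /h divr_gt0.
have he w : h w <= e by rewrite /h ler_pdivrMr// ler_peMr ?(ltW e0)// lerDl.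
have mh : meas_wrt (F T) h.
  apply: (meas_wrtM sFT); first exact: (meas_wrt_cst sFT).
  apply: (meas_wrtV sFT) => [w|]; first by rewrite gt_eqF.
  by apply: (meas_wrtD sFT) => //; exact: (meas_wrt_cst sFT).
pose hR w := h w * \1_(~` Rt) w.
have mhRF : meas_wrt (F T) hR.
  by apply: (meas_wrtM sFT) => //; apply: (meas_wrt_indic sFT); exact: (sub_sigmaC sFT).
have mhR := meas_wrt_measurable sFT mhRF.
have hR0e w : 0 <= hR w <= e.
  rewrite /hR indicE; case: (_ \in _) => /=; rewrite ?mulr1 ?mulr0 ?lexx ?(ltW e0)//.
  by rewrite (ltW (h0 w)) he.
have [v [mv iv vE] v0e] := cond_exp_exists_range sG
  (@sigma_at_Pnull _ _ _ P _ _ T0 ucF tau) mhR (ltW e0) hR0e.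
pose a w := (1 - v w) / p w.
have a0 w : 0 < a w.
  have /andP[p0 _] := p01 w; have /andP[_ ve] := v0e w.
  by rewrite /a divr_gt0//; lra.
have maG : meas_wrt (sigma_at T F tau) a.
  apply: (meas_wrtM sG); first by apply: (meas_wrtB sG) => //; exact: (meas_wrt_cst sG).
  by apply: (meas_wrtV sG) => // w; rewrite gt_eqF//; case/andP: (p01 w).
have ma : meas_wrt (F T) a by apply: meas_wrtS maG; exact: (sigma_at_subT T0 st).
pose Z w := a w * \1_Rt w + hR w.
have ZE w : Z w = if w \in Rt then a w else h w.
  rewrite /Z /hR !indicE in_setC; case: ifPn => _ /=.
    by rewrite mulr1 mulr0 addr0.
  by rewrite mulr0 mulr1 add0r.
have Z0 w : 0 < Z w by rewrite ZE; case: ifPn.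
have maR : meas_wrt (F T) (fun w => a w * \1_Rt w).
  by apply: (meas_wrtM sFT) => //; exact: (meas_wrt_indic sFT).
have mZ : meas_wrt (F T) Z by exact: (meas_wrtD sFT).
have ip : P.-integrable setT (EFin \o p).
  apply: (@integrable_bounded _ _ _ _ _ 1); first exact: (meas_wrt_measurable sG).
  by move=> w; have /andP[p0 p1] := p01 w; rewrite ger0_norm// ltW.
have intZ A : sigma_at T F tau A -> (\int[P]_(w in A) (Z w)%:E = P A)%E.
  move=> GA; have mA := sub_sigmaW sG GA.
  under eq_integral do rewrite EFinD.
  rewrite ge0_integralD//; last 4 first.
  - by move=> w _; rewrite lee_fin mulr_ge0 ?(ltW (a0 w))// indicE.
  - exact/measurable_EFinP/measurable_funTS/(meas_wrt_measurable sFT).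
  - by move=> w _; rewrite lee_fin; case/andP: (hR0e w).
  - exact/measurable_EFinP/measurable_funTS.
  rewrite -vE// (@integral_pull_out _ _ _ _ sG P P _ p)//; last 3 first.
  - exact: integrable_indic1.
  - by move=> w; case/andP: (p01 w) => /ltW.
  - move=> B GB; rewrite integral_indic//; last exact: (sub_sigmaW sG).
    by rewrite pE// setIC.
  rewrite (eq_integral (fun w => (1 - v w)%:E)); last first.
    by move=> w _; rewrite /a divfK// gt_eqF//; case/andP: (p01 w).
  rewrite -integralD_EFin//; last 2 first.
  - apply: integrable_sub => //; apply: (@integrable_bounded _ _ _ _ _ 1).
      by apply: measurable_funB => //; exact: (meas_wrt_measurable sG).
    by move=> w; have /andP[v0 ve] := v0e w; rewrite ler_norml; lra.
  - exact: integrable_sub.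
  rewrite (eq_integral (cst 1%:E)); last by move=> w _; rewrite -EFinD subrK.
  by rewrite integral_cst// mul1e.
have iZ : P.-integrable setT (EFin \o Z).
  apply/integrableP; split; first exact/measurable_EFinP/(meas_wrt_measurable sFT).
  rewrite (eq_integral (EFin \o Z)) /=; last by move=> w _; rewrite ger0_norm// ltW.
  rewrite intZ; last exact: (sub_sigmaT sG).
  by rewrite probability_setT ltry.
have Z1 : (\int[P]_w (Z w)%:E = 1)%E.
  by rewrite intZ ?probability_setT//; exact: (sub_sigmaT sG).
have [Q QE] := density_probability iZ (fun w => ltW (Z0 w)) Z1.
exists Q, Z; split=> //; first by move=> A GA; rewrite QE intZ.
have mgE : measurable_fun setT (fun w => gext g (D w)).
  exact: measurable_gext_supdist_stopped.
have gE w : gext g (D w) = (gU w)%:E by rewrite gext_fin.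
rewrite (ge0_integral_change T0 ucF mZ Z0 QE)//; last first.
  by move=> w; rewrite gE lee_fin.
(* On the sticky event g is at most chi / 4, off it g times the density is at most e; the total is
   at most chi / 2. *)
apply: (@le_lt_trans _ _ (\int[P]_w ((chi / 4 * Z w)%:E + e%:E))%E).
  apply: ge0_le_integral => //.
  - by move=> w _; rewrite gE -EFinM lee_fin mulr_ge0// ltW.
  - apply: emeasurable_funM => //.
    exact/measurable_EFinP/(meas_wrt_measurable sFT).
  - apply: emeasurable_funD => //; apply/measurable_EFinP/measurable_funM => //.
    exact: (meas_wrt_measurable sFT).
  move=> w _; rewrite gE -EFinM -EFinD lee_fin ZE; case: ifPn => [|_].
    rewrite inE => Rw; apply: (@le_trans _ _ (chi / 4 * a w)); last by rewrite lerDl ltW.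
    rewrite ler_wpM2r ?(ltW (a0 w))// (le_trans _ (ltW gk))//.
    apply: (convex_loss_nd g_ge0 g_convex g0); first by rewrite le_max lexx orbT.
    by rewrite ge_max (ltW k0) andbT -lee_fin fineK// ltW.
  apply: (@le_trans _ _ e); last by rewrite lerDr mulr_ge0// ?(ltW (h0 w))// divr_ge0// ltW.
  rewrite /h mulrCA ler_piMr ?(ltW e0)// ler_pdivrMr// mul1r.
  by rewrite lerDr.
have ZE4 : (fun w => (chi / 4 * Z w)%:E) = fun w => ((chi / 4)%:E * (EFin \o Z) w)%E.
  by apply/funext => w; rewrite -EFinM.
have iZ4 : P.-integrable setT (fun w => (chi / 4 * Z w)%:E).
  by rewrite ZE4; exact: integrableZl.
have IZ4 : (\int[P]_w (chi / 4 * Z w)%:E = (chi / 4)%:E)%E.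
  by rewrite ZE4 integralZl// [X in (_ * X)%E]Z1 mule1.
rewrite integralD_EFin//; last exact: finite_measure_integrable_cst.
rewrite [X in (X + _)%E]IZ4 (integral_cst P measurableT e%:E).
rewrite [X in (_ + _ * X)%E](probability_setT P) mule1 -EFinD lte_fin; lra.
Qed.

End JumpCase.

Section ContinuousCase.
Context {R : realType} {d : measure_display} {Omega : measurableType d}.
Variables (P : probability Omega R) (T : R) (F : R -> set (set Omega)) (n : nat).
Variables (S : R -> Omega -> 'rV[R]_n) (kappa : R) (tau : Omega -> R).
Hypotheses (T0 : 0 < T) (ucF : usual_conditions P T F).
Hypothesis rcS : forall w i t, 0 <= t < T ->
  (fun u => S u w ord0 i) @ t^'+ --> S t w ord0 i.
Hypothesis adS : forall t i, 0 <= t <= T -> meas_wrt (F t) (fun w => S t w ord0 i).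
Hypotheses (stS : sticky P T F S) (st : stopping_time T F tau) (k0 : 0 < kappa).
Hypotheses (ctS : cont_paths T S) (MS : martingale P T F (stopped S tau)).

Let sF t : 0 <= t <= T -> sub_sigma (F t).
Proof. by case: ucF => -[+ _] _ _; exact. Qed.
Let FS s t : 0 <= s -> s <= t -> t <= T -> F s `<=` F t.
Proof. by case: ucF => -[_ +] _ _; exact. Qed.
Let T0T : 0 <= T <= T. Proof. by rewrite lexx ltW. Qed.
Let sFT : sub_sigma (F T). Proof. exact: sF. Qed.

Let sg j := exit_seq T S kappa tau j.
Let G j := sigma_at T F (sg j).
(** With the shift, the stay in the ball around S at [sg k] is recorded at index k + 1, when it is
    known. A path whose largest distance is exactly kappa reaches T without retiring, and retires at
    the next step. *)
Let E j := if j is k.+1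
  then [set w | (supdist T S (stopped S (sg k)) w < kappa%:E)%E] else set0.

Let ssg j : stopping_time T F (sg j).
Proof. exact: (exit_seq_stopping T0 ucF rcS adS k0 st). Qed.
Let sg0T j w : 0 <= sg j w <= T. Proof. by case: (ssg j). Qed.
Let sg_le j w : sg j w <= sg j.+1 w.
Proof. exact: (exit_seq_le T0 ucF rcS adS k0 st). Qed.
Let tau_le j w : tau w <= sg j w.
Proof. by elim: j => [//|j IH]; exact: le_trans IH (sg_le j w). Qed.
Let sG j : sub_sigma (G j). Proof. exact: (sigma_at_sub_sigma ucF (ssg j)). Qed.
Let GS j : G j `<=` G j.+1.
Proof. exact: (sigma_at_le ucF (ssg j.+1) (sg_le j)). Qed.
Let GGT j : G j `<=` F T. Proof. exact: (sigma_at_subT T0 (ssg j)). Qed.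
Let E0 : E 0 = set0. Proof. by []. Qed.
Let EsT j w : E j.+1 w -> sg j.+1 w = T /\ enorm (S T w - S (sg j w) w) <= kappa.
Proof. exact: (exit_seq_retired T0 ucF rcS adS k0 st). Qed.
Let ES j : E j `<=` E j.+1.
Proof.
move=> w; case: j => [[]|j Ew].
by have [sT _] := EsT Ew; exact: (exit_seq_retired_end k0 sT).
Qed.
(** Staying in the ball is only known at T, but on that event the next exit time is T. *)
Let GE j : G j (E j).
Proof.
case: j => [|j]; first exact: (sub_sigma0 (sG 0)).
apply: (sigma_at_last T0 ucF (ssg j.+1)); last by move=> w Ew; have [] := EsT Ew.
exact: (supdist_stopped_lt T0 ucF rcS adS kappa (ssg j)).
Qed.
Let covE w : exists j, E j w.
Proof.
have [j jT] := exit_seq_end T0 ucF rcS adS ctS k0 st w.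
by exists j.+1; exact: (exit_seq_retired_end k0 jT).
Qed.

Let not_retired j w t : sg j w <= t -> t < T -> ~ E j w.
Proof.
case: j => [_ _ []|j st' tT Ew]; have [sT _] := EsT Ew.
by move: (le_lt_trans st' tT); rewrite sT ltxx.
Qed.

Let x i j w := S (sg j.+1 w) w ord0 i - S (sg j w) w ord0 i.

Let sum_x i k w : \sum_(j < k) x i j w = S (sg k w) w ord0 i - S (tau w) w ord0 i.
Proof.
elim: k => [|k IH]; first by rewrite big_ord0 subrr.
by rewrite big_ord_recr /= IH /x addrC addrA subrK.
Qed.

Let coord_dist (v v' : 'rV[R]_n) i : enorm (v - v') <= kappa ->
  `|v ord0 i - v' ord0 i| <= kappa.
Proof. by apply: le_trans; have := coord_le_enorm (v - v') i; rewrite !mxE. Qed.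

Let xK i j w : `|x i j w| <= kappa.
Proof. by apply: coord_dist; exact: (exit_seq_dist T0 ucF rcS adS ctS k0 st). Qed.

Let mx i j : meas_wrt (G j.+1) (x i j).
Proof.
apply: (meas_wrtB (sG _)); first exact: (meas_wrt_atS T0 ucF rcS adS i (ssg j.+1)).
by apply: (meas_wrtS (@GS j)); exact: (meas_wrt_atS T0 ucF rcS adS i (ssg j)).
Qed.

Let Pnull_eq (Q : probability Omega R) (f h : Omega -> R) A : measurable A ->
  Q.-integrable setT (EFin \o f) -> Q.-integrable setT (EFin \o h) ->
  (\int[Q]_(w in A) (f w)%:E = \int[Q]_(w in A) (h w)%:E)%E ->
  (forall w, A w -> h w < f w) -> Pnull Q A.
Proof.
move=> mA if_ ih fh hf; have le_fh : (\int[Q]_(w in A) (f w)%:E <= \int[Q]_(w in A) (h w)%:E)%E.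
  by rewrite fh.
apply: Pnull_sub (Pnull_of_integral_le mA if_ ih (fun w Aw => ltW (hf w Aw)) le_fh) => w Aw.
by split=> //=; exact: hf.
Qed.

Section martingale_part.
Variables (Q : probability Omega R) (i : 'I_n).
Variables (zeta : Omega -> R) (s : nat -> Omega -> R).
Hypotheses (mzeta : meas_wrt (F T) zeta) (izeta : Q.-integrable setT (EFin \o zeta)).
Hypothesis is_ : forall k, Q.-integrable setT (EFin \o s k).
Hypothesis zetaE : forall k A, G k A ->
  (\int[Q]_(w in A) (zeta w)%:E = \int[Q]_(w in A) (s k w)%:E)%E.
Hypothesis sE : forall k w, ~ E k w -> s k w = \sum_(j < k) x i j w.
Hypothesis sK : forall k w, `|s k.+1 w - s k w| <= kappa.
Hypothesis zetas : forall k w, E k.+1 w -> ~ E k w -> zeta w = s k.+1 w.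

(** One kappa is the distance from the last centre to S at T, the other the last corrected
    increment. *)
Let dist_end w : `|S T w ord0 i - (S (tau w) w ord0 i + zeta w)| <= kappa *+ 2.
Proof.
have [Ek nEk] := retire_idxP E0 covE w; set k := retire_idx _ _ w in Ek nEk.
have [_ /(coord_dist i) Sk] := EsT Ek.
have := sK k w; rewrite (zetas Ek nEk) (sE nEk) sum_x.
move: Sk; rewrite !ler_norml mulr2n; lra.
Qed.

(** Between [sg k] and [sg k.+1] the mean of zeta is that of [s k.+1], within kappa of [s k], which
    is the increment of S from tau to [sg k]; and S at t is within kappa of S at [sg k]. Before tau
    the mean is 0, at T it is zeta. *)
Lemma dist_conditional_mean (M : Omega -> R) t : 0 <= t <= T ->
  cond_exp Q (F t) zeta M ->
  Pnull Q [set w | ~ (`|S t w ord0 i - (stopped S tau t w ord0 i + M w)| <= kappa *+ 2)].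
Proof.
move=> t0T [mM iM ME]; have /andP[t0 tT] := t0T; have sFt := sF t0T.
have [tTE|tneT] := eqVneq t T.
  have mzt : meas_wrt (F t) zeta by rewrite tTE.
  have F1 : F t [set w | zeta w < M w] by exact: (meas_wrt_lt sFt).
  have F2 : F t [set w | M w < zeta w] by exact: (meas_wrt_lt sFt).
  apply: Pnull_sub (PnullU (Pnull_eq (sub_sigmaW sFt F1) iM izeta (ME _ F1) (fun w h => h))
    (Pnull_eq (sub_sigmaW sFt F2) izeta iM (esym (ME _ F2)) (fun w h => h))) => w /= nd.
  case: (ltgtP (zeta w) (M w)) => [lt|gt|eq]; [by left|by right|].
  exfalso; apply: nd; rewrite -eq tTE (stopped_endE S w st); exact: dist_end.
have tT' : t < T by rewrite lt_neqAle tneT.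
(* Before [sg k] an event known at t is known at [sg k], so M and [s k] have equal integrals over it
   and cannot be strictly ordered there. This is applied to the countably many ways in which M can
   stray too far. *)
have null_lt (B : set Omega) k : F t B -> B `<=` [set w | t < sg k w] ->
    (forall w, B w -> s k w < M w) \/ (forall w, B w -> M w < s k w) -> Pnull Q B.
  move=> FB Bk hM; have mB := sub_sigmaW sFt FB.
  have GB : G k B by exact: (sigma_at_before ucF (ssg k) t0T FB).
  have eqB : (\int[Q]_(w in B) (M w)%:E = \int[Q]_(w in B) (s k w)%:E)%E.
    by rewrite ME// (zetaE GB).
  case: hM => hM; first exact: (Pnull_eq mB iM (is_ k) eqB hM).
  exact: (Pnull_eq mB (is_ k) iM (esym eqB) hM).
have s0E w : s 0 w = 0 by rewrite sE// big_ord0.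
have mc c : meas_wrt (F t) (fun=> c : R) by exact: (meas_wrt_cst sFt).
have Fgt k : F t [set w | t < sg k w] by exact: (stopping_time_gt ucF (ssg k)).
have Fle k : F t [set w | sg k w <= t] by case: (ssg k) => _; exact.
(* Equals [s k] once [sg k] has passed, but is known at time t by construction. *)
pose Y k w := stopped S (sg k) t w ord0 i - stopped S tau t w ord0 i.
have mY k : meas_wrt (F t) (Y k).
  by apply: (meas_wrtB sFt); exact: (meas_wrt_stoppedS ucF rcS adS).
have YE k w : sg k w <= t -> Y k w = s k w.
  move=> st'; rewrite (sE (not_retired st' tT')) sum_x /Y /stopped !min_r//.
  exact: le_trans (tau_le k w) st'.
pose B1 := [set w | t < tau w] `&` [set w | 0 < M w].
pose B2 := [set w | t < tau w] `&` [set w | M w < 0].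
pose C1 k := [set w | sg k w <= t] `&` [set w | t < sg k.+1 w] `&`
  [set w | Y k w + kappa < M w].
pose C2 k := [set w | sg k w <= t] `&` [set w | t < sg k.+1 w] `&`
  [set w | M w < Y k w - kappa].
have nB1 : Pnull Q B1.
  apply: (null_lt _ 0%N); [|exact: subIsetl|by left=> w [_]; rewrite s0E].
  by apply: (sub_sigmaI sFt); [exact: (Fgt 0%N)|exact: (meas_wrt_lt sFt)].
have nB2 : Pnull Q B2.
  apply: (null_lt _ 0%N); [|exact: subIsetl|by right=> w [_]; rewrite s0E].
  by apply: (sub_sigmaI sFt); [exact: (Fgt 0%N)|exact: (meas_wrt_lt sFt)].
have nC1 k : Pnull Q (C1 k).
  apply: (null_lt _ k.+1); [|by move=> w [[]]|left].
    apply: (sub_sigmaI sFt); first by apply: (sub_sigmaI sFt).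
    by apply: (meas_wrt_lt sFt) => //; exact: (meas_wrtD sFt).
  move=> w [[/= sgt _]]; rewrite (YE _ _ sgt).
  by have := sK k w; rewrite ler_norml; lra.
have nC2 k : Pnull Q (C2 k).
  apply: (null_lt _ k.+1); [|by move=> w [[]]|right].
    apply: (sub_sigmaI sFt); first by apply: (sub_sigmaI sFt).
    by apply: (meas_wrt_lt sFt) => //; exact: (meas_wrtB sFt).
  move=> w [[/= sgt _]]; rewrite (YE _ _ sgt).
  by have := sK k w; rewrite ler_norml; lra.
apply: Pnull_sub (PnullU (PnullU nB1 nB2)
  (PnullU (Pnull_bigcup nC1) (Pnull_bigcup nC2))) => w /= nd.
have ext : exists k, t < sg k w.
  by have [k kT] := exit_seq_end T0 ucF rcS adS ctS k0 st w; exists k; rewrite /sg kT.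
case: (ex_minnP ext) => -[|k] tk mink.
  left; case: (ltgtP 0 (M w)) => [M0|M0|M0]; [by left|by right|].
  exfalso; apply: nd; rewrite -M0 addr0 /stopped min_l ?(ltW tk)// subrr normr0.
  by rewrite mulrn_wge0// ltW.
have sgk : sg k w <= t by rewrite leNgt; apply/negP => /mink; rewrite ltnn.
right; have [lt1|ge1] := ltP (Y k w + kappa) (M w); first by left; exists k.
have [lt2|ge2] := ltP (M w) (Y k w - kappa); first by right; exists k.
exfalso; apply: nd.
have : enorm (S t w - S (sg k w) w) <= kappa.
  by apply: (exit_seq_before T0 ucF rcS adS k0 st); rewrite sgk.
move=> /(coord_dist i); move: ge1 ge2.
rewrite /Y /stopped min_r// (min_r (le_trans (tau_le k w) sgk)) !ler_norml mulr2n; lra.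
Qed.

End martingale_part.

(** The retirement density depends on the whole vector S only, so one Q serves all coordinates; each
    coordinate has its own terminal value. *)
Lemma continuous_case : exists (Q : probability Omega R) (Z : Omega -> R)
    (V : R -> Omega -> 'rV[R]_n),
  [/\ meas_wrt (F T) Z /\ (forall w, 0 < Z w),
      forall A, (Q A = \int[P]_(w in A) (Z w)%:E)%E,
      forall A, sigma_at T F tau A -> Q A = P A,
      martingale Q T F V
    & forall t i, 0 <= t <= T ->
        Pnull Q [set w | ~ (`|S t w ord0 i - V t w ord0 i| <= kappa *+ 2)]].
Proof.
have /choice[p pP] : forall j, exists p : Omega -> R,
    [/\ meas_wrt (G j) p, forall w, 0 < p w <= 1
    & forall A, G j A -> (\int[P]_(w in A) (p w)%:E = P (A `&` E j.+1))%E].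
  by move=> j; exact: (sticky_prob T0 ucF rcS adS stS (ssg j) k0).
have mp j : meas_wrt (G j) (p j) by case: (pP j).
have p01 j w : 0 < p j w <= 1 by case: (pP j) => _ + _; exact.
have pE j A : G j A -> (\int[P]_(w in A) (p j w)%:E = P (A `&` E j.+1))%E.
  by case: (pP j) => _ _; exact.
have [Q QE QP] := retire_probability sG sFT GS GGT E0 ES GE covE mp p01 pE.
have GN j : Pnull P `<=` G j by exact: (sigma_at_Pnull T0 ucF).
have /choice[zs zsP] := fun i => retire_martingale sG sFT GS GGT ES GE mp p01 pE
  QE GN (mx i) (xK i).
have /choice[ss ssP] := zsP.
have mZ := meas_wrt_retire_density sG sFT GGT E0 ES GE covE mp p01.
have Z0 := retire_density_gt0 E0 covE p01.
(* A version is picked for each time and coordinate separately, with value 0 outside the time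
   interval, so the bound obtained is almost sure at each fixed time. *)
have /choice[Mp MpP] : forall ti : R * 'I_n, exists Y : Omega -> R,
    0 <= ti.1 <= T -> cond_exp Q (F ti.1) (zs ti.2) Y.
  move=> [t i] /=; have [t0T|nt] := boolP (0 <= t <= T); last by exists (cst 0).
  have [_ iz _ _ _] := ssP i.
  by have [Y YP] := cond_exp_exists (sF t0T) iz; exists Y.
pose M t w : 'rV[R]_n := \row_i Mp (t, i) w.
have filF : filtration T F by case: ucF.
have MM : martingale Q T F M.
  apply: martingaleP.
  - move=> t i t0T; under [X in meas_wrt _ X]eq_fun do rewrite mxE.
    by have [] := MpP (t, i) t0T.
  - move=> t i t0T; under [X in integrable _ _ X]eq_fun do rewrite mxE.
    by have [] := MpP (t, i) t0T.
  - move=> u t i A u0 ut tT FA.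
    have u0T : 0 <= u <= T by rewrite u0 (le_trans ut).
    have t0T : 0 <= t <= T by rewrite tT (le_trans u0).
    have [_ _ E1] := MpP (u, i) u0T; have [_ _ E2] := MpP (t, i) t0T.
    under eq_integral do rewrite mxE; under [RHS]eq_integral do rewrite mxE.
    by rewrite E1// E2//; exact: FS FA.
have MSQ : martingale Q T F (stopped S tau).
  exact: (change_martingale ucF st QP rcS adS MS).
exists Q, (retire_density p E0 covE), (fun t w => stopped S tau t w + M t w).
split=> //; first exact: martingaleD.
move=> t i t0T; have [mz iz is_ zE [sE sK zs_]] := ssP i.
apply: Pnull_sub (dist_conditional_mean mz iz is_ zE sE sK zs_ t0T (MpP (t, i) t0T)) => w /=.
by rewrite !mxE.
Qed.

End ContinuousCase.

Theorem theorem5p1 (R : realType) (d : measure_display) (Omega : measurableType d)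
  (P : probability Omega R) (T : R) (F : R -> set (set Omega)) (n : nat)
  (g : R -> R) (chi : R) (B S : R -> Omega -> 'rV[R]_n) :
  0 < T ->
  usual_conditions P T F ->
  (forall x, 0 <= x -> 0 <= g x) ->
  (forall x y l, 0 <= x -> 0 <= y -> 0 <= l <= 1 ->
     g (l * x + (1 - l) * y) <= l * g x + (1 - l) * g y) ->
  g 0 = 0 ->
  0 < chi ->
  brownian P T B ->
  indep_sigma P (aug_nat_filtration P B T) (F T) ->
  cadlag T S ->
  local_martingale P T F S ->
  sticky P T F S ->
  (exists (Q : probability Omega R) (St : R -> Omega -> 'rV[R]_n),
     [/\ equiv_meas Q P,
         (tv_dist Q P < chi%:E)%E,
         martingale Q T (join_filtration F (aug_nat_filtration P B)) St,
         measurable_fun setT (fun w => gext g (supdist T S St w)) /\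
         (\int[Q]_w gext g (supdist T S St w) < chi%:E)%E
       & cont_paths T S -> {ae P, forall w, (supdist T S St w < chi%:E)%E}])
  /\ local_martingale P T (join_filtration F (aug_nat_filtration P B)) S.
Proof.
move=> T0 ucF g_ge0 g_convex g0 chi0 bB ind cS lmS stS.
have filF : filtration T F by case: ucF.
have T0T : 0 <= T <= T by rewrite lexx ltW.
have filG := aug_nat_filtration_filtration T0 ucF bB.
have sGT : sub_sigma (aug_nat_filtration P B T) by case: filG => + _; exact.
have rcS w i t : 0 <= t < T -> (fun u => S u w ord0 i) @ t^'+ --> S t w ord0 i.
  by case: (cS w i) => + _; exact.
have adS t i := @local_martingale_adapted _ _ _ P T F n S ucF lmS t i.
split; last first.
  have [tau [stau ndtau aeT Mtau]] := lmS.
  exists tau; split=> // k; last exact: martingale_join.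
  have [tau0T Ftau] := stau k; split=> // t t0T.
  by apply: sub_sigma_algebra; left; exact: Ftau.
(* The total variation is at most twice P(tau < T), hence below chi / 2. *)
have chi4 : 0 < chi / 4 by rewrite divr_gt0.
have [tau [st MS Ptau]] := local_martingale_large_time T0 ucF lmS chi4.
have tv_lt : ((fine (P [set w | (tau w < T)%R]) *+ 2)%:E < chi%:E)%E.
  rewrite lte_fin mulr2n.
  have : fine (P [set w | (tau w < T)%R]) < chi / 4.
    rewrite -lte_fin fineK// fin_num_measure//.
    exact: (sub_sigmaW (usual_sub_sigmaT T0 ucF)) (stopping_time_ltT T0 ucF st).
  lra.
have [ctS|nctS] := pselect (cont_paths T S); last first.
  have [Q [Z [mZ Z0 QE QP gD]]] :=
    jump_case T0 ucF g_ge0 g_convex g0 chi0 cS adS stS st.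
  exists Q, (stopped S tau); split=> //.
  - exact: (change_equiv T0 ucF mZ Z0 QE).
  - exact: le_lt_trans (change_tv_dist T0 ucF st mZ Z0 QE QP) tv_lt.
  - apply: martingale_join => //; first exact: (change_indep T0 ucF mZ Z0 QE).
    exact: (change_martingale ucF st QP rcS adS MS).
  - split=> //.
    exact: (measurable_gext_supdist_stopped T0 ucF g_ge0 g_convex g0 cS adS st).
have [del /andP[del0 del_chi] gdel] := convex_loss_small g_ge0 g_convex g0 chi0 chi0.
(* Each of the n coordinates is off by at most 2 kappa, which adds up to at most del; n + 1 avoids
   dividing by 0 when n = 0. *)
pose kappa := del / (n.+1 * 2)%:R.
have k0 : 0 < kappa by rewrite divr_gt0.
have kn : kappa * (n.+1 * 2)%:R = del by rewrite divfK// pnatr_eq0.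
have [Q [Z [V [[mZ Z0] QE QP MV nV]]]] :=
  continuous_case T0 ucF rcS adS stS st k0 ctS MS.
have nullQP := change_Pnull T0 ucF mZ Z0 QE.
have FN t : 0 <= t <= T -> Pnull Q `<=` F t.
  by move=> t0T; rewrite nullQP; exact: (usual_Pnull ucF t0T).
have nE t : 0 <= t <= T -> Pnull Q [set w | ~ (enorm (S t w - V t w) <= del)].
  move=> t0T.
  (* The finitely many coordinate events, padded with empty sets to a sequence. *)
  pose N k := if insub k is Some i
    then [set w | ~ (`|S t w ord0 i - V t w ord0 i| <= kappa *+ 2)] else set0.
  have nN k : Pnull Q (N k).
    rewrite /N; case: insub => [i|]; first exact: nV.
    by exists set0; split=> //; exact: measure0.
  apply: Pnull_sub (Pnull_bigcup nN) => w /= nle; apply: contrapT => nN'; apply: nle.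
  apply: (le_trans (enorm_le_sum _)).
  apply: (@le_trans _ _ (\sum_(i < n) kappa *+ 2)).
    apply: ler_sum => i _; rewrite !mxE; apply: contrapT => nle; apply: nN'.
    by exists i => //; rewrite /N valK.
  rewrite sumr_const card_ord -mulrnA -[kappa *+ _]mulr_natr -kn.
  by rewrite ler_wpM2l ?(ltW k0)// ler_nat mulnC leq_mul2r leqnSn orbT.
have [St [MSt mSt St01]] := martingale_regularize filF T0 (ltW del0) FN adS MV nE.
have Sfin w : supdist T S St w \is a fin_num.
  have /andP[s0 s1] := St01 w.
  by rewrite ge0_fin_numE// (le_lt_trans s1)// ltry.
have S0 w : (0 <= supdist T S St w)%E by case/andP: (St01 w).
have mgS := measurable_gext g_ge0 g_convex g0 mSt Sfin S0.
exists Q, St; split.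
- exact: (change_equiv T0 ucF mZ Z0 QE).
- exact: le_lt_trans (change_tv_dist T0 ucF st mZ Z0 QE QP) tv_lt.
- by apply: martingale_join => //; exact: (change_indep T0 ucF mZ Z0 QE).
- split=> //; apply: (@le_lt_trans _ _ (\int[Q]_w (cst (g del)%:E) w)%E).
    apply: ge0_le_integral => //.
    + by move=> w _; rewrite gext_fin// lee_fin g_ge0// le_max lexx orbT.
    + move=> w _; rewrite gext_fin// lee_fin.
      apply: (convex_loss_nd g_ge0 g_convex g0); first by rewrite le_max lexx orbT.
      rewrite ge_max (ltW del0) andbT -lee_fin fineK//.
      by case/andP: (St01 w).
  rewrite integral_cst// [X in (_ * X)%E](probability_setT Q) mule1 lte_fin.
  exact: gdel.
- move=> _; apply: aeW => w; have /andP[_ le_del] := St01 w.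
  by apply: (le_lt_trans le_del); rewrite lte_fin.
Qed.
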